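(* $\textsc{BNSL}^{+}$ is fixed-parameter tractable when parameterized by the treewidth of the superstructure graph. Moreover, $\textsc{BNSL}^{+}_{\leq}$ is fixed-parameter tractable when parameterized by $q$ plus the treewidth of the superstructure graph.
   Context: Let $V$ be a finite set and $\mathcal{F}=\{f_v:2^{V\setminus\{v\}}\to\mathbb{N}_0 : v\in V\}$. For a digraph $D=(V,A)$ let $P_D(v)=\{u:uv\in A\}$ and $\texttt{score}(D)=\sum_v f_v(P_D(v))$. In the additive representation, $f_v(Q)=\sum_{x\in Q}f_v(\{x\})$ for all $v$ and $Q\subseteq V\setminus\{v\}$, and $\mathcal{F}$ is given by the values $f_v(\{x\})$ that are non-zero. $\textsc{BNSL}^{+}$: given $V$, $\mathcal{F}$ in the additive representation and an integer $\ell$, decide whether there is an acyclic digraph $D$ on $V$ with $\texttt{score}(D)\geq\ell$. $\textsc{BNSL}^{+}_{\leq}$: additionally an integer $q$ is given and $D$ must have all in-degrees at most $q$. The superstructure graph $G=(V,E)$ has $ab\in E$ iff $f_b(\{a\})\neq0$ or $f_a(\{b\})\neq 0$. Fixed-parameter tractable means solvable in time $f(k)\cdot n^{O(1)}$ for a computable $f$ of the parameter $k$. *)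

(* Defs.v *)
From Corelib Require Import BinNums.
From HB Require Import structures.
From mathcomp Require Import all_boot all_order all_algebra.
From mathcomp Require Import boolp.

Set Implicit Arguments.
Unset Strict Implicit.
Unset Printing Implicit Defensive.

(** * Model of computation

    First-order LISP-like programs over binary trees (the language F of
    N. D. Jones, "Computability and Complexity from a Programming
    Perspective", with several mutually recursive functions).  A program is a
    list of bodies of unary functions; function 0 is the entry point.  The
    running time is the number of evaluation steps.  With trees stored as
    shared pointer structures every step is a constant number of pointer
    operations, so time agrees with Turing machine time up to a polynomial,
    and bounds of the form f(k) * n^O(1) do not depend on the choice. *)

Inductive tree := Leaf | Node of tree & tree.

Fixpoint tree_size (t : tree) : nat :=
  if t is Node a b then (tree_size a + tree_size b).+1 else 1.

Definition tfst (t : tree) : tree := if t is Node a _ then a else Leaf.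
Definition tsnd (t : tree) : tree := if t is Node _ b then b else Leaf.

Inductive expr :=
  | EArg                          (* the argument of the current function *)
  | ELeaf
  | ENode of expr & expr
  | EFst of expr
  | ESnd of expr
  | EIf of expr & expr & expr     (* Leaf is false, any Node is true *)
  | ECall of nat & expr.

Definition program := seq expr.

(* [eval p e x v t]: with argument [x], [e] evaluates to [v] in [t] steps. *)
Inductive eval (p : program) : expr -> tree -> tree -> nat -> Prop :=
  | eval_arg x : eval p EArg x x 1
  | eval_leaf x : eval p ELeaf x Leaf 1
  | eval_node e1 e2 x v1 v2 t1 t2 :
      eval p e1 x v1 t1 -> eval p e2 x v2 t2 ->
      eval p (ENode e1 e2) x (Node v1 v2) (t1 + t2).+1
  | eval_fst e x v t : eval p e x v t -> eval p (EFst e) x (tfst v) t.+1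
  | eval_snd e x v t : eval p e x v t -> eval p (ESnd e) x (tsnd v) t.+1
  | eval_ifT e e1 e2 x a b v t t1 :
      eval p e x (Node a b) t -> eval p e1 x v t1 ->
      eval p (EIf e e1 e2) x v (t + t1).+1
  | eval_ifF e e1 e2 x v t t2 :
      eval p e x Leaf t -> eval p e2 x v t2 ->
      eval p (EIf e e1 e2) x v (t + t2).+1
  | eval_call g e x y v t1 t2 :
      eval p e x y t1 -> eval p (nth ELeaf p g) y v t2 ->
      eval p (ECall g e) x v (t1 + t2).+1.

Definition run (p : program) (x v : tree) (t : nat) : Prop :=
  eval p (nth ELeaf p 0) x v t.

Lemma eval_det p e x v t v' t' :
  eval p e x v t -> eval p e x v' t' -> v = v' /\ t = t'.
Proof.
move=> H; move: v' t'.
induction H; intros v' t' H'; inversion H'; subst;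
  repeat match goal with
  | IH : forall v t, eval p ?e ?x v t -> _, K : eval p ?e ?x _ _ |- _ =>
      let E := fresh in
      case: (IH _ _ K) => E ?; try discriminate E; clear K; subst
  end; done.
Qed.

(** * Encodings *)

Definition enc_bool (b : bool) : tree := if b then Node Leaf Leaf else Leaf.

Definition enc_seq (s : seq tree) : tree := foldr Node Leaf s.

Definition enc_unary (n : nat) : tree := iter n (Node Leaf) Leaf.

(* Binary digits, least significant first. *)
Fixpoint pos_bits (p : positive) : seq bool :=
  match p with
  | xH => [:: true]
  | xO p' => false :: pos_bits p'
  | xI p' => true :: pos_bits p'
  end.

Definition nat_bits (n : nat) : seq bool :=
  match bin_of_nat n with N0 => [::] | Npos p => pos_bits p end.

Definition enc_nat (n : nat) : tree := enc_seq (map enc_bool (nat_bits n)).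

Definition enc_int (z : int) : tree :=
  match z with
  | Posz n => Node (enc_bool false) (enc_nat n)
  | Negz n => Node (enc_bool true) (enc_nat n.+1)
  end.

(** * Fixed-parameter tractability *)

Definition computable (f : nat -> nat) : Prop :=
  exists p : program,
    forall n, exists t, run p (enc_unary n) (enc_unary (f n)) t.

(* The value of the parameter is not part of the input. *)
Definition fpt (I : Type) (enc : I -> tree) (yes : I -> Prop)
    (kappa : I -> nat) : Prop :=
  exists (p : program) (f : nat -> nat) (c : nat),
    computable f /\
    forall i : I, exists (v : tree) (t : nat),
      [/\ run p (enc i) v t,
          t <= f (kappa i) * tree_size (enc i) ^ c
        & v <> Leaf <-> yes i].

(** * Treewidth of a simple graph, given by its adjacency relation *)

Definition is_tree (T : finType) (e : rel T) : Prop :=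
  [/\ 0 < #|T|, symmetric e, irreflexive e,
      forall x y, connect e x y
    & forall s, ucycle e s -> size s <= 2].

Definition tree_decomposition (V : finType) (G : rel V)
    (T : finType) (e : rel T) (bag : T -> {set V}) : Prop :=
  [/\ is_tree e,
      forall v, exists t, v \in bag t,
      forall u v, G u v -> exists2 t, u \in bag t & v \in bag t
    & forall v s t, v \in bag s -> v \in bag t ->
        connect [rel x y | [&& e x y, v \in bag x & v \in bag y]] s t].

(* The width is the largest bag size minus one. *)
Definition width_le (V : finType) (G : rel V) (k : nat) : Prop :=
  exists (T : finType) (e : rel T) (bag : T -> {set V}),
    tree_decomposition G e bag /\ forall t, #|bag t| <= k.+1.

Lemma width_le_exists (V : finType) (G : rel V) :
  exists k, `[< width_le G k >].
Proof.
exists #|V|; apply/asboolP; exists unit, [rel _ _ | false], (fun=> setT).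
split; last by move=> _; rewrite cardsT.
split.
- split=> //; first by rewrite card_unit.
    by case=> -[].
  move=> [|[] [|[] s]] //.
- by move=> v; exists tt; rewrite inE.
- by move=> u v _; exists tt; rewrite inE.
- by move=> v [] [].
Qed.

(* The graph without vertices gets treewidth 0. *)
Definition treewidth (V : finType) (G : rel V) : nat :=
  ex_minn (width_le_exists G).

(** * Bayesian network structure learning *)

(* The functions f_v : 2^(V \ {v}) -> N_0; the value of [F v] on a set
   containing [v] is irrelevant and never used. *)
Definition score_family (V : finType) := V -> {set V} -> nat.

Definition is_additive (V : finType) (F : score_family V) : Prop :=
  forall (v : V) (Q : {set V}),
    v \notin Q -> F v Q = \sum_(x in Q) F v [set x].

Definition superstructure (V : finType) (F : score_family V) : rel V :=
  [rel a b | (a != b) && ((F b [set a] != 0) || (F a [set b] != 0))].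

Definition parents (V : finType) (D : rel V) (v : V) : {set V} :=
  [set u | D u v].

(* A loop is a cycle of length 1. *)
Definition acyclic (V : finType) (D : rel V) : Prop :=
  forall s, ucycle D s -> s = [::].

Definition score (V : finType) (F : score_family V) (D : rel V) : nat :=
  \sum_(v : V) F v (parents D v).

Record bnsl := Bnsl {
  nvert : nat;
  local_scores : score_family 'I_nvert;
  scores_additive : is_additive local_scores;
  target : int
}.

Record bnsl_bounded := BnslBounded {
  bnsl_part :> bnsl;
  indeg_bound : nat
}.

Definition bnsl_yes (I : bnsl) : Prop :=
  exists D : rel 'I_(nvert I),
    acyclic D /\ (target I <= (score (@local_scores I) D)%:Z)%R.

Definition bnsl_bounded_yes (I : bnsl_bounded) : Prop :=
  exists D : rel 'I_(nvert I),
    [/\ acyclic D,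
        forall v, #|parents D v| <= indeg_bound I
      & (target I <= (score (@local_scores I) D)%:Z)%R].

Definition bnsl_treewidth (I : bnsl) : nat :=
  treewidth (superstructure (@local_scores I)).

(* The triples (v, x, f_v({x})) with x != v and f_v({x}) != 0. *)
Definition enc_family (n : nat) (F : score_family 'I_n) : tree :=
  enc_seq
    [seq Node (enc_nat vx.1) (Node (enc_nat vx.2) (enc_nat (F vx.1 [set vx.2])))
       | vx : 'I_n * 'I_n <- enum {: 'I_n * 'I_n}
       & (vx.2 != vx.1) && (F vx.1 [set vx.2] != 0)].

Definition enc_bnsl (I : bnsl) : tree :=
  Node (enc_seq (map enc_nat (iota 0 (nvert I))))
       (Node (enc_family (@local_scores I)) (enc_int (target I))).

Definition enc_bnsl_bounded (I : bnsl_bounded) : tree :=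
  Node (enc_nat (indeg_bound I)) (enc_bnsl I).

(* Main.v *)
From Corelib Require Import BinNums.
From HB Require Import structures.
Require Import Defs.
From mathcomp Require Import all_boot all_order all_algebra.
From mathcomp Require Import boolp zify.

Set Implicit Arguments.
Unset Strict Implicit.
Unset Printing Implicit Defensive.

(** The problem is to choose a linear order of the vertices and arcs that go
    forward in it.  The algorithm runs through the stages k = 0, 1, 2, ...

    Stage k first looks for an elimination order of width O(k) in the manner of
    Robertson and Seymour.  As long as the neighbourhood S of the component that
    is being split is small, any vertex is chosen next; when |S| reaches 8k + 11,
    a set X of at most k + 1 vertices that separates two sets of 2k + 3 vertices
    of S is added, so that the new components have small neighbourhoods again.
    Such an X exists when the treewidth is at most k: take a bag of a tree
    decomposition and a union of components behind it.  It is found by an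
    augmenting path computation in the network whose nodes are the halves of the
    vertices.

    Then the vertices are eliminated one by one.  The table of a factor gives the
    best value for every linear order of its scope and all numbers of parents
    already chosen; linear orders that agree on the common part of two scopes can
    be amalgamated, so no further condition is needed for acyclicity.

    Running times are bounded by the closure properties of the polynomial time
    functions [P]: stage k is polynomial in the size of the input together with a
    unary padding of length C^(2^k), which also cuts off the enumerations and
    tables that are exponential in k. *)

(** The treewidth is not part of the input, so [k] is a guess. A stage answers as soon as [q <= k]
    and no separator was missing while its order was built, whether or not the treewidth is at most
    [k]: such an order has width at most 9k + 13, and this alone makes the tables exact. Small
    treewidth only shows that some stage not above the parameter succeeds. The constants, with x = k
    + 1: adding X and one vertex enlarges a boundary by at most x + 1, so the new boundary must miss
    x + 1 vertices of S; sets of a = 2x + 1 vertices, at most x of them in X, ensure this.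
    Collecting branches behind a bag until they hold a vertices of S stops below 2a + x, and the bag
    takes x more, so 3a + 2x = 8x + 3 vertices of S leave a on the other side. The padding starts at
    C and is squared from stage to stage, a polynomial time step; C^(2^k) exceeds (100x)^(100x),
    which bounds all enumerations and tables. Both problems are one: a chosen arc adds [delta] to
    the parent count of its head, with [delta] 0 in the unbounded and 1 in the bounded problem. *)

(** * Linking programs *)

(* Calls beyond the end of a program evaluate [ELeaf]; after relocation they go
   to the extra [ELeaf] that [blk] puts at the end of the block. *)
Fixpoint reloc (n off : nat) (e : expr) : expr :=
  match e with
  | EArg => EArg
  | ELeaf => ELeaf
  | ENode a b => ENode (reloc n off a) (reloc n off b)
  | EFst a => EFst (reloc n off a)
  | ESnd a => ESnd (reloc n off a)
  | EIf a b c => EIf (reloc n off a) (reloc n off b) (reloc n off c)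
  | ECall g a => ECall (off + minn g n) (reloc n off a)
  end.

Definition blk (off : nat) (p : program) : program :=
  rcons (map (reloc (size p) off) p) ELeaf.

Lemma size_blk off p : size (blk off p) = (size p).+1.
Proof. by rewrite size_rcons size_map. Qed.

Lemma nth_blk pre p post g :
  nth ELeaf (pre ++ blk (size pre) p ++ post) (size pre + minn g (size p)) =
  reloc (size p) (size pre) (nth ELeaf p g).
Proof.
rewrite nth_cat ltnNge leq_addr /= addKn nth_cat size_blk ltnS geq_minr.
rewrite nth_rcons size_map; case: (ltnP g (size p)) => h.
  by rewrite h (nth_map ELeaf).
by rewrite ltnn eqxx [nth _ p g]nth_default.
Qed.

Lemma eval_reloc pre p post e x v t : eval p e x v t ->
  eval (pre ++ blk (size pre) p ++ post) (reloc (size p) (size pre) e) x v t.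
Proof.
elim=> /=; intros; try (by econstructor; eauto).
apply: eval_call; first by eassumption.
by rewrite nth_blk.
Qed.

Definition calls (q : program) (i : nat) (p : program) :=
  forall x v t, run p x v t -> eval q (nth ELeaf q i) x v t.

Lemma calls_blk pre p post : calls (pre ++ blk (size pre) p ++ post) (size pre) p.
Proof.
move=> x v t /(eval_reloc pre post); rewrite -(nth_blk _ _ post) min0n addn0.
by [].
Qed.

Definition link4 (m : program) (a b c d : program) : program :=
  let o1 := size m in
  let o2 := o1 + (size a).+1 in
  let o3 := o2 + (size b).+1 in
  let o4 := o3 + (size c).+1 in
  m ++ blk o1 a ++ blk o2 b ++ blk o3 c ++ blk o4 d.

(** The main body is abstracted over the four entry points, which are fixed only by linking. It
    stands at index 0, so it can also call itself; the recursion scheme relies on this. *)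
Lemma link4P (m : nat -> nat -> nat -> nat -> expr) a b c d :
  exists q i j k l, [/\ nth ELeaf q 0 = m i j k l,
     calls q i a, calls q j b, calls q k c & calls q l d].
Proof.
pose o1 := 1; pose o2 := o1 + (size a).+1; pose o3 := o2 + (size b).+1.
pose o4 := o3 + (size c).+1.
exists (link4 [:: m o1 o2 o3 o4] a b c d), o1, o2, o3, o4.
rewrite /link4 /=; split=> //.
- exact: (@calls_blk [:: _] a).
- have := @calls_blk ([:: m o1 o2 o3 o4] ++ blk o1 a) b.
  by rewrite /= size_blk => /(_ (blk o3 c ++ blk o4 d)).
- have := @calls_blk ([:: m o1 o2 o3 o4] ++ blk o1 a ++ blk o2 b) c (blk o4 d).
  by rewrite /= size_cat !size_blk /= -!catA /= -addSn.
- have := @calls_blk ([:: m o1 o2 o3 o4] ++ blk o1 a ++ blk o2 b ++ blk o3 c) d [::].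
  by rewrite /= !size_cat !size_blk /= cats0 -!catA /= -!addSn !addnA.
Qed.

(** * Encodable types *)

(** Injectivity allows equality of values to be decided by comparing trees. *)
HB.mixin Record hasEnc T of Equality T := {
  enc : T -> tree;
  enc_inj : injective enc
}.
#[short(type="encType")]
HB.structure Definition Encodable := { T of hasEnc T & Equality T }.

Definition esize (A : encType) (x : A) := tree_size (enc x).

Lemma tree_size_gt0 t : 0 < tree_size t. Proof. by case: t. Qed.
Lemma esize_gt0 (A : encType) (x : A) : 0 < esize x.
Proof. exact: tree_size_gt0. Qed.

Lemma enc_bool_inj : injective enc_bool. Proof. by case; case. Qed.
HB.instance Definition _ := hasEnc.Build bool enc_bool_inj.

Lemma enc_unit_inj : injective (fun _ : unit => Leaf).
Proof. by case; case. Qed.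
HB.instance Definition _ := hasEnc.Build unit enc_unit_inj.

Definition enc_prod (A B : encType) (z : A * B) := Node (enc z.1) (enc z.2).
Lemma enc_prod_inj (A B : encType) : injective (@enc_prod A B).
Proof. by move=> [a b] [c d] [] /enc_inj -> /enc_inj ->. Qed.
HB.instance Definition _ (A B : encType) :=
  hasEnc.Build (A * B)%type (@enc_prod_inj A B).

Lemma enc_seq_inj : injective enc_seq.
Proof. by elim=> [|a s IH] [|b t] //= [-> /IH ->]. Qed.

Definition enc_list (A : encType) (s : seq A) := enc_seq (map enc s).
Lemma enc_list_inj (A : encType) : injective (@enc_list A).
Proof. by move=> s t /enc_seq_inj; apply: inj_map; apply: enc_inj. Qed.
HB.instance Definition _ (A : encType) :=
  hasEnc.Build (seq A) (@enc_list_inj A).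

Lemma pos_bits_inj : injective pos_bits.
Proof.
elim=> [p IH|p IH|] [q|q|] //= [].
- by move/IH=> ->.
- by case: (p).
- by move/IH=> ->.
- by case: (q).
Qed.

Lemma nat_bits_inj : injective nat_bits.
Proof.
move=> m n h; apply: (can_inj bin_of_natK); move: h; rewrite /nat_bits.
case: (bin_of_nat m) (bin_of_nat n) => [|p] [|q] //.
- by case: q.
- by case: p.
- by move/pos_bits_inj=> ->.
Qed.

Lemma enc_nat_inj : injective enc_nat.
Proof. move=> m n /enc_seq_inj /(inj_map enc_bool_inj); exact: nat_bits_inj. Qed.
HB.instance Definition _ := hasEnc.Build nat enc_nat_inj.

Lemma encE (A B : encType) (z : A * B) : enc z = Node (enc z.1) (enc z.2).
Proof. by []. Qed.
Lemma enc_cons (A : encType) (x : A) (s : seq A) : enc (x :: s) = Node (enc x) (enc s).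
Proof. by []. Qed.
(** Lists over [unit] serve as unary numbers: they make loop counters and padding ordinary values of
    an encodable type. *)
Lemma enc_fuel n : enc (nseq n tt) = enc_unary n.
Proof. by elim: n => //= n; rewrite enc_cons => ->. Qed.

Lemma esize_pair (A B : encType) (x : A) (y : B) : esize (x, y) = (esize x + esize y).+1.
Proof. by []. Qed.
Lemma esizeE (A B : encType) (z : A * B) : esize z = (esize z.1 + esize z.2).+1.
Proof. by []. Qed.
Lemma esize_cons (A : encType) (x : A) (s : seq A) : esize (x :: s) = (esize x + esize s).+1.
Proof. by []. Qed.
Lemma esize_nil (A : encType) : esize ([::] : seq A) = 1.
Proof. by []. Qed.
Lemma esize_natE (n : nat) : esize n = esize (nat_bits n). Proof. by []. Qed.
Lemma esize_seq (A : encType) (s : seq A) : esize s = (\sum_(x <- s) (esize x).+1).+1.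
Proof. by elim: s => [|x s IH]; rewrite ?big_nil // esize_cons IH big_cons; lia. Qed.
Lemma size_le_esize (A : encType) (s : seq A) : size s <= esize s.
Proof. by elim: s => //= x s; rewrite esize_cons; lia. Qed.
Lemma esize_mem (A : encType) (x : A) (s : seq A) : x \in s -> esize x <= esize s.
Proof.
elim: s => //= y s IH; rewrite inE esize_cons => /orP[/eqP->|/IH]; lia.
Qed.
Lemma esize_fuel (s : seq unit) : esize s = (size s).*2.+1.
Proof. by elim: s => //= -[] s IH; rewrite esize_cons IH /esize /=; lia. Qed.

(** * Polynomial bounds *)

Lemma leq_exp2r' m n c : m <= n -> m ^ c <= n ^ c.
Proof. by case: c => // c h; rewrite leq_exp2r. Qed.


(** One constant is both factor and exponent; since every encoding has size at least 1, the bound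
    grows with [c] and two bounds can be merged. *)
Definition pb (E : encType) (n : E -> nat) :=
  exists c, forall e, n e <= c * esize e ^ c.

Section PB.
Variable E : encType.
Implicit Types n m : E -> nat.

Lemma pb_le n m : pb m -> (forall e, n e <= m e) -> pb n.
Proof. by move=> [c h] le; exists c => e; apply: leq_trans (le e) (h e). Qed.
Lemma pb_const k : pb (fun _ : E => k).
Proof. by exists k => e; rewrite leq_pmulr // expn_gt0 esize_gt0. Qed.
Lemma pb_esize : pb (@esize E).
Proof. by exists 1 => e; rewrite mul1n expn1. Qed.
Lemma pb_add n m : pb n -> pb m -> pb (fun e => n e + m e).
Proof.
move=> [c h] [d k]; exists (c + d) => e; rewrite mulnDl; apply: leq_add.
  by apply: leq_trans (h e) _; apply: leq_mul => //; apply: leq_pexp2l (leq_addr _ _); apply: esize_gt0.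
by apply: leq_trans (k e) _; apply: leq_mul => //; apply: leq_pexp2l (leq_addl _ _); apply: esize_gt0.
Qed.
Lemma pb_mul n m : pb n -> pb m -> pb (fun e => n e * m e).
Proof.
move=> [c h] [d k]; exists (c * d + (c + d)) => e.
apply: leq_trans (leq_mul (h e) (k e)) _.
rewrite mulnACA -expnD; apply: leq_mul; first exact: leq_addr.
by apply: leq_pexp2l; [exact: esize_gt0 | exact: leq_addl].
Qed.
Lemma pb_S n : pb n -> pb (fun e => (n e).+1).
Proof. by move=> h; apply: (pb_le (pb_add h (pb_const 1))) => e; rewrite addn1. Qed.
Lemma pb_exp n k : pb n -> pb (fun e => n e ^ k).
Proof.
move=> h; elim: k => [|k IH]; first exact: pb_const.
by apply: (pb_le (pb_mul h IH)) => e; rewrite expnS.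
Qed.
Lemma pb_poly n c : pb n -> pb (fun e => c * n e ^ c).
Proof. by move=> h; apply: pb_mul; [exact: pb_const | exact: pb_exp]. Qed.
Lemma pb_comp (A : encType) (f : E -> A) (n : A -> nat) :
  pb n -> pb (fun e => esize (f e)) -> pb (fun e => n (f e)).
Proof. by move=> [c h] k; apply: (pb_le (pb_poly c k)) => e; apply: h. Qed.
End PB.

(** * Functions computable in polynomial time *)

(** The size of the result is bounded separately: evaluation shares subtrees, so a tree can double
    in a constant number of steps and time does not control size. *)
Definition P (E A : encType) (f : E -> A) :=
  pb (fun e => esize (f e)) /\
  exists p T, pb T /\
    forall e, exists2 t, run p (enc e) (enc (f e)) t & t <= T e.

Section Basic.
Variable E : encType.

Lemma P_size (A : encType) (f : E -> A) : P f -> pb (fun e => esize (f e)).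
Proof. by case. Qed.

Lemma P_ext (A : encType) (f g : E -> A) : P f -> f =1 g -> P g.
Proof. by move=> Pf /funext <-. Qed.

(** A program sees only encodings. Thus pairing also computes [::], and a number is the same datum
    as its list of digits. *)
Lemma P_tree (A B : encType) (f : E -> A) (g : E -> B) :
  P f -> (forall e, enc (f e) = enc (g e)) -> P g.
Proof.
move=> [hs [p [T [hT hp]]]] h; split.
  by apply: (pb_le hs) => e; rewrite /esize h.
by exists p, T; split=> // e; rewrite -h; apply: hp.
Qed.

Lemma P_expr (A : encType) (f : E -> A) (ex : expr) (c : nat) :
  (forall p e, exists2 t, eval p ex (enc e) (enc (f e)) t & t <= c) ->
  (pb (fun e => esize (f e))) -> P f.
Proof.
move=> h hs; split=> //; exists [:: ex], (fun=> c); split; first exact: pb_const.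
by move=> e; apply: h.
Qed.

Lemma P_id : P (fun e : E => e).
Proof.
apply: (@P_expr _ _ EArg 1); last exact: pb_esize.
by move=> p e; exists 1 => //; constructor.
Qed.

Fixpoint lit (t : tree) := if t is Node a b then ENode (lit a) (lit b) else ELeaf.
Lemma eval_lit p x t : eval p (lit t) x t (tree_size t).
Proof. by elim: t => [|a IHa b IHb] /=; constructor. Qed.

Lemma P_const (A : encType) (a : A) : P (fun _ : E => a).
Proof.
apply: (@P_expr _ _ (lit (enc a)) (esize a)); last exact: pb_const.
by move=> p e; exists (esize a) => //; apply: eval_lit.
Qed.

End Basic.

Section Combine.
Variable E : encType.

Lemma P_comp (A B : encType) (g : A -> B) (f : E -> A) : P g -> P f -> P (fun e => g (f e)).
Proof.
move=> [sg [p [T [hT hp]]]] [sf [q [U [hU hq]]]]; split; first exact: pb_comp sg sf.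
have [r [i [j [_ [_ [r0 ci cj _ _]]]]]] :=
  link4P (fun i j _ _ => ECall i (ECall j EArg)) p q [::] [::].
exists r, (fun e => T (f e) + U e + 3); split.
  by apply: pb_add (pb_const _ _); apply: pb_add hU; apply: pb_comp hT sf.
move=> e; have [t rt let_] := hp (f e); have [u ru leu] := hq e.
exists (((1 + u).+1 + t).+1); last by lia.
rewrite /run r0; apply: eval_call; last exact: ci rt.
by apply: eval_call; [apply: eval_arg | exact: cj ru].
Qed.

Lemma P_pair (A B : encType) (f : E -> A) (g : E -> B) :
  P f -> P g -> P (fun e => (f e, g e)).
Proof.
move=> [sg [p [T [hT hp]]]] [sf [q [U [hU hq]]]]; split.
  by apply: (pb_le (pb_S (pb_add sg sf))) => e; rewrite esize_pair.
have [r [i [j [_ [_ [r0 ci cj _ _]]]]]] :=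
  link4P (fun i j _ _ => ENode (ECall i EArg) (ECall j EArg)) p q [::] [::].
exists r, (fun e => T e + U e + 5); split.
  by apply: pb_add (pb_const _ _); apply: pb_add hU.
move=> e; have [t rt let_] := hp e; have [u ru leu] := hq e.
exists (((1 + t).+1 + (1 + u).+1).+1); last by lia.
rewrite /run r0; apply: eval_node; (apply: eval_call; first exact: eval_arg); [exact: ci rt|exact: cj ru].
Qed.

Lemma P_if (A : encType) (b : E -> bool) (f g : E -> A) :
  P b -> P f -> P g -> P (fun e => if b e then f e else g e).
Proof.
move=> [sb [p [T [hT hp]]]] [sf [q [U [hU hq]]]] [sg [o [W [hW ho]]]]; split.
  by apply: (pb_le (pb_add sf sg)) => e; case: ifP => _; lia.
have [r [i [j [k [_ [r0 ci cj ck _]]]]]] :=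
  link4P (fun i j k _ => EIf (ECall i EArg) (ECall j EArg) (ECall k EArg)) p q o [::].
exists r, (fun e => T e + U e + W e + 5); split.
  by apply: pb_add (pb_const _ _); apply: pb_add hW; apply: pb_add hU.
move=> e; have [t rt let_] := hp e; have [u ru leu] := hq e; have [w rw lew] := ho e.
rewrite /run r0; case E1: (b e) rt => rt.
  exists (((1 + t).+1 + (1 + u).+1).+1); last by lia.
  apply: (@eval_ifT _ _ _ _ _ Leaf Leaf).
    by apply: eval_call; [exact: eval_arg | exact: ci rt].
  by apply: eval_call; [exact: eval_arg | exact: cj ru].
exists (((1 + t).+1 + (1 + w).+1).+1); last by lia.
apply: eval_ifF.
  by apply: eval_call; [exact: eval_arg | exact: ci rt].
by apply: eval_call; [exact: eval_arg | exact: ck rw].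
Qed.

Lemma P_app2 (A B C : encType) (h : A -> B -> C) (f : E -> A) (g : E -> B) :
  P (fun z : A * B => h z.1 z.2) -> P f -> P g -> P (fun e => h (f e) (g e)).
Proof. by move=> Ph Pf Pg; apply: (P_comp Ph (P_pair Pf Pg)). Qed.

Lemma P_fst (A B : encType) (f : E -> A * B) : P f -> P (fun e => (f e).1).
Proof.
apply: P_comp; apply: (@P_expr _ _ _ (EFst EArg) 2).
  by move=> p e; exists 2 => //; apply: (@eval_fst _ _ _ (enc e)); constructor.
by apply: (pb_le (@pb_esize _)) => e; rewrite esizeE; lia.
Qed.
Lemma P_snd (A B : encType) (f : E -> A * B) : P f -> P (fun e => (f e).2).
Proof.
apply: P_comp; apply: (@P_expr _ _ _ (ESnd EArg) 2).
  by move=> p e; exists 2 => //; apply: (@eval_snd _ _ _ (enc e)); constructor.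
by apply: (pb_le (@pb_esize _)) => e; rewrite esizeE; lia.
Qed.
Lemma P_cons (A : encType) (f : E -> A) (g : E -> seq A) : P f -> P g -> P (fun e => f e :: g e).
Proof. by move=> Pf Pg; apply: (P_tree (P_pair Pf Pg)). Qed.
Lemma P_behead (A : encType) (f : E -> seq A) : P f -> P (fun e => behead (f e)).
Proof.
apply: P_comp; apply: (@P_expr _ _ _ (ESnd EArg) 2).
  move=> p e; exists 2 => //.
  by have := @eval_snd p EArg (enc e) (enc e) 1 (@eval_arg _ _); case: e.
by apply: (pb_le (@pb_esize _)) => -[|x s] //=; rewrite esize_cons; lia.
Qed.
Lemma P_head (A : encType) (a : A) (f : E -> seq A) : P f -> P (fun e => head a (f e)).
Proof.
move=> Pf; apply: (P_comp _ Pf); apply: (@P_expr _ _ _ (EIf EArg (EFst EArg) (lit (enc a))) (4 + esize a)).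
  move=> p [|x s] /=.
    exists ((1 + esize a).+1); last by lia.
    by apply: eval_ifF; [apply: eval_arg | apply: eval_lit].
  exists ((1 + 2).+1); last by lia.
  apply: (@eval_ifT _ _ _ _ _ (enc x) (enc s)); first exact: eval_arg.
  by apply: (@eval_fst _ _ _ (enc (x :: s))); constructor.
apply: (pb_le (pb_add (@pb_esize _) (pb_const _ (esize a)))) => -[|x s] /=; rewrite ?esize_cons; lia.
Qed.
Lemma P_nilp (A : encType) (f : E -> seq A) : P f -> P (fun e => nilp (f e)).
Proof.
apply: P_comp; apply: (@P_expr _ _ _ (EIf EArg ELeaf (ENode ELeaf ELeaf)) 5).
  move=> p [|x s] /=.
    by exists ((1 + 3).+1) => //; apply: eval_ifF; [exact: eval_arg | exact: (eval_node (eval_leaf _ _) (eval_leaf _ _))].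
  exists ((1 + 1).+1) => //.
  by apply: (@eval_ifT _ _ _ _ _ (enc x) (enc s)); [exact: eval_arg | exact: eval_leaf].
by apply: (pb_le (pb_const _ 3)) => -[].
Qed.
Lemma P_negb (f : E -> bool) : P f -> P (fun e => ~~ f e).
Proof.
move=> Pf; apply: (P_ext (P_if Pf (P_const _ false) (P_const _ true))) => e.
by case: (f e).
Qed.
Lemma P_andb (f g : E -> bool) : P f -> P g -> P (fun e => f e && g e).
Proof. by move=> Pf Pg; apply: (P_ext (P_if Pf Pg (P_const _ false))). Qed.
Lemma P_orb (f g : E -> bool) : P f -> P g -> P (fun e => f e || g e).
Proof. by move=> Pf Pg; apply: (P_ext (P_if Pf (P_const _ true) Pg)). Qed.

End Combine.

(** * Recursion *)

Section Rec.
Variables (E A : encType) (f : E -> A) (b : E -> bool) (r : E -> E).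
Variables (g : E -> A) (h : E -> A -> A).
Hypothesis fE : forall e, f e = if b e then g e else h e (f (r e)).
Hypotheses (Pb : P b) (Pr : P r) (Pg : P g).
Hypothesis Ph : P (fun z : E * A => h z.1 z.2).

(** The time stays a sum over the iterates of [r], without a polynomial bound in the starting value,
    because the loops of [computable_pow] and [driver] are not polynomial in it. *)
Lemma rec_run : exists p (T : E -> nat) (U : E * A -> nat), [/\ pb T, pb U &
  forall n e, (forall i, i < n -> ~~ b (iter i r e)) -> b (iter n r e) ->
   exists2 t, run p (enc e) (enc (f e)) t &
   t <= \sum_(i < n) (T (iter i r e) + U (iter i r e, f (iter i.+1 r e))) + T (iter n r e)].
Proof.
case: Pb => _ [pB [TB [hTB rB]]]; case: Pr => _ [pR [TR [hTR rR]]].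
case: Pg => _ [pG [TG [hTG rG]]]; case: Ph => _ [pH [TH [hTH rH]]].
have [q [i [j [k [l [q0 ci cj ck cl]]]]]] :=
  link4P (fun i j k l => EIf (ECall i EArg) (ECall j EArg)
    (ECall k (ENode EArg (ECall 0 (ECall l EArg))))) pB pG pH pR.
exists q, (fun e => TB e + TR e + TG e + 10), TH; split=> //.
  by apply: pb_add (pb_const _ _); apply: pb_add hTG; apply: pb_add.
elim=> [|n IH] e nb be.
  rewrite big_ord0 /= fE be; have [t1 r1 l1] := rB e; have [t2 r2 l2] := rG e.
  exists (((1 + t1).+1 + (1 + t2).+1).+1); last by lia.
  rewrite /run q0; apply: (@eval_ifT _ _ _ _ _ Leaf Leaf).
    apply: eval_call; first exact: eval_arg.
    by move: r1; rewrite [b e]be; apply: ci.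
  by apply: eval_call; [exact: eval_arg | exact: cj r2].
have nb0 := nb 0 isT; rewrite /= in nb0.
have [||t rt lt_] := IH (r e).
- by move=> i0 hi; rewrite -iterSr; apply: nb.
- by rewrite -iterSr.
rewrite fE (negbTE nb0); have [t1 r1 l1] := rB e; have [t2 r2 l2] := rR e.
have [t3 r3 l3] := rH (e, f (r e)).
exists (((1 + t1).+1 + ((1 + ((1 + t2).+1 + t).+1).+1 + t3).+1).+1).
  rewrite /run q0; apply: eval_ifF.
    by apply: eval_call; [exact: eval_arg | move: r1; rewrite (negbTE nb0); apply: ci].
  apply: eval_call; last exact: ck r3.
  apply: eval_node; first exact: eval_arg.
  apply: eval_call; last exact: rt.
  by apply: eval_call; [exact: eval_arg | exact: cl r2].
rewrite big_ord_recl /=.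
have -> : \sum_(i0 < n) (TB (iter (bump 0 i0) r e) + TR (iter (bump 0 i0) r e) + TG (iter (bump 0 i0) r e) + 10 +
     TH (iter (bump 0 i0) r e, f (r (iter (bump 0 i0) r e))))
  = \sum_(i0 < n) (TB (iter i0 r (r e)) + TR (iter i0 r (r e)) + TG (iter i0 r (r e)) + 10 +
     TH (iter i0 r (r e), f (iter i0.+1 r (r e)))).
  by apply: eq_bigr => i0 _; rewrite /= -!iterSr.
move: lt_; rewrite -!iterSr /= => lt_; set S := \sum_(i < n) _ in lt_ *.
by move: (leqnn S) lt_ l1 l2 l3; rewrite /=; clearbody S; lia.
Qed.

Variables (N mu : E -> nat).
Hypothesis Nge : forall e, esize e <= N e.
Hypothesis Nr : forall e, ~~ b e -> N (r e) <= N e.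
Hypothesis mur : forall e, ~~ b e -> mu (r e) < mu e.
Hypotheses (pN : pb N) (pmu : pb mu) (pf : pb (fun e => esize (f e))).

Lemma rec_stop e : exists2 n, n <= mu e &
  (forall i, i < n -> ~~ b (iter i r e) /\ N (iter i r e) <= N e)
   /\ b (iter n r e) /\ N (iter n r e) <= N e.
Proof.
elim: {e}(mu e) {-2}e (leqnn (mu e)) => [|m IH] e le_m.
  exists 0 => //; split=> //=; case: (boolP (b e)) => // /mur; lia.
case: (boolP (b e)) => be; first by exists 0.
have [|n nm [h1 [h2 h3]]] := IH (r e); first by have := mur be; lia.
exists n.+1; first by have := mur be; lia.
have NN := Nr be.
split; last by rewrite iterSr; split=> //; apply: leq_trans h3 NN.
case=> [|i] hi //; rewrite iterSr; have [] := h1 i hi => ? hh; split=> //.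
exact: leq_trans hh NN.
Qed.

(** Cheap steps alone do not give a cheap recursion, since arguments could grow. [N] is a potential
    that dominates sizes and never increases along [r], [mu] bounds the depth, and [pf] bounds the
    results handed back to [h]. *)
Lemma P_rec : P f.
Proof.
split=> //; have [p [T [U [pT pU run_]]]] := rec_run.
exists p.
move: pT pU pf => [c1 hT] [c2 hU] [c3 hf].
pose M e := N e + c3 * N e ^ c3 + 1.
have pM : pb M by apply: pb_add (pb_const _ _); apply: pb_add => //; exact: pb_poly.
exists (fun e => (mu e).+1 * (c1 * M e ^ c1 + c2 * M e ^ c2)); split.
  by apply: pb_mul; [apply: pb_S | apply: pb_add; apply: pb_poly].
move=> e; have [n nmu [h1 [h2 h3]]] := rec_stop e.
have [|t rt lt_] := run_ n e _ h2; first by move=> i /h1 [].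
exists t => //; apply: leq_trans lt_ _.
have M1 : N e <= M e by rewrite /M; lia.
have hT' x : N x <= N e -> T x <= c1 * M e ^ c1.
  move=> hx; apply: leq_trans (hT _) _; apply: leq_mul => //; apply: leq_exp2r'.
  by apply: leq_trans (Nge _) _; apply: leq_trans hx M1.
have hU' x : N x <= N e -> ~~ b x -> U (x, f (r x)) <= c2 * M e ^ c2.
  move=> hx nb; apply: leq_trans (hU _) _; apply: leq_mul => //; apply: leq_exp2r'.
  have nr : N (r x) <= N e by apply: leq_trans (Nr nb) hx.
  have h4 : esize (f (r x)) <= c3 * N e ^ c3.
    apply: leq_trans (hf _) _; apply: leq_mul => //; apply: leq_exp2r'.
    by apply: leq_trans (Nge _) nr.
  by rewrite esize_pair /M; have := Nge x; lia.
rewrite mulSn addnC; apply: leq_add.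
  by apply: leq_trans (hT' _ h3) (leq_addr _ _).
apply: (@leq_trans (\sum_(i < n) (c1 * M e ^ c1 + c2 * M e ^ c2))).
  apply: leq_sum => i _; have [nb hi] := h1 i (ltn_ord i).
  by apply: leq_add; [exact: hT' | exact: hU'].
by rewrite sum_nat_const card_ord leq_mul2r nmu orbT.
Qed.
End Rec.

(** * Folds *)

Lemma leq_sum_const (A : eqType) (l : seq A) (F : A -> nat) k :
  (forall a, a \in l -> F a <= k) -> \sum_(a <- l) F a <= size l * k.
Proof.
elim: l => [|a l IH] h; first by rewrite big_nil.
rewrite big_cons mulSn; apply: leq_add; first by apply: h; rewrite mem_head.
by apply: IH => b hb; apply: h; rewrite inE hb orbT.
Qed.

Lemma pb_sum (E A X : encType) (bnd : E * A -> nat) (e : X -> E) (l : X -> seq A) :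
  pb bnd -> pb (fun x => esize (e x)) -> pb (fun x => esize (l x)) ->
  pb (fun x => \sum_(a <- l x) bnd (e x, a)).
Proof.
move=> [c hb] he hl.
have h2 : pb (fun x => c * (esize (e x) + esize (l x) + 1) ^ c).
  by apply: pb_poly; apply: pb_add (pb_const _ _); apply: pb_add hl.
apply: (pb_le (pb_mul hl h2)) => x.
apply: leq_trans (_ : size (l x) * (c * (esize (e x) + esize (l x) + 1) ^ c) <= _).
  apply: leq_sum_const => a /esize_mem ha; apply: leq_trans (hb _) _.
  by apply: leq_mul => //; apply: leq_exp2r'; rewrite esize_pair; lia.
by rewrite leq_mul2r size_le_esize orbT.
Qed.

Lemma esize_foldl (S A : encType) (g : S -> A -> S) (b : A -> nat) s l :
  (forall s a, esize (g s a) <= esize s + b a) ->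
  esize (foldl g s l) <= esize s + \sum_(a <- l) b a.
Proof.
move=> h; elim: l s => [|a l IH] s; first by rewrite big_nil addn0.
by rewrite big_cons /=; apply: leq_trans (IH _) _; have := h s a; lia.
Qed.

Lemma esize_foldr (S A : encType) (g : A -> S -> S) (b : A -> nat) s l :
  (forall s a, esize (g a s) <= esize s + b a) ->
  esize (foldr g s l) <= esize s + \sum_(a <- l) b a.
Proof.
move=> h; elim: l => [|a l IH] /=; first by rewrite big_nil addn0.
by rewrite big_cons /=; have := h (foldr g s l) a; lia.
Qed.

(** The folds read their list through [head], which needs a default item; an empty item type is
    treated apart. *)
Lemma enc_inhabited (A : encType) : (forall s : seq A, s = [::]) \/ exists a : A, True.
Proof.
case: (pselect (exists a : A, True)) => h; [by right | left].
by case=> // a s; case: h; exists a.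
Qed.

Section Folds.
Variables (E S A : encType).
Variables (i : E -> S) (l : E -> seq A) (bnd : E * A -> nat).
Hypotheses (Pi : P i) (Pl : P l) (pbb : pb bnd).

(** The growth [bnd] allowed to a step depends on the environment and the item but not on the state,
    so that growth adds up instead of compounding. *)
Lemma P_foldl (g : E -> S -> A -> S) :
  (forall e s a, esize (g e s a) <= esize s + bnd (e, a)) ->
  P (fun z : E * (S * A) => g z.1 z.2.1 z.2.2) ->
  P (fun e => foldl (g e) (i e) (l e)).
Proof.
move=> hg Pg; case: (enc_inhabited A) => [nA | [a0 _]].
  by apply: (P_ext Pi) => e; rewrite (nA (l e)).
pose f (z : E * (S * seq A)) := foldl (g z.1) z.2.1 z.2.2.
suff Pf : P f by apply: (P_ext (P_comp Pf (P_pair (@P_id _) (P_pair Pi Pl)))).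
have hs : pb (fun z : E * (S * seq A) => \sum_(a <- z.2.2) bnd (z.1, a)).
  apply: pb_sum => //.
    by apply: P_size; apply: P_fst; apply: P_id.
  by apply: P_size; do 2!apply: P_snd; apply: P_id.
have hN : pb (fun z : E * (S * seq A) => esize z + \sum_(a <- z.2.2) bnd (z.1, a)).
  by apply: pb_add hs; apply: pb_esize.
(* The potential is the current size plus the growth that the unread items still allow. *)
apply: (@P_rec _ _ f (fun z => nilp z.2.2)
   (fun z => (z.1, (g z.1 z.2.1 (head a0 z.2.2), behead z.2.2)))
   (fun z => z.2.1) (fun z y => y) _ _ _ _ _
   (fun z => esize z + \sum_(a <- z.2.2) bnd (z.1, a)) (fun z => esize z.2.2)).
- by case=> e [s [|a k]].
- by apply: P_nilp; do 2!apply: P_snd; apply: P_id.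
- apply: P_pair; first exact: P_fst (@P_id _).
  apply: P_pair; last by apply: P_behead; do 2!apply: P_snd; apply: P_id.
  apply: (P_comp Pg (P_pair _ (P_pair _ _))).
  + exact: P_fst (@P_id _).
  + exact: P_fst (P_snd (@P_id _)).
  + by apply: P_head; do 2!apply: P_snd; apply: P_id.
- exact: P_fst (P_snd (@P_id _)).
- exact: P_snd (@P_id _).
- by move=> z; lia.
- case=> e [s [|a k]] //= _; rewrite big_cons !esize_pair esize_cons.
  by have := hg e s a; lia.
- by case=> e [s [|a k]] //= _; rewrite esize_cons; lia.
- by [].
- by apply: P_size; do 2!apply: P_snd; apply: P_id.
- apply: (pb_le hN) => -[e [s k]]; rewrite /f /=.
  have := @esize_foldl _ _ (g e) (fun a => bnd (e, a)) s k (hg e).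
  by rewrite !esize_pair; lia.
Qed.

Lemma P_foldr (g : E -> A -> S -> S) :
  (forall e s a, esize (g e a s) <= esize s + bnd (e, a)) ->
  P (fun z : E * (A * S) => g z.1 z.2.1 z.2.2) ->
  P (fun e => foldr (g e) (i e) (l e)).
Proof.
move=> hg Pg; case: (enc_inhabited A) => [nA | [a0 _]].
  by apply: (P_ext Pi) => e; rewrite (nA (l e)).
pose f (z : E * (S * seq A)) := foldr (g z.1) z.2.1 z.2.2.
suff Pf : P f by apply: (P_ext (P_comp Pf (P_pair (@P_id _) (P_pair Pi Pl)))).
have hs : pb (fun z : E * (S * seq A) => \sum_(a <- z.2.2) bnd (z.1, a)).
  apply: pb_sum => //.
    by apply: P_size; apply: P_fst; apply: P_id.
  by apply: P_size; do 2!apply: P_snd; apply: P_id.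
have hN : pb (fun z : E * (S * seq A) => esize z + \sum_(a <- z.2.2) bnd (z.1, a)).
  by apply: pb_add hs; apply: pb_esize.
apply: (@P_rec _ _ f (fun z => nilp z.2.2)
   (fun z => (z.1, (z.2.1, behead z.2.2)))
   (fun z => z.2.1) (fun z y => g z.1 (head a0 z.2.2) y) _ _ _ _ _
   (fun z => esize z) (fun z => esize z.2.2)).
- by case=> e [s [|a k]].
- by apply: P_nilp; do 2!apply: P_snd; apply: P_id.
- apply: P_pair; first exact: P_fst (@P_id _).
  apply: P_pair; first exact: P_fst (P_snd (@P_id _)).
  by apply: P_behead; do 2!apply: P_snd; apply: P_id.
- exact: P_fst (P_snd (@P_id _)).
- apply: (P_comp Pg (P_pair _ (P_pair _ _))).
  + exact: P_fst (P_fst (@P_id _)).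
  + by apply: P_head; do 2!apply: P_snd; apply: P_fst; apply: P_id.
  + exact: P_snd (@P_id _).
- by [].
- by case=> e [s [|a k]] //= _; rewrite !esize_pair esize_cons; lia.
- by case=> e [s [|a k]] //= _; rewrite esize_cons; lia.
- exact: pb_esize.
- by apply: P_size; do 2!apply: P_snd; apply: P_id.
- apply: (pb_le hN) => -[e [s k]]; rewrite /f /=.
  have := @esize_foldr _ _ (g e) (fun a => bnd (e, a)) s k (hg e).
  by rewrite !esize_pair; lia.
Qed.
End Folds.

(** * Equality and size of encodings *)

Fixpoint teq (a b : tree) : bool :=
  match a, b with
  | Leaf, Leaf => true
  | Node a1 a2, Node b1 b2 => teq a1 b1 && teq a2 b2
  | _, _ => false
  end.

Lemma teqP a b : reflect (a = b) (teq a b).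
Proof.
apply: (iffP idP) => [|<-].
  by elim: a b => [|a1 IH1 a2 IH2] [|b1 b2] //= /andP[/IH1-> /IH2->].
by elim: {b} a => //= a -> c ->.
Qed.

Definition eq_expr : expr :=
  EIf (EFst EArg)
   (EIf (ESnd EArg)
      (EIf (ECall 0 (ENode (EFst (EFst EArg)) (EFst (ESnd EArg))))
           (ECall 0 (ENode (ESnd (EFst EArg)) (ESnd (ESnd EArg)))) ELeaf) ELeaf)
   (EIf (ESnd EArg) ELeaf (ENode ELeaf ELeaf)).

Lemma eval_le_exists p e x v T T' :
  (exists2 t, eval p e x v t & t <= T) -> T <= T' ->
  exists2 t, eval p e x v t & t <= T'.
Proof. by move=> [t h1 h2] h; exists t => //; apply: leq_trans h. Qed.

Lemma eval_eq a b : exists2 t, eval [:: eq_expr] eq_expr (Node a b) (enc_bool (teq a b)) t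
  & t <= 30 * tree_size a.
Proof.
have A1 x : eval [:: eq_expr] (EFst EArg) x (tfst x) 2 by do 2!constructor.
have A2 x : eval [:: eq_expr] (ESnd EArg) x (tsnd x) 2 by do 2!constructor.
elim: a b => [|a1 IH1 a2 IH2] [|b1 b2].
- exists (2 + (2 + 3).+1).+1 => //.
  exact: (eval_ifF _ (A1 (Node Leaf Leaf)) (eval_ifF _ (A2 (Node Leaf Leaf)) (eval_node (eval_leaf _ _) (eval_leaf _ _)))).
- exists (2 + (2 + 1).+1).+1 => //.
  exact: (eval_ifF _ (A1 (Node Leaf (Node b1 b2))) (eval_ifT _ (A2 (Node Leaf (Node b1 b2))) (eval_leaf _ _))).
- exists (2 + (2 + 1).+1).+1; last by move=> /=; lia.
  exact: (eval_ifT _ (A1 (Node (Node a1 a2) Leaf)) (eval_ifF _ (A2 (Node (Node a1 a2) Leaf)) (eval_leaf _ _))).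
have [t1 r1 l1] := IH1 b1; have [t2 r2 l2] := IH2 b2.
have B1 : eval [:: eq_expr] (ECall 0 (ENode (EFst (EFst EArg)) (EFst (ESnd EArg))))
   (Node (Node a1 a2) (Node b1 b2)) (enc_bool (teq a1 b1)) (7 + t1).+1.
  apply: (@eval_call [:: eq_expr] 0 _ _ (Node a1 b1) _ 7 _ _ r1); apply: (@eval_node _ _ _ _ _ _ 3 3).
    exact: (eval_fst (A1 (Node (Node a1 a2) (Node b1 b2)))).
  exact: (eval_fst (A2 (Node (Node a1 a2) (Node b1 b2)))).
have B2 : eval [:: eq_expr] (ECall 0 (ENode (ESnd (EFst EArg)) (ESnd (ESnd EArg))))
   (Node (Node a1 a2) (Node b1 b2)) (enc_bool (teq a2 b2)) (7 + t2).+1.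
  apply: (@eval_call [:: eq_expr] 0 _ _ (Node a2 b2) _ 7 _ _ r2); apply: (@eval_node _ _ _ _ _ _ 3 3).
    exact: (eval_snd (A1 (Node (Node a1 a2) (Node b1 b2)))).
  exact: (eval_snd (A2 (Node (Node a1 a2) (Node b1 b2)))).
have: exists2 t, eval [:: eq_expr] (EIf (ECall 0 (ENode (EFst (EFst EArg)) (EFst (ESnd EArg))))
           (ECall 0 (ENode (ESnd (EFst EArg)) (ESnd (ESnd EArg)))) ELeaf)
    (Node (Node a1 a2) (Node b1 b2)) (enc_bool (teq (Node a1 a2) (Node b1 b2))) t & t <= t1 + t2 + 18.
  rewrite /=; case E: (teq a1 b1) B1 => B1 /=.
    exists ((7 + t1).+1 + (7 + t2).+1).+1; last by lia.
    exact: (eval_ifT _ B1 B2).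
  exists ((7 + t1).+1 + 1).+1; last by lia.
  by apply: (eval_ifF _ B1); constructor.
move=> [t r lt_]; exists (2 + (2 + t).+1).+1; last by move=> /=; lia.
pose z := Node (Node a1 a2) (Node b1 b2); exact: (eval_ifT _ (A1 z) (eval_ifT _ (A2 z) r)).
Qed.

(** The argument pairs a tree with a unary accumulator, which avoids additions and keeps the time
    linear in the tree. *)
Definition size_expr : expr :=
  EIf (EFst EArg)
   (ECall 1 (ENode (EFst (EFst EArg))
      (ECall 1 (ENode (ESnd (EFst EArg)) (ENode ELeaf (ESnd EArg))))))
   (ENode ELeaf (ESnd EArg)).
Definition size_prog := [:: ECall 1 (ENode EArg ELeaf); size_expr].

Lemma eval_size a b : exists2 t, eval size_prog size_expr (Node a b)
    (iter (tree_size a) (Node Leaf) b) t & t <= 30 * tree_size a.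
Proof.
have A1 x : eval size_prog (EFst EArg) x (tfst x) 2 by do 2!constructor.
have A2 x : eval size_prog (ESnd EArg) x (tsnd x) 2 by do 2!constructor.
have A3 x : eval size_prog (ENode ELeaf (ESnd EArg)) x (Node Leaf (tsnd x)) 4.
  by apply: (eval_node (eval_leaf _ _) (A2 _)).
elim: a b => [|a1 IH1 a2 IH2] b.
  by exists 7 => //; apply: (eval_ifF _ (A1 (Node Leaf b)) (A3 _)).
have [t2 r2 l2] := IH2 (Node Leaf b).
have [t1 r1 l1] := IH1 (iter (tree_size a2) (Node Leaf) (Node Leaf b)).
exists (2 + ((3 + ((3 + 4).+1 + t2).+1).+1 + t1).+1).+1; last by move=> /=; lia.
have -> : iter (tree_size (Node a1 a2)) (Node Leaf) b =
  iter (tree_size a1) (Node Leaf) (iter (tree_size a2) (Node Leaf) (Node Leaf b)).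
  by rewrite -iterD /= -iterSr.
apply: (@eval_ifT _ _ _ _ _ a1 a2 _ _ _ (A1 (Node (Node a1 a2) b))).
apply: eval_call; last exact: r1.
apply: eval_node; first exact: (eval_fst (A1 (Node (Node a1 a2) b))).
apply: eval_call; last exact: r2.
apply: eval_node; first exact: (eval_snd (A1 (Node (Node a1 a2) b))).
exact: (A3 (Node (Node a1 a2) b)).
Qed.

Section Prims.
Variable E : encType.

Lemma P_eq (A : encType) (f g : E -> A) : P f -> P g -> P (fun e => f e == g e).
Proof.
apply: (@P_app2 _ _ _ _ (fun x y : A => x == y)); split.
  by apply: (pb_le (pb_const _ 3)) => z; case: (_ == _).
exists [:: eq_expr], (fun z => 30 * esize z); split.
  by apply: pb_mul (pb_const _ _) (@pb_esize _).
move=> [x y] /=; have -> : enc (x == y) = enc_bool (teq (enc x) (enc y)).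
  congr enc_bool; apply/eqP/teqP => [-> //|]; exact: enc_inj.
apply: (eval_le_exists (eval_eq _ _)); rewrite leq_mul2l esize_pair /=.
by rewrite /esize; lia.
Qed.

Lemma P_esize_fuel (A : encType) (f : E -> A) : P f -> P (fun e => nseq (esize (f e)) tt).
Proof.
apply: (@P_comp _ _ _ (fun x : A => nseq (esize x) tt)); split.
  apply: (pb_le (pb_add (pb_mul (pb_const _ 2) (@pb_esize A)) (pb_const _ 1))) => e.
  by rewrite esize_fuel size_nseq; lia.
exists size_prog, (fun z => 30 * esize z + 4); split.
  by apply: pb_add (pb_const _ _); apply: pb_mul (pb_const _ _) (@pb_esize _).
move=> x; have [t r l] := eval_size (enc x) Leaf.
exists ((1 + 1).+1 + t).+1; last by rewrite /esize; lia.
rewrite /run /= enc_fuel; apply: eval_call; last exact: r.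
by apply: eval_node; constructor.
Qed.

End Prims.

(** * Binary arithmetic *)

Definition bval (s : seq bool) := foldr (fun (x : bool) n => x + n.*2) 0 s.

Lemma nat_bitsD (b : bool) n :
  nat_bits (b + n.*2) = if ~~ b && nilp (nat_bits n) then [::] else b :: nat_bits n.
Proof.
rewrite {1}/nat_bits.
have -> : bin_of_nat (b + n.*2) =
  match bin_of_nat n with
  | N0 => if b then Npos xH else N0
  | Npos p => Npos (if b then xI p else xO p)
  end.
  apply: (can_inj nat_of_binK); rewrite bin_of_natK.
  rewrite -{1}(bin_of_natK n); case: (bin_of_nat n) => [|p]; case: b => //=;
  by rewrite NatTrec.doubleE /= ?add0n ?add1n.
rewrite /nat_bits; case: (bin_of_nat n) => [|p]; case: b => //=.
by case: p.
Qed.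

Lemma bval_nat_bits n : bval (nat_bits n) = n.
Proof.
elim/ltn_ind: n => n IH; case: (posnP n) => [-> //|n0].
rewrite -{1}(odd_double_half n) nat_bitsD.
have h : n./2 < n by rewrite -divn2; apply: ltn_Pdiv.
case: ifP => [/andP[no /nilP hn]|_] /=; last by rewrite IH // odd_double_half.
by have := IH _ h; rewrite hn /= => h2; have := odd_double_half n; rewrite -h2 (negbTE no); lia.
Qed.

Lemma nilp_nat_bits n : nilp (nat_bits n) = (n == 0).
Proof.
apply/nilP/eqP => [h|-> //]; by rewrite -(bval_nat_bits n) h.
Qed.

Lemma bval_head_behead s : bval s = head false s + (bval (behead s)).*2.
Proof. by case: s. Qed.

Definition bsum (z : bool * (seq bool * seq bool)) :=
  nat_bits (z.1 + bval z.2.1 + bval z.2.2).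
Definition maj (x y c : bool) := if x then y || c else y && c.
(** Canonical digit lists have no leading zero; a [false] in front of the empty list must therefore
    vanish. *)
Definition cons_bit (b : bool) (s : seq bool) := if ~~ b && nilp s then [::] else b :: s.

(** [bsum] is specified by its value, hence canonical by construction; ripple-carry addition enters
    as the recursion equation that [P_rec] asks for. *)
Lemma bsumE z : bsum z = if nilp z.2.1 && nilp z.2.2 then (if z.1 then [:: true] else [::])
  else cons_bit (if head false z.2.1 == head false z.2.2 then z.1 else ~~ z.1)
   (bsum (maj (head false z.2.1) (head false z.2.2) z.1, (behead z.2.1, behead z.2.2))).
Proof.
case: z => c [a b]; rewrite /bsum /=; case: ifP => [/andP[/nilP-> /nilP->]|_].
  by case: c.
rewrite /cons_bit -nat_bitsD; congr nat_bits.
rewrite (bval_head_behead a) (bval_head_behead b).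
by case: (head false a); case: (head false b); case: c => /=; lia.
Qed.

Lemma esize_bool (b : bool) : esize b = b.*2.+1. Proof. by case: b. Qed.
Lemma esize_cons_bit b s : esize (cons_bit b s) <= esize (b :: s).
Proof. by rewrite /cons_bit; case: ifP => // /andP[_ /nilP->]; rewrite esize_cons; lia. Qed.

Lemma esize_bsum z : esize (bsum z) <= esize z.2.1 + esize z.2.2 + z.1.*2 + 1.
Proof.
case: z => c [a b]; move: {2}(size a + size b) (leqnn (size a + size b)) => n.
elim: n c a b => [|n IH] c a b hn; rewrite bsumE /=.
  by case: a b c hn => [|x a] [|y b] [] //= _; rewrite ?esize_cons ?esize_nil ?esize_bool //=; lia.
case: ifP => [_|h]; first by case: c; rewrite ?esize_cons !esize_nil ?esize_bool /=;
  have := esize_gt0 a; have := esize_gt0 b; lia.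
apply: leq_trans (esize_cons_bit _ _) _; rewrite esize_cons.
have := IH (maj (head false a) (head false b) c) (behead a) (behead b).
rewrite !size_behead /=; have h2 : (size a).-1 + (size b).-1 <= n.
  by case: a b h hn => [|x a] [|y b] //=; lia.
move=> /(_ h2); rewrite !esize_bool.
case: a b h {hn h2} => [|x a] [|y b] //= _; rewrite ?esize_cons ?esize_bool ?esize_nil.
- by case: y; case: c => /=; lia.
- by case: x; case: c => /=; lia.
- by case: x; case: y; case: c => /=; lia.
Qed.

Lemma esize_add m n : esize (m + n) <= esize m + esize n + 1.
Proof.
have := esize_bsum (false, (nat_bits m, nat_bits n)).
by rewrite /bsum /= !bval_nat_bits add0n addn0.
Qed.

Section Arith.
Variable E : encType.

Lemma P_tobits (f : E -> nat) : P f -> P (fun e => nat_bits (f e)).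
Proof. by move=> Pf; apply: (P_tree Pf). Qed.

Lemma P_carry_step (F : bool -> bool -> bool -> bool) (z : E -> bool * (seq bool * seq bool)) :
  P z -> P (fun e => (F (head false (z e).2.1) (head false (z e).2.2) (z e).1,
                (behead (z e).2.1, behead (z e).2.2))).
Proof.
move=> Pz; have Pa := P_fst (P_snd Pz); have Pb := P_snd (P_snd Pz).
apply: P_pair; last by apply: P_pair; apply: P_behead.
have h x y : P (fun e => F x y (z e).1).
  apply: (P_ext (P_if (P_fst Pz) (P_const _ (F x y true)) (P_const _ (F x y false)))) => e.
  by case: (z e).1.
have k x : P (fun e => F x (head false (z e).2.2) (z e).1).
  apply: (P_ext (P_if (P_head false Pb) (h x true) (h x false))) => e.
  by case: (head _ (z e).2.2).
apply: (P_ext (P_if (P_head false Pa) (k true) (k false))) => e.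
by case: (head _ (z e).2.1).
Qed.

End Arith.

Lemma pb_carry : pb (fun z : bool * (seq bool * seq bool) => esize z.2 + 4).
Proof. by apply: pb_add (pb_const _ _); apply: P_size; apply: P_snd (@P_id _). Qed.

Lemma carry_esize (z : bool * (seq bool * seq bool)) : esize z <= esize z.2 + 4.
Proof. by case: z => -[] ab; rewrite esize_pair esize_bool /=; lia. Qed.

Lemma carry_dec (c : bool) (z : bool * (seq bool * seq bool)) :
  ~~ (nilp z.2.1 && nilp z.2.2) ->
  esize (c, (behead z.2.1, behead z.2.2)).2 < esize z.2.
Proof. by case: z => d [[|x a] [|y b]] //= _; rewrite !esize_pair ?esize_cons ?esize_nil; lia. Qed.

Lemma P_bsum : P bsum.
Proof.
have Pz := @P_id (bool * (seq bool * seq bool))%type.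
apply: (@P_rec _ _ bsum (fun z => nilp z.2.1 && nilp z.2.2)
  (fun z => (maj (head false z.2.1) (head false z.2.2) z.1, (behead z.2.1, behead z.2.2)))
  (fun z => if z.1 then [:: true] else [::])
  (fun z y => cons_bit (if head false z.2.1 == head false z.2.2 then z.1 else ~~ z.1) y)
  bsumE _ _ _ _ (fun z => esize z.2 + 4) (fun z => esize z.2)).
- by apply: P_andb; apply: P_nilp; [apply: P_fst|apply: P_snd]; exact: P_snd Pz.
- exact: P_carry_step Pz.
- by apply: P_if (P_const _ _) (P_const _ _); exact: P_fst Pz.
- rewrite /cons_bit; pose b (z : (bool * (seq bool * seq bool)) * seq bool) :=
    if head false z.1.2.1 == head false z.1.2.2 then z.1.1 else ~~ z.1.1.
  have Pzz := P_fst (@P_id ((bool * (seq bool * seq bool)) * seq bool)%type).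
  have Pb : P b.
    apply: P_if; last by apply: P_negb; apply: P_fst.
      by apply: P_eq; apply: P_head; [apply: P_fst|apply: P_snd]; exact: P_snd Pzz.
    by apply: P_fst.
  apply: (@P_if _ _ (fun z => ~~ b z && nilp z.2) (fun=> [::]) (fun z => b z :: z.2)).
  + by apply: P_andb; [apply: P_negb | apply: P_nilp; exact: P_snd (@P_id _)].
  + exact: P_const.
  + by apply: P_cons => //; exact: P_snd (@P_id _).
- exact: carry_esize.
- by move=> z /(@carry_dec (maj (head false z.2.1) (head false z.2.2) z.1)) /=; lia.
- by move=> z /(@carry_dec (maj (head false z.2.1) (head false z.2.2) z.1)).
- exact: pb_carry.
- by apply: P_size; exact: P_snd Pz.
- apply: (pb_le (pb_add (pb_add (P_size (P_snd Pz)) (P_size (P_fst Pz))) (pb_const _ 1))) => z.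
  have := esize_bsum z; case: z => c [a b] /=; rewrite !esize_pair esize_bool; lia.
Qed.

Lemma P_add (E : encType) (f g : E -> nat) : P f -> P g -> P (fun e => f e + g e).
Proof.
move=> /P_tobits Pf /P_tobits Pg.
apply: (P_tree (P_comp P_bsum (P_pair (P_const _ false) (P_pair Pf Pg)))) => e.
by rewrite /bsum /= !bval_nat_bits add0n.
Qed.

Lemma P_leq (E : encType) (f g : E -> nat) : P f -> P g -> P (fun e => f e <= g e).
Proof.
move=> /P_tobits Pf /P_tobits Pg.
(* Comparison from the lowest digit upwards. The flag sums up the digits already read: it says
   whether the remaining parts may be equal or must be strictly ordered. *)
pose le (z : bool * (seq bool * seq bool)) := bval z.2.1 + ~~ z.1 <= bval z.2.2.
suff Ple : P le.
  apply: (P_ext (P_comp Ple (P_pair (P_const _ true) (P_pair Pf Pg)))) => e.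
  by rewrite /le /= !bval_nat_bits addn0.
have Pz := @P_id (bool * (seq bool * seq bool))%type.
apply: (@P_rec _ _ le (fun z => nilp z.2.1 && nilp z.2.2)
  (fun z => ((fun x y c : bool => if x == y then c else y) (head false z.2.1) (head false z.2.2) z.1, (behead z.2.1, behead z.2.2)))
  (fun z => z.1) (fun z y => y) _ _ _ _ _ (fun z => esize z.2 + 4) (fun z => esize z.2)).
- case=> c [a b]; rewrite /le /=; case: ifP => [/andP[/nilP-> /nilP->]|_] /=; first by case: c.
  rewrite (bval_head_behead a) (bval_head_behead b).
  by case: (head false a); case: (head false b); case: c => /=; lia.
- by apply: P_andb; apply: P_nilp; [apply: P_fst|apply: P_snd]; exact: P_snd Pz.
- exact: (@P_carry_step _ (fun x y c : bool => if x == y then c else y) _ Pz).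
- exact: P_fst Pz.
- exact: P_snd (@P_id _).
- exact: carry_esize.
- by move=> z /(@carry_dec true z) /=; lia.
- by move=> z /(@carry_dec true z).
- exact: pb_carry.
- by apply: P_size; exact: P_snd Pz.
- by apply: (pb_le (pb_const _ 3)) => z; case: (le z).
Qed.

(** * Lists *)

Lemma P_map (E : encType) (A B : encType) (f : E -> A -> B) (s : E -> seq A) :
  P (fun z : E * A => f z.1 z.2) -> P s -> P (fun e => map (f e) (s e)).
Proof.
move=> Pf Ps.
apply: (@P_foldr _ _ _ (fun=> [::]) s (fun z => esize (f z.1 z.2) + 1)
  (P_const _ _) Ps _ (fun e a t => f e a :: t)).
- by apply: pb_add (pb_const _ _); apply: P_size.
- by move=> e t a /=; rewrite esize_cons; lia.
- apply: P_cons; last exact: P_snd (P_snd (@P_id _)).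
  apply: (P_comp Pf (P_pair _ _)); first exact: P_fst (@P_id _).
  exact: P_fst (P_snd (@P_id _)).
Qed.

Lemma P_cat (E : encType) (A : encType) (s t : E -> seq A) : P s -> P t -> P (fun e => s e ++ t e).
Proof.
move=> Ps Pt.
apply: (P_ext (@P_foldr _ _ _ t s (fun z => esize z + 1) Pt Ps _ (fun e a t => a :: t) _ _)).
- by apply: pb_add (pb_const _ _); apply: pb_esize.
- by move=> e u a; rewrite esize_cons esize_pair; lia.
- by apply: P_cons; [exact: P_fst (P_snd (@P_id _)) | exact: P_snd (P_snd (@P_id _))].
- by move=> e; elim: (s e) => //= a u ->.
Qed.

Lemma P_rev (E : encType) (A : encType) (s : E -> seq A) : P s -> P (fun e => rev (s e)).
Proof.
move=> Ps.
apply: (P_ext (@P_foldl _ _ _ (fun=> [::]) s (fun z => esize z + 1) (P_const _ _) Ps _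
   (fun e t a => a :: t) _ _)).
- by apply: pb_add (pb_const _ _); apply: pb_esize.
- by move=> e u a; rewrite esize_cons esize_pair; lia.
- by apply: P_cons; [exact: P_snd (P_snd (@P_id _)) | exact: P_fst (P_snd (@P_id _))].
- by move=> e; rewrite /rev; move: [::]; elim: (s e) => //= a u IH t; rewrite IH.
Qed.

Lemma esize_cat (A : encType) (s t : seq A) : (esize (s ++ t)).+1 = esize s + esize t.
Proof. by elim: s => [|a s IH] /=; rewrite ?esize_nil ?esize_cons; lia. Qed.

Lemma P_flatten (E : encType) (A : encType) (s : E -> seq (seq A)) : P s -> P (fun e => flatten (s e)).
Proof.
move=> Ps; apply: (@P_foldr _ _ _ (fun=> [::]) s (fun z => esize z.2)
  (P_const _ _) Ps _ (fun e a t => a ++ t)).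
- by apply: P_size; exact: P_snd (@P_id _).
- by move=> e t a /=; have := esize_cat a t; lia.
- by apply: P_cat; [exact: P_fst (P_snd (@P_id _)) | exact: P_snd (P_snd (@P_id _))].
Qed.

Lemma esize_filter (A : encType) (p : pred A) (s : seq A) : esize (filter p s) <= esize s.
Proof. by elim: s => //= a s IH; case: (p a); rewrite ?esize_cons; lia. Qed.

Lemma P_filter (E : encType) (A : encType) (p : E -> A -> bool) (s : E -> seq A) :
  P (fun z : E * A => p z.1 z.2) -> P s -> P (fun e => filter (p e) (s e)).
Proof.
move=> Pp Ps; apply: (P_ext (@P_foldr _ _ _ (fun=> [::]) s (fun z => esize z.2 + 1)
  (P_const _ _) Ps _ (fun e a t => if p e a then a :: t else t) _ _)).
- by apply: pb_add (pb_const _ _); apply: P_size; exact: P_snd (@P_id _).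
- by move=> e t a /=; case: (p e a); rewrite ?esize_cons; lia.
- apply: P_if; last exact: P_snd (P_snd (@P_id _)).
    apply: (P_comp Pp (P_pair _ _)); first exact: P_fst (@P_id _).
    exact: P_fst (P_snd (@P_id _)).
  by apply: P_cons; [exact: P_fst (P_snd (@P_id _)) | exact: P_snd (P_snd (@P_id _))].
- by move=> e; elim: (s e) => //= a t ->.
Qed.

Lemma P_has (E : encType) (A : encType) (p : E -> A -> bool) (s : E -> seq A) :
  P (fun z : E * A => p z.1 z.2) -> P s -> P (fun e => has (p e) (s e)).
Proof.
move=> Pp Ps; apply: (P_ext (P_negb (P_nilp (P_filter Pp Ps)))) => e.
by rewrite has_filter; case: (filter _ _).
Qed.

Lemma P_all (E : encType) (A : encType) (p : E -> A -> bool) (s : E -> seq A) :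
  P (fun z : E * A => p z.1 z.2) -> P s -> P (fun e => all (p e) (s e)).
Proof.
move=> Pp Ps; apply: (P_ext (P_negb (@P_has _ _ (fun e a => ~~ p e a) _ (P_negb Pp) Ps))) => e.
by rewrite -all_predC; apply: eq_all => a /=; rewrite negbK.
Qed.

Lemma P_mem (E : encType) (A : encType) (x : E -> A) (s : E -> seq A) :
  P x -> P s -> P (fun e => x e \in s e).
Proof.
move=> Px Ps; apply: (P_ext (@P_has _ _ (fun e a => x e == a) _ _ Ps)) => [|e].
  by apply: P_eq; [exact: P_comp Px (P_fst (@P_id _)) | exact: P_snd (@P_id _)].
by rewrite -has_pred1; apply: eq_has => a /=; rewrite eq_sym.
Qed.

Lemma P_unzip1 (E : encType) (A B : encType) (s : E -> seq (A * B)) : P s -> P (fun e => unzip1 (s e)).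
Proof. by move=> Ps; apply: P_map => //; exact: P_fst (P_snd (@P_id _)). Qed.

Lemma P_len (E : encType) (A : encType) (s : E -> seq A) : P s -> P (fun e => size (s e)).
Proof.
move=> Ps; apply: (P_ext (@P_foldr _ _ _ (fun=> 0) s (fun=> 20) (P_const _ _) Ps
  (pb_const _ _) (fun e a n => n + 1) _ _)).
- by move=> e n a; have -> : 20 = esize 1 + 1 + 14 by []; have := esize_add n 1; lia.
- by apply: P_add (P_const _ _); exact: P_snd (P_snd (@P_id _)).
- by move=> e; elim: (s e) => //= a t ->; rewrite addn1.
Qed.

Lemma P_maxn (E : encType) (f g : E -> nat) : P f -> P g -> P (fun e => maxn (f e) (g e)).
Proof.
move=> Pf Pg; apply: (P_ext (P_if (P_leq Pf Pg) Pg Pf)) => e.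
by case: leqP.
Qed.

(** A list that is too large is dropped as a whole. The size is then bounded by the padding whatever
    was computed, as the folds demand, and a list that fits is exact. *)
Definition trunc (A : encType) (pad : seq unit) (s : seq A) : seq A :=
  if esize s <= size pad then s else [::].

Lemma esize_trunc (A : encType) pad (s : seq A) : esize (trunc pad s) <= (size pad).+1.
Proof. by rewrite /trunc; case: ifP => // h; apply: leq_trans h _. Qed.

Lemma P_trunc (E : encType) (A : encType) (pad : E -> seq unit) (s : E -> seq A) :
  P pad -> P s -> P (fun e => trunc (pad e) (s e)).
Proof.
move=> Pp Ps; apply: P_if => //; last exact: P_const.
apply: P_leq; last exact: P_len.
by apply: (P_ext (P_len (P_esize_fuel Ps))) => e; rewrite size_nseq.
Qed.


Lemma P_undup (E A : encType) (s : E -> seq A) : P s -> P (fun e => undup (s e)).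
Proof.
move=> Ps; apply: (P_ext (@P_foldr _ _ _ (fun=> [::]) s (fun z => esize z.2 + 1)
  (P_const _ _) Ps _ (fun e a t => if a \in t then t else a :: t) _ _)).
- by apply: pb_add (pb_const _ _); apply: P_size; exact: P_snd (@P_id _).
- by move=> e t a /=; case: (a \in t); rewrite ?esize_cons; lia.
- apply: P_if; last by apply: P_cons; [exact: P_fst (P_snd (@P_id _)) | exact: P_snd (P_snd (@P_id _))].
    by apply: P_mem; [exact: P_fst (P_snd (@P_id _)) | exact: P_snd (P_snd (@P_id _))].
  exact: P_snd (P_snd (@P_id _)).
- by move=> e; elim: (s e) => //= a t ->; rewrite mem_undup.
Qed.

Lemma size_le_trunc (A : encType) pad (s : seq A) : esize s <= size pad -> trunc pad s = s.
Proof. by rewrite /trunc => ->. Qed.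

(** [pt] chooses the closure property by the head symbol of the body; [pt_user] is a hook redefined
    as further functions become available. *)
Ltac pt_user := fail.
Ltac pt1 :=
  cbv beta;
  lazymatch goal with
  | |- P (fun e => e) => apply P_id
  | |- P fst => apply (P_fst (@P_id _))
  | |- P snd => apply (P_snd (@P_id _))
  | |- P (fun _ => ?c) => apply P_const
  | |- P (fun e => (@?f e).1) => apply (@P_fst _ _ _ f)
  | |- P (fun e => (@?f e).2) => apply (@P_snd _ _ _ f)
  | |- P (fun e => (@?f e, @?g e)) => apply (@P_pair _ _ _ f g)
  | |- P (fun e => @?f e :: @?g e) => apply (@P_cons _ _ f g)
  | |- P (fun e => if _ then _ else _) => apply P_if
  | |- P (fun e => @?f e && @?g e) => apply (@P_andb _ f g)
  | |- P (fun e => @?f e || @?g e) => apply (@P_orb _ f g)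
  | |- P (fun e => ~~ @?f e) => apply (@P_negb _ f)
  | |- P (fun e => @eq_op _ (@?f e) (@?g e)) =>
      match type of f with _ -> ?T => let A := open_constr:(_ : encType) in
        let T := eval cbn in T in unify T (Encodable.sort A); apply (@P_eq _ A f g) end
  | |- P (fun e => @?f e + @?g e) => apply (@P_add _ f g)
  | |- P (fun e => @?f e <= @?g e) => apply (@P_leq _ f g)
  | |- P (fun e => maxn (@?f e) (@?g e)) => apply (@P_maxn _ f g)
  | |- P (fun e => (@?f e).+1) => apply (fun H => P_ext H (fun e => addn1 (f e))); apply P_add
  | |- P (fun e => @?f e ++ @?g e) => apply (@P_cat _ _ f g)
  | |- P (fun e => size (@?f e)) => apply (@P_len _ _ f)
  | |- P (fun e => map (fun x => @?f e x) (@?s e)) => apply (@P_map _ _ _ f s)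
  | |- P (fun e => filter (fun x => @?f e x) (@?s e)) => apply (@P_filter _ _ f s)
  | |- P (fun e => has (fun x => @?f e x) (@?s e)) => apply (@P_has _ _ f s)
  | |- P (fun e => all (fun x => @?f e x) (@?s e)) => apply (@P_all _ _ f s)
  | |- P (fun e => flatten (@?s e)) => apply (@P_flatten _ _ s)
  | |- P (fun e => unzip1 (@?s e)) => apply (@P_unzip1 _ _ _ s)
  | |- P (fun e => undup (@?s e)) => apply (@P_undup _ _ s)
  | |- P (fun e => rev (@?s e)) => apply (@P_rev _ _ s)
  | |- P (fun e => nilp (@?s e)) => apply (@P_nilp _ _ s)
  | |- P (fun e => behead (@?s e)) => apply (@P_behead _ _ s)
  | |- P (fun e => head ?a (@?s e)) => apply (@P_head _ _ a s)
  | |- P (fun e => trunc (@?p e) (@?s e)) => apply (@P_trunc _ _ p s)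
  | |- P (fun e => in_mem (@?x e) _) =>
      match type of x with _ -> ?T =>
        let A := open_constr:(_ : encType) in
        let T := eval cbn in T in unify T (Encodable.sort A); apply (@P_mem _ A x) end
  | _ => pt_user
  end.
Ltac pt_hyp :=
  match goal with
  | H : P ?f |- P ?f => exact H
  | H : P ?f |- P (fun e => ?f e) => exact H
  | H : P ?f |- P (fun e => ?f (@?g e)) => apply (@P_comp _ _ _ f g H)
  end.
Ltac pt := repeat first [pt_hyp | pt1].

(** * Graph search *)

(* A search tree is the list of its arcs (child, parent), the newest first. *)
Definition reached (T : encType) (s : T) (t : seq (T * T)) (v : T) :=
  (v == s) || (v \in unzip1 t).
Definition bstep (T : encType) (s : T) (t : seq (T * T)) (a : T * T) :=
  if reached s t a.1 && ~~ reached s t a.2 then (a.2, a.1) :: t else t.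
Definition bround (T : encType) (s : T) (L : seq (T * T)) t := foldl (bstep s) t L.
(** The list [(s, s) :: L] only counts rounds: a search tree has at most [size L] arcs, so one of
    [size L + 1] rounds adds nothing. *)
Definition bfs (T : encType) (L : seq (T * T)) (s : T) :=
  foldl (fun t _ => bround s L t) [::] ((s, s) :: L).

Lemma P_reached (E T : encType) (s : E -> T) (t : E -> seq (T * T)) (v : E -> T) :
  P s -> P t -> P v -> P (fun e => reached (s e) (t e) (v e)).
Proof. by move=> Ps Pt Pv; rewrite /reached; pt. Qed.
Ltac pt_user ::= lazymatch goal with
  | |- P (fun e => reached (@?s e) (@?t e) (@?v e)) => apply (@P_reached _ _ s t v)
  end.

Lemma P_bround (E T : encType) (s : E -> T) (L t : E -> seq (T * T)) :
  P s -> P L -> P t -> P (fun e => bround (s e) (L e) (t e)).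
Proof.
move=> Ps PL Pt; apply: (@P_foldl _ _ _ t L (fun z => esize z.2 + 1) Pt PL _ (fun e => bstep (s e))).
- by apply: pb_add (pb_const _ _); apply: P_size; pt.
- move=> e u a /=; rewrite /bstep; case: ifP => _; last by lia.
  by rewrite esize_cons esize_pair esizeE; lia.
- by rewrite /bstep; pt.
Qed.

Lemma P_bfs (E T : encType) (s : E -> T) (L : E -> seq (T * T)) :
  P s -> P L -> P (fun e => bfs (L e) (s e)).
Proof.
move=> Ps PL; apply: (@P_foldl _ _ _ (fun=> [::]) (fun e => (s e, s e) :: L e)
   (fun z => esize (L z.1)) (P_const _ _) _ _ (fun e t _ => bround (s e) (L e) t)).
- by pt.
- by apply: P_size; pt.
- move=> e t a /=; rewrite /bround.
  have h := @esize_foldl _ _ (bstep (s e)) (fun a => (esize a).+1) t (L e).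
  rewrite [esize (L e)]esize_seq; apply: leq_trans (h _) _; last by lia.
  clear; move=> t1 a1; rewrite /bstep; case: ifP => _; last by lia.
  by rewrite esize_cons esize_pair esizeE; lia.
- by apply: P_bround; pt.
Qed.
Ltac pt_user ::= lazymatch goal with
  | |- P (fun e => reached (@?s e) (@?t e) (@?v e)) => apply (@P_reached _ _ s t v)
  | |- P (fun e => bfs (@?L e) (@?s e)) => apply (@P_bfs _ _ s L)
  end.

(** * Vertex separators *)

(** The words without repetition over [S], of the length of [F]. They serve twice: as candidates for
    the two sets to be separated, and as the linear orders of a bag. *)
Definition words (pad : seq unit) (S : seq nat) (F : seq unit) : seq (seq nat) :=
  foldl (fun W _ => trunc pad (flatten [seq [seq b :: w | b <- S & b \notin w] | w <- W]))
    [:: [::]] F.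

Lemma P_words (E : encType) pad S F :
  P pad -> P S -> P F -> P (fun e : E => words (pad e) (S e) (F e)).
Proof.
move=> Pp PS PF; apply: (@P_foldl _ _ _ (fun=> [:: [::]]) F
   (fun z => (esize (pad z.1)).+1) (P_const _ _) PF _ (fun e W _ => 
   trunc (pad e) (flatten [seq [seq b :: w | b <- S e & b \notin w] | w <- W]))).
- by apply: pb_S; apply: P_size; pt.
- move=> e s a /=; apply: leq_trans (esize_trunc _ _) _; apply: leq_trans (leq_addl _ _).
  by rewrite ltnS size_le_esize.
- by pt.
Qed.

(* Nodes of the network: (0, 0) and (1, 0) are the source and the sink, (2, v)
   and (3, v) the two halves of the vertex v. *)
Local Notation node := (nat * nat)%type.
Definition src : node := (0, 0).
Definition snk : node := (1, 0).

Definition harcs (V : seq nat) (Ed : seq (nat * nat)) (A B : seq nat) : seq (node * node) :=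
  undup ([seq (src, (2, a)) | a <- A] ++ [seq ((3, b), snk) | b <- B] ++
         [seq ((2, v), (3, v)) | v <- V] ++ [seq ((3, a.1), (2, a.2)) | a <- Ed]).

Definition residual (H f : seq (node * node)) :=
  [seq a <- H | a \notin f] ++ [seq (a.2, a.1) | a <- f].
Definition flip (f : seq (node * node)) (u v : node) :=
  if (v, u) \in f then [seq a <- f | a != (v, u)] else (u, v) :: f.
(** A search tree lists its newest arcs first, so a single pass over it follows the path from the
    current node back to the source. *)
Definition flip_step (z : node * seq (node * node)) (a : node * node) :=
  if a.1 == z.1 then (a.2, flip z.2 a.2 a.1) else z.
(** The new flow is listed as a sublist of [H], which bounds its size by that of [H] through all
    rounds. *)
Definition augment (H f t : seq (node * node)) :=
  if snk \in unzip1 t then [seq a <- H | a \in (foldl flip_step (snk, f) t).2] else f.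
Definition flow (H : seq (node * node)) (xs : seq unit) :=
  foldl (fun f _ => augment H f (bfs (residual H f) src)) [::] xs.
(** Every arc of the network has capacity one, so any kind of arc may lie in the cut. An arc is
    charged to a vertex: an arc from the source to its head, any other arc to its tail. *)
Definition vtx (a : node * node) := if a.1 == src then a.2.2 else a.1.2.
(** A list of length at most one plays the role of an option: it is empty when the sink is reached
    even after all augmentations. *)
Definition cut (V : seq nat) (H t : seq (node * node)) : seq (seq nat) :=
  if snk \in unzip1 t then [::]
  else [:: [seq v <- V | has (fun a => [&& reached src t a.1, ~~ reached src t a.2 & vtx a == v]) H]].
Definition separator V H xs := cut V H (bfs (residual H (flow H xs)) src).
Definition separators pad V Ed xs F S :=
  flatten [seq flatten [seq separator V (harcs V Ed A B) xs | B <- words pad S F] | A <- words pad S F].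

Lemma P_flip_step (E : encType) z a : P z -> P a -> P (fun e : E => flip_step (z e) (a e)).
Proof. by move=> Pz Pa; rewrite /flip_step /flip; pt. Qed.

Lemma P_augment (E : encType) H f t : P H -> P f -> P t ->
  P (fun e : E => augment (H e) (f e) (t e)).
Proof.
move=> PH Pf Pt; rewrite /augment; apply: P_if => //; first by pt.
apply: P_filter => //; apply: P_mem; first by pt.
apply: P_snd.
apply: (@P_foldl _ _ _ (fun e => (snk, f e.1)) (fun e => t e.1) (fun z => 3 * esize z.2 + 3) _ _ _ (fun=> flip_step)).
- by pt.
- by pt.
- apply: pb_add (pb_const _ _); apply: pb_mul (pb_const _ _) _.
  by apply: P_size; pt.
- move=> e [c g] [a1 a2] /=; rewrite /flip_step /=; case: ifP => _; last by lia.
  rewrite /flip; case: ifP => _; rewrite !esize_pair ?esize_cons ?esize_pair.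
    by set h := filter _ _; have : esize h <= esize g by [exact: esize_filter]; lia.
  by lia.
- by apply: P_flip_step; pt.
Qed.

Lemma P_flow (E : encType) H xs : P H -> P xs -> P (fun e : E => flow (H e) (xs e)).
Proof.
move=> PH Px; apply: (@P_foldl _ _ _ (fun=> [::]) xs (fun z => esize (H z.1)) (P_const _ _) Px _
  (fun e f _ => augment (H e) f (bfs (residual (H e) f) src))).
- by apply: P_size; pt.
- move=> e f a /=; rewrite /augment; case: ifP => _; last by lia.
  by apply: leq_trans (esize_filter _ _) _; lia.
- by rewrite /residual; apply: P_augment; pt.
Qed.

Ltac pt_user ::= lazymatch goal with
  | |- P (fun e => reached (@?s e) (@?t e) (@?v e)) => apply (@P_reached _ _ s t v)
  | |- P (fun e => bfs (@?L e) (@?s e)) => apply (@P_bfs _ _ s L)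
  | |- P (fun e => flow (@?H e) (@?x e)) => apply (@P_flow _ H x)
  end.

Lemma P_separator (E : encType) V H xs : P V -> P H -> P xs -> P (fun e : E => separator (V e) (H e) (xs e)).
Proof.
move=> PV PH Px; rewrite /separator; set t := fun e => bfs (residual (H e) (flow (H e) (xs e))) src.
have Pt : P t by rewrite /t /residual; pt.
by rewrite /cut -/t /vtx; change (P (fun e => if snk \in unzip1 (t e) then [::]
  else [:: [seq v <- V e | has (fun a => [&& reached src (t e) a.1, ~~ reached src (t e) a.2 & 
   (if a.1 == src then a.2.2 else a.1.2) == v]) (H e)]])); pt.
Qed.

Lemma P_separators (E : encType) pad V Ed xs F S : P pad -> P V -> P Ed -> P xs -> P F -> P S ->
  P (fun e : E => separators (pad e) (V e) (Ed e) (xs e) (F e) (S e)).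
Proof.
move=> Pp PV PE Px PF PS; have PW := P_words Pp PS PF; rewrite /separators.
apply: P_flatten; apply: (@P_map _ _ _ (fun e A => flatten [seq separator (V e) (harcs (V e) (Ed e) A B) (xs e) | B <- words (pad e) (S e) (F e)])); last exact: PW.
apply: P_flatten; apply: (@P_map _ _ _ (fun z B => separator (V z.1) (harcs (V z.1) (Ed z.1) z.2 B) (xs z.1))).
  by apply: P_separator; rewrite /harcs; pt.
apply: (P_comp PW); pt.
Qed.

(** * An elimination order *)

Definition component (Ed : seq (nat * nat)) (o : seq nat) (u : nat) :=
  u :: unzip1 (bfs [seq a <- Ed | (a.1 \notin o) && (a.2 \notin o)] u).
Definition boundary (Ed : seq (nat * nat)) (o D : seq nat) :=
  [seq y <- o | has (fun a => (a.1 == y) && (a.2 \in D)) Ed].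
Definition extend (V D o : seq nat) (u : nat) (c : seq (seq nat)) (z : bool) :=
  if nilp c then (false, u :: o)
  else (z, [seq y <- V | (y \in D) && ((y == u) || (y \in head [::] c))] ++ o).
(** The order grows at its head and is also eliminated from its head, so the vertices chosen first
    are eliminated last. *)
Definition order_step pad V Ed xs F s0 (z : bool * seq nat) (u : nat) : bool * seq nat :=
  if u \in z.2 then z
  else if size (boundary Ed z.2 (component Ed z.2 u)) < s0 then (z.1, u :: z.2)
  else extend V (component Ed z.2 u) z.2 u
    (separators pad V Ed xs F (boundary Ed z.2 (component Ed z.2 u))) z.1.
Definition elim_order pad V Ed xs F s0 :=
  foldl (order_step pad V Ed xs F s0) (true, [::]) V.

Lemma P_elim_order (E : encType) pad V Ed xs F s0 :
  P pad -> P V -> P Ed -> P xs -> P F -> P s0 ->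
  P (fun e : E => elim_order (pad e) (V e) (Ed e) (xs e) (F e) (s0 e)).
Proof.
move=> Pp PV PE Px PF Ps.
apply: (@P_foldl _ _ _ (fun=> (true, [::])) V (fun z => esize (V z.1) + esize z.2 + 3) (P_const _ _) PV _
  (fun e => order_step (pad e) (V e) (Ed e) (xs e) (F e) (s0 e))).
- by apply: pb_add (pb_const _ _); apply: pb_add; apply: P_size; pt.
- move=> e [b o] u /=; rewrite /order_step /=; case: ifP => _; first by lia.
  case: ifP => _; first by rewrite !esize_pair esize_cons; lia.
  rewrite /extend; case: nilP => _; first by rewrite !esize_pair esize_cons !esize_bool /=; lia.
  rewrite !esize_pair; set s := filter _ _.
  have : esize s <= esize (V e) by exact: esize_filter.
  by have : (esize (s ++ o)).+1 = esize s + esize o := esize_cat s o; lia.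
- have PD : P (fun z : E * ((bool * seq nat) * nat) => component (Ed z.1) z.2.1.2 z.2.2).
    by rewrite /component; pt.
  have PB : P (fun z : E * ((bool * seq nat) * nat) => boundary (Ed z.1) z.2.1.2 (component (Ed z.1) z.2.1.2 z.2.2)).
    by rewrite /boundary; move: PD; set D := (fun z => component _ _ _) => PD; 
       change (P (fun z : E * ((bool * seq nat) * nat) => [seq y <- z.2.1.2 | has (fun a => (a.1 == y) && (a.2 \in D z)) (Ed z.1)])); pt.
  have PS : P (fun z : E * ((bool * seq nat) * nat) => separators (pad z.1) (V z.1) (Ed z.1) (xs z.1) (F z.1)
     (boundary (Ed z.1) z.2.1.2 (component (Ed z.1) z.2.1.2 z.2.2))).
    by apply: P_separators => //; pt.
  rewrite /order_step /extend.
  move: PD PB PS; set D := (fun z => component _ _ _); set B := (fun z => boundary _ _ _);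
  set S := (fun z => separators _ _ _ _ _ _) => PD PB PS.
  change (P (fun z : E * ((bool * seq nat) * nat) => if z.2.2 \in z.2.1.2 then z.2.1
    else if size (B z) < s0 z.1 then (z.2.1.1, z.2.2 :: z.2.1.2)
    else if nilp (S z) then (false, z.2.2 :: z.2.1.2)
    else (z.2.1.1, [seq y <- V z.1 | (y \in D z) && ((y == z.2.2) || (y \in head [::] (S z)))] ++ z.2.1.2))).
  by pt.
Qed.

(** * Bucket elimination *)

(* A state lists the vertices of the scope of a factor in increasing order, each
   with the number of its parents chosen so far. *)
Local Notation state := (seq (nat * nat)).
Local Notation entry := (state * nat)%type.
Local Notation factor := (seq nat * seq entry)%type.

Definition parent_count (M : state) (u : nat) :=
  foldr (fun p s => if p.1 == u then p.2 + s else s) 0 M.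
Definition add_counts (L M : state) : state := [seq (p.1, p.2 + parent_count M p.1) | p <- L].
Definition compatible (sc : seq nat) (L M : state) :=
  unzip1 M == [seq u <- unzip1 L | u \in sc].
Definition fits (q : nat) (L : state) := all (fun p => p.2 <= q) L.
Definition join_entry (q : nat) (sc : seq nat) (e m : entry) : seq entry :=
  if compatible sc e.1 m.1 && fits q (add_counts e.1 m.1)
  then [:: (add_counts e.1 m.1, e.2 + m.2)] else [::].
Definition join q (acc : seq entry) (phi : factor) : seq entry :=
  flatten [seq flatten [seq join_entry q phi.1 e m | m <- phi.2] | e <- acc].
Definition put (t : seq entry) (e : entry) : seq entry :=
  if has (fun y => (y.1 == e.1) && (e.2 <= y.2)) t then t
  else e :: [seq y <- t | y.1 != e.1].
Definition prune (s : seq entry) := foldl put [::] s.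

Definition scope_of V (Phi : seq factor) v :=
  [seq u <- V | (u != v) && has (fun phi : factor => (v \in phi.1) && (u \in phi.1)) Phi].
Definition bag_start pad B : seq entry :=
  [seq ([seq (u, 0) | u <- w], 0) | w <- words pad B [seq tt | _ <- B]].
Definition join_all q pad acc (Phi : seq factor) :=
  foldl (fun acc phi => trunc pad (prune (join q acc phi))) acc Phi.
(** The count of [v] is final here, since no remaining factor has [v] in its scope, and every join
    has checked it against [q]. *)
Definition forget v (acc : seq entry) : seq entry :=
  [seq ([seq p <- e.1 | p.1 != v], e.2) | e <- acc].
Definition eliminate q pad V (Phi : seq factor) v : seq factor :=
  (scope_of V Phi v, trunc pad (prune (forget v
     (join_all q pad (bag_start pad (v :: scope_of V Phi v)) [seq phi : factor <- Phi | v \in phi.1]))))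
  :: [seq phi : factor <- Phi | v \notin phi.1].
Definition eliminate_all q pad V Phi o := foldl (eliminate q pad V) Phi o.

Definition best (t : seq entry) :=
  foldr (fun m s => if nilp m.1 then maxn m.2 s else s) 0 t.
Definition total_value (Phi : seq factor) := foldr (fun (phi : factor) s => best phi.2 + s) 0 Phi.

Local Notation arc := (nat * (nat * nat))%type.
(** Two entries leave the arc out, one for each order of its ends; the third uses it, which puts the
    tail before the head, adds [delta] to the count of the head and earns the score. *)
Definition arc_factor (delta : nat) (a : arc) : factor :=
  ([:: a.2.1; a.1],
   [:: ([:: (a.2.1, 0); (a.1, 0)], 0); ([:: (a.1, 0); (a.2.1, 0)], 0);
       ([:: (a.2.1, 0); (a.1, delta)], a.2.2)]).

Lemma P_parent_count (E : encType) M u : P M -> P u -> P (fun e : E => parent_count (M e) (u e)).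
Proof.
move=> PM Pu; apply: (@P_foldr _ _ _ (fun=> 0) M (fun z => esize z.2 + 1) (P_const _ _) PM _
  (fun e (p : nat * nat) s => if p.1 == u e then p.2 + s else s)).
- by apply: pb_add (pb_const _ _); apply: P_size; pt.
- move=> e s [p1 p2] /=; case: ifP => _; last by lia.
  by have := esize_add p2 s; rewrite esize_pair; lia.
- by pt.
Qed.

Lemma P_prune (E : encType) s : P s -> P (fun e : E => prune (s e)).
Proof.
move=> Ps; apply: (@P_foldl _ _ _ (fun=> [::]) s (fun z => esize z.2 + 1) (P_const _ _) Ps _ (fun=> put)).
- by apply: pb_add (pb_const _ _); apply: P_size; pt.
- move=> e t a /=; rewrite /put; case: ifP => _; first by lia.
  rewrite esize_cons; set f := filter _ _; have : esize f <= esize t by apply: esize_filter.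
  by lia.
- by rewrite /put; pt.
Qed.

Lemma P_join (E : encType) q acc phi : P q -> P acc -> P phi ->
  P (fun e : E => join (q e) (acc e) (phi e)).
Proof.
move=> Pq Pa Pp; rewrite /join.
apply: P_flatten; apply: (@P_map _ _ _ (fun z e => flatten [seq join_entry (q z) (phi z).1 e m | m <- (phi z).2])) => //.
apply: P_flatten; apply: (@P_map _ _ _ (fun z m => join_entry (q z.1) (phi z.1).1 z.2 m)); last by pt.
set X := fun z => _; pose M (z : (E * entry) * entry) := add_counts z.1.2.1 z.2.1.
have PM : P M.
  rewrite /M /add_counts; apply: (@P_map _ _ _ (fun z (p : nat * nat) => (p.1, p.2 + parent_count z.2.1 p.1))); last by pt.
  have PC : P (fun z : ((E * entry * entry) * (nat * nat)) => parent_count z.1.2.1 z.2.1).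
    by apply: P_parent_count; pt.
  by apply: P_pair; [pt | apply: P_add => //; pt].
rewrite /X /join_entry /compatible /fits.
change (P (fun z : (E * entry) * entry => if (unzip1 z.2.1 == [seq u <- unzip1 z.1.2.1 | u \in (phi z.1.1).1])
  && all (fun p => p.2 <= q z.1.1) (M z) then [:: (M z, z.1.2.2 + z.2.2)] else [::])).
by pt.
Qed.

Lemma P_join_all (E : encType) q pad acc Phi : P q -> P pad -> P acc -> P Phi ->
  P (fun e : E => join_all (q e) (pad e) (acc e) (Phi e)).
Proof.
move=> Pq Pp Pa Ph; apply: (@P_foldl _ _ _ acc Phi (fun z => (esize (pad z.1)).+1) Pa Ph _
  (fun e acc phi => trunc (pad e) (prune (join (q e) acc phi)))).
- by apply: pb_S; apply: P_size; pt.
- move=> e s a /=; apply: leq_trans (esize_trunc _ _) _; apply: leq_trans (leq_addl _ _).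
  by rewrite ltnS size_le_esize.
- by apply: P_trunc; [pt | apply: P_prune; apply: P_join; pt].
Qed.

Lemma P_eliminate_all (E : encType) q pad V Phi o : P q -> P pad -> P V -> P Phi -> P o ->
  P (fun e : E => eliminate_all (q e) (pad e) (V e) (Phi e) (o e)).
Proof.
move=> Pq Pp PV Ph Po; apply: (@P_foldl _ _ _ Phi o (fun z => esize (V z.1) + esize (pad z.1) + 4) Ph Po _
  (fun e => eliminate (q e) (pad e) (V e))).
- by apply: pb_add (pb_const _ _); apply: pb_add; apply: P_size; pt.
- move=> e F v; rewrite /eliminate esize_cons esize_pair; set t := trunc _ _; set s := scope_of _ _ _.
  set g := filter _ _; have : esize g <= esize F by apply: esize_filter.
  have : esize s <= esize (V e) by apply: esize_filter.
  have : esize t <= (size (pad e)).+1 by exact: esize_trunc.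
  have : size (pad e) <= esize (pad e) by exact: size_le_esize.
  by rewrite /=; lia.
- pose X := (E * (seq factor * nat))%type.
  have Psc : P (fun z : X => scope_of (V z.1) z.2.1 z.2.2) by rewrite /scope_of; pt.
  have PB : P (fun z : X => z.2.2 :: scope_of (V z.1) z.2.1 z.2.2) by apply: P_cons; [pt|].
  apply: P_cons; last by pt.
  apply: P_pair => //; apply: P_trunc; first by pt.
  apply: P_prune; rewrite /forget.
  apply: (@P_map _ _ _ (fun z (e : entry) => ([seq p <- e.1 | p.1 != z.2.2], e.2))); first by pt.
  apply: P_join_all; [by pt | by pt | | by pt].
  rewrite /bag_start.
  apply: (@P_map _ _ _ (fun z (w : seq nat) => ([seq (u, 0) | u <- w], 0))); first by pt.
  apply: P_words => //; first by pt.
  by apply: (@P_map _ _ _ (fun z _ => tt)) PB; pt.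
Qed.

Lemma P_total_value (E : encType) Phi : P Phi -> P (fun e : E => total_value (Phi e)).
Proof.
move=> Ph.
have Pb (X : encType) t : P t -> P (fun x : X => best (t x)).
  move=> Pt; apply: (@P_foldr _ _ _ (fun=> 0) t (fun z => esize z.2) (P_const _ _) Pt _
    (fun _ (m : entry) s => if nilp m.1 then maxn m.2 s else s)).
  - by apply: P_size; pt.
  - move=> e s [a1 a2] /=; case: ifP => _; last by lia.
    by rewrite esize_pair; case: (leqP a2 s) => _; lia.
  - by pt.
apply: (@P_foldr _ _ _ (fun=> 0) Phi (fun z => esize (best z.2.2) + 1) (P_const _ _) Ph _
  (fun _ (phi : factor) s => best phi.2 + s)).
- by apply: pb_add (pb_const _ _); apply: P_size; apply: Pb; pt.
- by move=> e s [a1 a2] /=; have := esize_add (best a2) s; lia.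
- by apply: P_add; [apply: Pb; pt | pt].
Qed.

(** * One stage of the algorithm *)

Definition fuel_mul (a b : seq unit) : seq unit := flatten [seq b | _ <- a].

Lemma P_fuel_mul (E : encType) a b : P a -> P b -> P (fun e : E => fuel_mul (a e) (b e)).
Proof.
by move=> Pa Pb; apply: P_flatten; apply: (@P_map _ _ _ (fun e _ => b e)) Pa; pt.
Qed.

Local Notation instance := (nat * (nat * (seq nat * (seq arc * (bool * nat)))))%type.
Definition delta_of (i : instance) := i.1.
Definition q_of (i : instance) := i.2.1.
Definition V_of (i : instance) := i.2.2.1.
Definition arcs_of (i : instance) := i.2.2.2.1.
Definition target_of (i : instance) := i.2.2.2.2.

Definition edges (s : seq arc) : seq (nat * nat) :=
  [seq (a.1, a.2.1) | a <- s] ++ [seq (a.2.1, a.1) | a <- s].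

(** In unary, with x = k + 1: the separator size x, the size a = 2x + 1 of the separated sets, and
    the threshold 3a + 2x. *)
Definition fuel_x (K : seq unit) := tt :: K.
Definition fuel_a (K : seq unit) := tt :: fuel_x K ++ fuel_x K.
Definition fuel_s (K : seq unit) := fuel_a K ++ fuel_a K ++ fuel_a K ++ fuel_x K ++ fuel_x K.

Definition padding (padk : seq unit) (i : instance) := fuel_mul padk (nseq (esize i) tt).
Definition stage_order (K padk : seq unit) (i : instance) :=
  elim_order (padding padk i) (V_of i) (edges (arcs_of i)) (fuel_x K) (fuel_a K) (size (fuel_s K)).
Definition stage_value (padk : seq unit) (i : instance) (o : seq nat) :=
  total_value (eliminate_all (q_of i) (padding padk i) (V_of i) (map (arc_factor (delta_of i)) (arcs_of i)) o).
(** The empty list means undecided. The test [q <= k] keeps the number of parent counts in the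
    tables bounded in [k]; a negative target is reached by every digraph. *)
Definition stage (z : seq unit * (seq unit * instance)) : seq bool :=
  if (q_of z.2.2 <= size z.1) && (stage_order z.1 z.2.1 z.2.2).1 then
    [:: (target_of z.2.2).1 || ((target_of z.2.2).2 <= stage_value z.2.1 z.2.2 (stage_order z.1 z.2.1 z.2.2).2)]
  else [::].

Lemma P_stage : P stage.
Proof.
pose X := (seq unit * (seq unit * instance))%type.
have Ppad : P (fun z : X => padding z.2.1 z.2.2).
  by apply: P_fuel_mul; [pt | apply: P_esize_fuel; pt].
have Po : P (fun z : X => stage_order z.1 z.2.1 z.2.2).
  apply: P_elim_order => //; rewrite /V_of /edges /arcs_of /fuel_s /fuel_a /fuel_x; pt.
have Pv : P (fun z : X => stage_value z.2.1 z.2.2 (stage_order z.1 z.2.1 z.2.2).2).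
  apply: P_total_value; apply: P_eliminate_all => //; rewrite /q_of /V_of; [by pt | by pt | | exact: P_snd].
  apply: (@P_map _ _ _ (fun (z : X) a => arc_factor (delta_of z.2.2) a)); last by rewrite /arcs_of; pt.
  by rewrite /arc_factor /delta_of; pt.
rewrite /stage; apply: P_if; last by pt.
  by apply: P_andb; [rewrite /q_of; pt | exact: P_fst].
apply: P_cons; last by pt.
by apply: P_orb; [rewrite /target_of; pt | apply: P_leq => //; rewrite /target_of; pt].
Qed.

(** * Running the stages *)

Lemma fuelE (s : seq unit) : s = nseq (size s) tt.
Proof. by elim: s => //= -[] s {1}->. Qed.

Lemma size_fuel_mul a b : size (fuel_mul a b) = size a * size b.
Proof. by elim: a => //= x a IH; rewrite /fuel_mul /= size_cat -/(fuel_mul a b) IH mulSn. Qed.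

Lemma fuel_mul_nseq m n : fuel_mul (nseq m tt) (nseq n tt) = nseq (m * n) tt.
Proof. by rewrite [LHS]fuelE size_fuel_mul !size_nseq. Qed.

Lemma run_init (E X : encType) (i : E -> X) (p : program) : P i ->
  exists q T, pb T /\ forall e v t, run p (enc (i e)) v t ->
    exists2 t', run q (enc e) v t' & t' <= t + T e.
Proof.
move=> [_ [pi [Ti [hT ri]]]].
have [q [j [k [_ [_ [q0 cj ck _ _]]]]]] :=
  link4P (fun i j _ _ => ECall i (ECall j EArg)) p pi [::] [::].
exists q, (fun e => Ti e + 3); split; first by apply: pb_add (pb_const _ _).
move=> e v t rt; have [u ru lu] := ri e.
exists ((1 + u).+1 + t).+1; last by lia.
rewrite /run q0; apply: eval_call; last exact: cj rt.
by apply: eval_call; [apply: eval_arg | exact: ck ru].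
Qed.

(** Repeated squaring of a unary number. The result is doubly exponential, so [rec_run] is used
    directly and its time bound is discarded. *)
Lemma computable_pow D : computable (fun k => D ^ (2 ^ k)).
Proof.
pose X := (seq unit * seq unit)%type.
pose f (z : X) := nseq (size z.2 ^ (2 ^ size z.1)) tt.
have fE z : f z = if nilp z.1 then z.2 else f (behead z.1, fuel_mul z.2 z.2).
  case: z => -[|x n] a; rewrite /f /=; first by rewrite expn1 -fuelE.
  by rewrite size_fuel_mul expnS expnM mulnn.
have [||||p [T [U [_ _ h]]]] := @rec_run X (seq unit) f (fun z => nilp z.1)
  (fun z => (behead z.1, fuel_mul z.2 z.2)) (fun z => z.2) (fun _ y => y) fE.
- by pt.
- by apply: P_pair; [pt | apply: P_fuel_mul; pt].
- by pt.
- by pt.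
have [|q [Q [_ hq]]] := @run_init (seq unit) X (fun n => (n, nseq D tt)) p.
  by pt.
exists q => n.
have hit i : i <= n -> iter i (fun z : X => (behead z.1, fuel_mul z.2 z.2)) (nseq n tt, nseq D tt)
   = (nseq (n - i) tt, nseq (D ^ (2 ^ i)) tt).
  elim: i => [|i IH] hi; first by rewrite subn0 expn1.
  rewrite iterS IH /=; last by lia.
  by rewrite fuel_mul_nseq mulnn -expnM expnSr; congr (_, _); rewrite subnS; case: (n - i).
have [|| t rt _] := h n (nseq n tt, nseq D tt).
- move=> i hi; rewrite hit; last by lia.
  by rewrite /= /nilp size_nseq subn_eq0 -ltnNge.
- by rewrite hit // subnn.
have [t' rt' _] := hq (nseq n tt) _ _ rt.
by exists t'; rewrite -!enc_fuel; move: rt'; rewrite /f /= !size_nseq.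
Qed.

Section FirstHit.
Variables (X : Type) (b : X -> bool) (r : X -> X) (g : X -> bool).

(** [rec_run] wants a total function satisfying the recursion equation. Where the search never stops
    the value is [false], which is constant along [r], so the equation holds there too. *)
Definition first_hit (z : X) : bool :=
  if pselect (exists n, b (iter n r z)) is left h then g (iter (ex_minn h) r z) else false.

Lemma first_hitP z n : b (iter n r z) -> (forall m, b (iter m r z) -> n <= m) ->
  first_hit z = g (iter n r z).
Proof.
move=> bn nmin; rewrite /first_hit; case: (pselect _) => [h|[]]; last by exists n.
case: ex_minnP => m bm mmin; suff -> : m = n by [].
by apply/eqP; rewrite eqn_leq mmin // nmin.
Qed.

Lemma first_hitE z : first_hit z = if b z then g z else first_hit (r z).
Proof.
case: (pselect (exists n, b (iter n r z))) => [h|nh].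
  case: (ex_minnP h) => n bn nmin; rewrite (first_hitP bn nmin).
  case: (boolP (b z)) => bz.
    by have := nmin 0 bz; rewrite leqn0 => /eqP->.
  case: n bn nmin => [|n] bn nmin; first by rewrite bn in bz.
  rewrite (@first_hitP (r z) n) -?iterSr // => m; rewrite -iterSr => /nmin.
  by rewrite ltnS.
have -> : b z = false by apply/negP => h; apply: nh; exists 0.
rewrite /first_hit; case: (pselect _) => // _.
by case: (pselect _) => // -[n hn]; case: nh; exists n.+1; rewrite iterSr.
Qed.
End FirstHit.

Section Driver.
Variables (I : Type) (J : encType) (encI : I -> tree) (j : I -> J).
Hypothesis encIE : forall i, encI i = enc (j i).
Variables (mk : J -> instance) (yes : I -> Prop) (kappa : I -> nat) (C : nat).
Hypothesis Pmk : P mk.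
Hypothesis C2 : 1 < C.
Let st (k : nat) (x : instance) := stage (nseq k tt, (nseq (C ^ (2 ^ k)) tt, x)).
Hypothesis stop : forall i, exists2 k, k <= kappa i & st k (mk (j i)) <> [::].
Hypothesis sound : forall i k b, st k (mk (j i)) = [:: b] -> b <-> yes i.

Let X := (seq unit * (seq unit * instance))%type.
(** Squaring the padding turns C^(2^k) into C^(2^(k+1)). *)
Let r (z : X) : X := (tt :: z.1, (fuel_mul z.2.1 z.2.1, z.2.2)).
Let b (z : X) := ~~ nilp (stage z).
Let g (z : X) := head false (stage z).
Let f := first_hit b r g.

Let e0 (x : J) : X := ([::], (nseq C tt, mk x)).

Let iter_r n x : iter n r (e0 x) = (nseq n tt, (nseq (C ^ (2 ^ n)) tt, mk x)).
Proof.
elim: n => [|n IH]; first by rewrite expn1.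
by rewrite iterS IH /r /= fuel_mul_nseq mulnn -expnM -expnSr.
Qed.

Lemma driver : fpt encI yes kappa.
Proof.
have [||||p [T [U [[c1 hT] [c2 hU] hrun]]]] := @rec_run X bool f b r g (fun _ y => y) (first_hitE b r g).
- by apply: P_negb; apply: P_nilp; exact: P_stage.
- by apply: P_pair; [pt | apply: P_pair; [apply: P_fuel_mul; pt | pt]].
- by apply: P_head; exact: P_stage.
- by pt.
have [|q [Q [[c4 hQ] hq]]] := @run_init J X e0 p.
  by rewrite /e0; apply: P_pair; [pt | apply: P_pair => //; pt].
have [c3 hmk] := P_size Pmk.
(* [w1 e] will bound the size of every argument met by the loop, in terms of one unary number
   [e]. *)
pose w1 (e : seq unit) := 4 * esize e + c3 * esize e ^ c3 + 10.
have [c hc] : pb (fun e : seq unit => (esize e).+1 * (c1 * w1 e ^ c1 + c2 * w1 e ^ c2)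
   + c4 * esize e ^ c4).
  have pw : pb w1.
    apply: pb_add (pb_const _ _); apply: pb_add; last exact: pb_poly (@pb_esize _).
    exact: pb_mul (pb_const _ _) (@pb_esize _).
  apply: pb_add; last exact: pb_poly (@pb_esize _).
  by apply: pb_mul; [apply: pb_S; exact: pb_esize | apply: pb_add; exact: pb_poly].
(* The 3 comes from [esize e = 2GS + 1 <= 3GS] below; the constant factors are raised to the power
   2^k as well, so that the bound has the form treated by [computable_pow]. *)
exists q, (fun k => (c.+1 * 3 ^ c * C ^ c) ^ (2 ^ k)), c; split; first exact: computable_pow.
move=> i; have [k0 lek0 sk0] := stop i.
have hex : exists n, b (iter n r (e0 (j i))).
  by exists k0; rewrite iter_r /b; apply/negP => /nilP.
case: (ex_minnP hex) => n bn nmin.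
have nk : n <= kappa i.
  by apply: leq_trans lek0; apply: nmin; rewrite iter_r /b; apply/negP => /nilP.
have [|t rt tle] := hrun n (e0 (j i)) _ bn.
  by move=> m hm; apply/negP => /nmin; rewrite leqNgt hm.
have [t' rt' t'le] := hq _ _ _ rt.
exists (enc (f (e0 (j i)))), t'; rewrite encIE; split=> //.
(* All sizes are measured by the product of G, which depends on the parameter only, and the input
   size S; a polynomial in G * S splits into a factor in G and one in S. *)
- pose G := C ^ (2 ^ kappa i); pose S := esize (j i).
  pose e : seq unit := nseq (G * S) tt.
  have Ce m : C ^ m > m by elim: m => [|m IH] //; rewrite expnS; nia.
  have G1 : kappa i < G.
    by apply: ltn_trans (Ce _); rewrite ltn_expl.
  have S0 : 0 < S by exact: esize_gt0.
  have eE : esize e = (G * S).*2.+1 by rewrite esize_fuel size_nseq.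
  have Ge : G <= G * S by rewrite leq_pmulr.
  have Se : S <= G * S by rewrite leq_pmull //; lia.
  have sz m : m <= n -> esize (iter m r (e0 (j i))) + 4 <= w1 e.
    move=> hm; rewrite iter_r !esize_pair !esize_fuel !size_nseq /w1.
    have h1 : C ^ 2 ^ m <= G by rewrite leq_exp2l // leq_exp2l //; lia.
    have h2 : esize (mk (j i)) <= c3 * esize e ^ c3.
      apply: leq_trans (hmk _) _; apply: leq_mul => //; apply: leq_exp2r'.
      by rewrite eE -/S; lia.
    by move: h2; rewrite eE; move: (c3 * _) => h3; lia.
  have t'le2 : t' <= (esize e).+1 * (c1 * w1 e ^ c1 + c2 * w1 e ^ c2) + c4 * esize e ^ c4.
    apply: leq_trans t'le _; apply: leq_add; last first.
      apply: leq_trans (hQ _) _; apply: leq_mul => //; apply: leq_exp2r'.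
      by rewrite eE -/S; lia.
    apply: leq_trans tle _.
    have hT' m : m <= n -> T (iter m r (e0 (j i))) <= c1 * w1 e ^ c1.
      move=> hm; apply: leq_trans (hT _) _; apply: leq_mul => //; apply: leq_exp2r'.
      by apply: leq_trans (sz m hm); apply: leq_addr.
    apply: (@leq_trans (n.+1 * (c1 * w1 e ^ c1 + c2 * w1 e ^ c2))); last first.
      by rewrite leq_mul2r; apply/orP; right; rewrite eE; lia.
    rewrite mulSn addnC; apply: leq_add.
      by apply: leq_trans (hT' _ (leqnn _)) _; lia.
    rewrite -[X in X * _](card_ord n) -sum_nat_const; apply: leq_sum => m _.
    apply: leq_add; first by apply: hT'; apply: ltnW.
    apply: leq_trans (hU _) _; apply: leq_mul => //; apply: leq_exp2r'.
    apply: leq_trans (sz m (ltnW (ltn_ord m))); rewrite esize_pair esize_bool -addnS leq_add2l.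
    by move: (nat_of_bool _) (leq_b1 (first_hit b r g (iter m.+1 r (e0 (j i))))) => ? ?; lia.
  apply: leq_trans t'le2 _; apply: leq_trans (hc e) _.
  apply: (@leq_trans (c.+1 * 3 ^ c * G ^ c * S ^ c)).
    rewrite -!mulnA; apply: leq_mul => //; rewrite -!expnMn; apply: leq_exp2r'.
    by rewrite eE; lia.
  rewrite leq_mul2r; apply/orP; right.
  rewrite expnMn -[(C ^ c) ^ _]expnM [c * 2 ^ _]mulnC expnM -/G leq_mul2r; apply/orP; right.
  rewrite -{1}[_ * _]expn1; apply: leq_pexp2l; last by rewrite expn_gt0.
  by rewrite muln_gt0 expn_gt0.
- have fv := first_hitP g bn nmin.
  move: bn; rewrite /f fv /g /b iter_r -/(st n (mk (j i))).
  have: size (st n (mk (j i))) <= 1 by rewrite /st /stage; case: ifP.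
  case es: (st n (mk (j i))) => [|c0 [|]] //= _ _.
  rewrite -(sound es); split; first by case: c0 {es}.
  by move=> h; rewrite h.
Qed.
End Driver.

(** * Correctness of the search *)

Section Bfs.
Variables (T : encType) (s : T).
Implicit Types (L t : seq (T * T)) (v : T) (a : T * T).

Fixpoint search_tree L t : Prop :=
  if t is a :: t' then
    [/\ search_tree L t', (a.2, a.1) \in L, reached s t' a.2 & ~~ reached s t' a.1]
  else True.

Lemma reached_cons a t v : reached s (a :: t) v = reached s t v || (v == a.1).
Proof. by rewrite /reached /= inE [_ == a.1]eq_sym -!orbA; congr (_ || _); rewrite orbC eq_sym. Qed.

Lemma bstep_tree L t a : search_tree L t -> a \in L -> search_tree L (bstep s t a).
Proof.
rewrite /bstep; case: ifP => // /andP[h1 h2] ht ha; split=> //=.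
by case: a ha {h1 h2}.
Qed.

Lemma bround_tree L L' t : {subset L' <= L} -> search_tree L t -> search_tree L (bround s L' t).
Proof.
rewrite /bround; elim: L' t => //= a L' IH t h ht; apply: IH.
  by move=> b hb; apply: h; rewrite inE hb orbT.
by apply: bstep_tree => //; apply: h; rewrite mem_head.
Qed.

Lemma bfs_tree L : search_tree L (bfs L s).
Proof.
rewrite /bfs; have : search_tree L [::] by [].
elim: (_ :: _) [::] => //= _ M IH t ht; apply: IH; exact: bround_tree.
Qed.

Lemma tree_uniq L t : search_tree L t -> uniq (unzip1 t) /\ s \notin unzip1 t.
Proof.
elim: t => //= a t IH [/IH[u1 u2] _ _]; rewrite /reached negb_or => /andP[h1 h2].
by rewrite h2 u1 inE negb_or u2 eq_sym h1.
Qed.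

Lemma tree_size_le L t : search_tree L t -> size t <= size L.
Proof.
move=> ht; have [u _] := tree_uniq ht.
rewrite -(size_map fst t) -(size_map snd L); apply: uniq_leq_size => //.
move=> v; elim: t ht {u} => //= a t IH [/IH h ha _ _]; rewrite inE => /orP[/eqP->|//].
by apply/mapP; exists (a.2, a.1).
Qed.

(** The reached set lies in every set that contains the root and is closed under the arcs;
    [bfs_closed] is the other half. *)
Lemma tree_min L t (p : pred T) : search_tree L t -> p s ->
  (forall a, a \in L -> p a.1 -> p a.2) -> forall v, reached s t v -> p v.
Proof.
move=> ht ps pL v; rewrite /reached => /orP[/eqP-> //|].
elim: t ht v => //= a t IH [ht ha hr _] v; rewrite inE => /orP[/eqP->|]; last exact: IH.
apply: (pL _ ha) => /=; move: hr; rewrite /reached => /orP[/eqP-> //|]; exact: IH.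
Qed.

Lemma tree_reached L t a : search_tree L t -> a \in t -> reached s t a.1 && reached s t a.2.
Proof.
elim: t => //= b t IH [ht _ hr _]; rewrite inE !reached_cons => /orP[/eqP->|/(IH ht)/andP[->->] //].
by rewrite eqxx hr orbT.
Qed.

Lemma tree_sub L L' t : search_tree L t ->
  (forall a, a \in t -> (a.2, a.1) \in L -> (a.2, a.1) \in L') -> search_tree L' t.
Proof.
elim: t => //= a t IH [h1 h2 h3 h4] h; split=> //; last by apply: h => //; rewrite mem_head.
by apply: IH => // b hb; apply: h; rewrite inE hb orbT.
Qed.

Lemma bstep_size t a : size t <= size (bstep s t a).
Proof. by rewrite /bstep; case: ifP => //=. Qed.
Lemma bround_size L t : size t <= size (bround s L t).
Proof. by rewrite /bround; elim: L t => //= a L IH t; apply: leq_trans (bstep_size t a) (IH _). Qed.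

Lemma bround_stable L t : size (bround s L t) = size t ->
  bround s L t = t /\ forall a, a \in L -> reached s t a.1 -> reached s t a.2.
Proof.
rewrite /bround; elim: L t => //= a L IH t h.
have e : bstep s t a = t.
  have := bround_size L (bstep s t a); rewrite /bround h; have := bstep_size t a.
  by rewrite {2 3}/bstep /bstep; case: ifP => //= _ _; rewrite ltnn.
rewrite e in h *; have [-> hL] := IH _ h; split=> // b; rewrite inE => /orP[/eqP->|]; last exact: hL.
move=> ra; apply/negPn/negP => nr; move: (congr1 size e); rewrite /bstep ra nr /=; lia.
Qed.

(** Once a round adds nothing, all later rounds repeat it; if every round added an arc, the tree
    would have more arcs than [L]. *)
Lemma bfs_closed L a : a \in L -> reached s (bfs L s) a.1 -> reached s (bfs L s) a.2.
Proof.
have key (M : seq (T * T)) t : let u := foldl (fun t _ => bround s L t) t M in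
   size (bround s L u) = size u \/ size t + size M <= size u.
  elim: M t => [|m M IH] t /=; first by right; lia.
  case: (boolP (size (bround s L t) == size t)) => [/eqP h|h].
    have [e _] := bround_stable h.
    have -> : foldl (fun t _ => bround s L t) (bround s L t) M = t.
      by rewrite e; elim: (M) => //= _ M' IH'; rewrite e.
    by left.
  have h2 := bround_size L t.
  have [->|h3] := IH (bround s L t); [by left | right].
  by move: h h2 h3; rewrite /=; lia.
have [h|h] := key ((s, s) :: L) [::]; first exact: (proj2 (bround_stable h)).
by have := tree_size_le (bfs_tree L); rewrite /bfs; move: h => /=; lia.
Qed.
End Bfs.

(** * Correctness of the flow *)

Definition leaving (R : pred node) (f : seq (node * node)) :=
  count (fun a => R a.1 && ~~ R a.2) f.
Definition entering (R : pred node) (f : seq (node * node)) :=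
  count (fun a => ~~ R a.1 && R a.2) f.

Lemma mem_residual H f (u v : node) :
  ((u, v) \in residual H f) = ((u, v) \in H) && ((u, v) \notin f) || ((v, u) \in f).
Proof.
rewrite mem_cat mem_filter andbC; congr (_ || _).
apply/mapP/idP => [[[x y] h [-> ->]] //|h]; by exists (v, u).
Qed.

Lemma count_filter_neq (T : eqType) (p : pred T) (f : seq T) x : uniq f -> x \in f ->
  count p f = count p [seq a <- f | a != x] + p x.
Proof.
move=> uf xf; rewrite -(rem_filter x uf).
by have /permP/(_ p) /= := perm_to_rem xf; lia.
Qed.

Lemma flipP H f u v : uniq f -> {subset f <= H} -> (u, v) \in residual H f ->
  [/\ uniq (flip f u v), {subset flip f u v <= H} &
   forall R : pred node, leaving R (flip f u v) + entering R f + R v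
     = leaving R f + entering R (flip f u v) + R u].
Proof.
move=> uf sf; rewrite mem_residual /flip; case: ifP => [vuf _|nvu].
  split; first exact: filter_uniq.
    by move=> a; rewrite mem_filter => /andP[_ /sf].
  move=> R; rewrite /leaving /entering.
  have := count_filter_neq (fun a : node * node => R a.1 && ~~ R a.2) uf vuf.
  have := count_filter_neq (fun a : node * node => ~~ R a.1 && R a.2) uf vuf => /=.
  by case: (R u); case: (R v) => /=; lia.
rewrite orbF => /andP[h1 h2]; split; first by rewrite /= h2.
  by move=> a; rewrite inE => /orP[/eqP->|/sf].
by move=> R; rewrite /leaving /entering /=; case: (R u); case: (R v) => /=; lia.
Qed.

Lemma flip_other f u v x y : x != v -> y != v -> ((x, y) \in flip f u v) = ((x, y) \in f).
Proof.
move=> xv yv; rewrite /flip; case: ifP => _.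
  rewrite mem_filter; case: eqP => // -[e _]; by rewrite e eqxx in xv.
rewrite inE; case: eqP => // -[_ e]; by rewrite e eqxx in yv.
Qed.

(** The path is flipped from its far end. Older tree arcs avoid the child [a.1] just left, so
    flipping its arc does not affect them, and the rest of the tree is a search tree of the new
    residual network. *)
Lemma augment_path H f t cur : uniq f -> {subset f <= H} ->
  search_tree src (residual H f) t -> reached src t cur ->
  let f' := (foldl flip_step (cur, f) t).2 in
  [/\ uniq f', {subset f' <= H} &
   forall R : pred node, leaving R f' + entering R f + R cur
     = leaving R f + entering R f' + R src].
Proof.
elim: t cur f => [|a t IH] cur f uf sf.
  by rewrite /reached /= orbF => _ /eqP->; split.
move=> /= [ht ha ra nra]; rewrite reached_cons.
case: (eqVneq cur a.1) => [->{cur} _|ne /=]; last first.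
  rewrite orbF => rc; have -> : flip_step (cur, f) a = (cur, f).
    by rewrite /flip_step /= eq_sym (negbTE ne).
  exact: IH.
have -> : flip_step (a.1, f) a = (a.2, flip f a.2 a.1) by rewrite /flip_step /= eqxx.
have [u1 s1 c1] := flipP uf sf ha.
have ht1 : search_tree src (residual H (flip f a.2 a.1)) t.
  apply: (tree_sub ht) => b bt; have /andP[r1 r2] := tree_reached ht bt.
  have n1 : b.1 != a.1 by apply: contraNneq nra => <-.
  have n2 : b.2 != a.1 by apply: contraNneq nra => <-.
  by rewrite !mem_residual !flip_other.
have [u2 s2 c2] := IH a.2 _ u1 s1 ht1 ra.
split=> // R; move: (c1 R) (c2 R) => /=; lia.
Qed.

(** Conservation is stated for all node sets at once, not node by node: in this form it survives
    flips by a local count, and the value of a cut can be read off directly. *)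
Definition flow_inv (H : seq (node * node)) n (f : seq (node * node)) :=
  [/\ uniq f, {subset f <= H} &
   forall R : pred node, leaving R f + n * R snk = entering R f + n * R src].

Lemma augment_inv H n f : uniq H -> flow_inv H n f ->
  snk \in unzip1 (bfs (residual H f) src) ->
  flow_inv H n.+1 (augment H f (bfs (residual H f) src)).
Proof.
move=> uH [uf sf cf] hs; rewrite /augment hs.
have hr : reached src (bfs (residual H f) src) snk by rewrite /reached hs orbT.
have [u1 s1 c1] := augment_path uf sf (bfs_tree _ _) hr.
set f' := (foldl _ _ _).2 in u1 s1 c1 *.
have pe : perm_eq [seq a <- H | a \in f'] f'.
  apply: uniq_perm => //; first exact: filter_uniq.
  move=> a; rewrite mem_filter; case: (boolP (a \in f')) => // /s1 ->.
  by [].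
split; first exact: filter_uniq.
  by move=> a; rewrite mem_filter => /andP[].
move=> R; have /permP pe' := pe; rewrite /leaving /entering !pe' -/(leaving R f') -/(entering R f').
have := c1 R; have := cf R; rewrite !mulSn; lia.
Qed.

Lemma flowP H xs : uniq H -> exists2 n, n <= size xs & flow_inv H n (flow H xs) /\
  (n = size xs \/ snk \notin unzip1 (bfs (residual H (flow H xs)) src)).
Proof.
move=> uH; rewrite /flow.
suff: forall m f, flow_inv H m f -> exists2 n, n <= m + size xs &
  flow_inv H n (foldl (fun f _ => augment H f (bfs (residual H f) src)) f xs) /\
  (n = m + size xs \/ snk \notin unzip1 (bfs (residual H
     (foldl (fun f _ => augment H f (bfs (residual H f) src)) f xs)) src)).
  by move=> /(_ 0 [::]); rewrite add0n; apply; split.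
elim: xs => [|x xs IH] m f hf /=.
  by exists m; rewrite addn0 //; split=> //; left.
case: (boolP (snk \in unzip1 (bfs (residual H f) src))) => hs.
  have [n le_n h] := IH _ _ (augment_inv uH hf hs).
  by exists n; [lia | move: h; rewrite addnS].
have e : augment H f (bfs (residual H f) src) = f by rewrite /augment (negbTE hs).
have e2 : foldl (fun f _ => augment H f (bfs (residual H f) src)) f xs = f.
  by elim: (xs) => //= _ xs' IH'; rewrite e.
by rewrite e e2; exists m; [lia | split=> //; right].
Qed.

(** * Separations *)

(** [Z] is the side of [A] behind the separator [X]; both [A] and [B] may meet [X]. *)
Definition separates (Ed : seq (nat * nat)) (A B X : seq nat) (Z : pred nat) :=
  [/\ forall a, a \in A -> Z a || (a \in X),
      forall b, b \in B -> ~~ Z b &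
      forall a, a \in Ed -> Z a.1 -> Z a.2 || (a.2 \in X)].

Lemma mem_harcs V Ed A B (x : node * node) : (x \in harcs V Ed A B) =
  [|| x \in [seq (src, (2, a)) | a <- A], x \in [seq ((3, b), snk) | b <- B],
      x \in [seq ((2, v), (3, v)) | v <- V] | x \in [seq ((3, a.1), (2, a.2)) | a <- Ed]].
Proof. by rewrite mem_undup !mem_cat. Qed.

(** Max-flow min-cut on the reached set: every arc leaving it carries flow and no flow arc enters
    it, so exactly n arcs leave, and [vtx] maps them onto [X]. The side [Z] consists of the vertices
    outside [X] whose second half is reached. *)
Lemma separator_sound V Ed A B xs X : uniq V -> {subset A <= V} -> {subset B <= V} ->
  (forall a, a \in Ed -> (a.1 \in V) && (a.2 \in V)) ->
  X \in separator V (harcs V Ed A B) xs ->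
  size X <= size xs /\ exists Z, separates Ed A B X Z.
Proof.
move=> uV AV BV EV; rewrite /separator /cut.
set H := harcs V Ed A B; set f := flow H xs; set t := bfs _ src.
case: ifP => //= ns; rewrite inE => /eqP eX.
have uH : uniq H by exact: undup_uniq.
have [n len [[uf sf cf] _]] := flowP xs uH; rewrite -/f in uf sf cf.
pose R := reached src t.
have Rs : R src by rewrite /R /reached eqxx.
have Rt : R snk = false by rewrite /R /reached ns.
have cutf a : a \in H -> R a.1 -> ~~ R a.2 -> a \in f.
  move=> aH r1 r2; apply/negPn/negP => naf; move/negP: r2; apply.
  apply: (@bfs_closed _ src (residual H f) a) => //.
  by case: a aH naf {r1} => u v aH naf; rewrite mem_residual aH naf.
have no_enter : entering R f = 0.
  apply/eqP; rewrite -leqn0 leqNgt -has_count; apply/hasP => -[[u v] af /andP[/= /negP r1 r2]].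
  apply: r1; apply: (@bfs_closed _ src (residual H f) (v, u)) => //.
  by rewrite mem_residual af orbT.
have lvn : leaving R f = n by have := cf R; rewrite no_enter Rs Rt; lia.
have memX v : v \in X <-> v \in V /\ exists2 a, a \in H & [/\ R a.1, ~~ R a.2 & vtx a = v].
  rewrite eX mem_filter; split.
    by move=> /andP[/hasP[a aH /and3P[r1 r2 /eqP<-]] vV]; split=> //; exists a.
  move=> [vV [a aH [r1 r2 e]]]; rewrite vV andbT; apply/hasP; exists a => //.
  by rewrite -/R; apply/and3P; split=> //; apply/eqP.
split.
  apply: leq_trans len; rewrite -lvn /leaving -size_filter -(size_map vtx).
  apply: uniq_leq_size; first by rewrite eX filter_uniq.
  move=> v /memX [_ [a aH [r1 r2 <-]]]; apply: map_f; rewrite mem_filter r1 r2 /=; exact: cutf.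
exists (fun v => R (3, v) && (v \notin X)); split.
- move=> a aA; have aV := AV _ aA.
  case: (boolP (a \in X)) => naX; rewrite ?orbT // orbF andbT.
  apply/negPn/negP => r3; move/negP: naX; apply; apply/memX; split=> //.
  case: (boolP (R (2, a))) => r2.
    by exists ((2, a), (3, a)) => //; rewrite mem_harcs; apply/or4P/Or43/mapP; exists a.
  by exists (src, (2, a)) => //; rewrite mem_harcs; apply/or4P/Or41/mapP; exists a.
- move=> b bB; apply/negP => /andP[r3 nbX]; move/negP: nbX; apply; apply/memX.
  have h : ((3, b), snk) \in H by rewrite mem_harcs; apply/or4P/Or42/mapP; exists b.
  have bV := BV _ bB.
  by split=> //; exists ((3, b), snk) => //; rewrite Rt.
- move=> [u v] uv /= /andP[r3 nuX]; have /andP[/= uV1 vV] := EV _ uv.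
  have r2 : R (2, v).
    apply/negPn/negP => nr2; move/negP: nuX; apply; apply/memX; split=> //.
    exists ((3, u), (2, v)) => //; rewrite mem_harcs; apply/or4P/Or44/mapP; by exists (u, v).
  case: (boolP (v \in X)) => nvX; rewrite ?orbT // orbF andbT.
  apply/negPn/negP => r3'; move/negP: nvX; apply; apply/memX; split=> //.
  by exists ((2, v), (3, v)) => //; rewrite mem_harcs; apply/or4P/Or43/mapP; exists v.
Qed.

(** If the sink were still reached, one more augmentation would give [size xs + 1] units. The cut
    with first halves in Z or X and second halves in Z is left only by the inner arcs of vertices of
    X, too few for that flow. *)
Lemma separator_complete V Ed A B xs X Z : separates Ed A B X Z -> size X <= size xs ->
  separator V (harcs V Ed A B) xs != [::].
Proof.
move=> [sA sB sE] sX; rewrite /separator /cut.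
set H := harcs V Ed A B; set f := flow H xs; case: ifP => // hs.
have uH : uniq H by exact: undup_uniq.
have [n len [inv [en|]]] := flowP xs uH; last by rewrite hs.
have [u1 s1 c1] := augment_inv uH inv hs.
set f' := augment _ _ _ in u1 s1 c1.
pose R : pred node := fun x => [|| x == src, (x.1 == 2) && (Z x.2 || (x.2 \in X)) | (x.1 == 3) && Z x.2].
have Rs : R src by [].
have Rt : R snk = false by [].
have : leaving R f' <= size X.
  rewrite /leaving -size_filter -[size X](size_map (fun x => ((2, x), (3, x)))).
  apply: uniq_leq_size; first exact: filter_uniq.
  move=> a; rewrite mem_filter => /andP[/andP[r1 r2] /s1]; rewrite mem_harcs => /or4P[] /mapP[x xin ea];
    move: r1 r2; rewrite {}ea /R /=.
  - by move=> _; rewrite (sA _ xin).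
  - by move=> zb; have := sB _ xin; rewrite zb.
  - rewrite !orbF => /orP[zx|xX _]; first by rewrite zx.
    by apply: map_f.
  - by move=> z1; rewrite !orbF (sE _ xin z1).
have := c1 R; rewrite Rs Rt; lia.
Qed.

(** * Words *)

Lemma words_rcons pad S F x : words pad S (rcons F x) =
  trunc pad (flatten [seq [seq b :: w | b <- S & b \notin w] | w <- words pad S F]).
Proof. by rewrite /words foldl_rcons. Qed.

Lemma mem_word_step S (W : seq (seq nat)) (w : seq nat) :
  w \in flatten [seq [seq b :: w | b <- S & b \notin w] | w <- W] <->
  exists b w', [/\ w = b :: w', w' \in W, b \in S & b \notin w'].
Proof.
split.
  move=> /flatten_mapP[w' w'W /mapP[b]]; rewrite mem_filter => /andP[h1 h2] ->.
  by exists b, w'.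
move=> [b [w' [-> h1 h2 h3]]]; apply/flatten_mapP; exists w' => //.
by apply: map_f; rewrite mem_filter h3.
Qed.

Lemma words_sound pad S F w : w \in words pad S F ->
  [/\ uniq w, {subset w <= S} & size w = size F].
Proof.
elim/last_ind: F w => [|F x IH] w; first by rewrite inE => /eqP->.
rewrite words_rcons /trunc; case: ifP => // _ /mem_word_step [b [w' [-> /IH[u s e] bS bw]]].
split; [by rewrite /= bw u | | by rewrite size_rcons /= e].
by move=> c; rewrite inE => /orP[/eqP-> //|/s].
Qed.

Lemma esize_seq_le (A : encType) (s : seq A) e : (forall b, b \in s -> esize b <= e) ->
  esize s <= size s * e.+1 + 1.
Proof.
move=> h; rewrite esize_seq addn1 ltnS; apply: leq_sum_const => a as_.
by rewrite ltnS h.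
Qed.

Lemma words_size_le S (W : seq (seq nat)) :
  size (flatten [seq [seq b :: w | b <- S & b \notin w] | w <- W]) <= size W * size S.
Proof.
elim: W => //= w W IH; rewrite size_cat mulSn size_map; apply: leq_add IH.
by rewrite size_filter count_size.
Qed.

(** Each intermediate list has to survive its cut. The base [(size S).+1] is positive, so the bound
    for the full length covers all shorter ones. *)
Lemma words_complete pad S F e : (forall b, b \in S -> esize b <= e) ->
  (size S).+1 ^ size F * (size F * e.+1 + 2) + 1 <= size pad ->
  size (words pad S F) <= (size S).+1 ^ size F /\
  forall w, uniq w -> {subset w <= S} -> size w = size F -> w \in words pad S F.
Proof.
move=> he; elim/last_ind: F => [|F x IH] hp.
  by split=> // -[|b w] // _ _ _; rewrite inE.
rewrite size_rcons in hp *.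
have [|hs hc] := IH.
  apply: leq_trans hp; rewrite leq_add2r; apply: leq_mul; first by rewrite leq_pexp2l.
  by rewrite leq_add2r leq_mul2r leqnSn orbT.
have sz : size (flatten [seq [seq b :: w | b <- S & b \notin w] | w <- words pad S F])
    <= (size S).+1 ^ (size F).+1.
  apply: leq_trans (words_size_le _ _) _; rewrite expnSr; apply: leq_mul => //.
rewrite words_rcons size_le_trunc; last first.
  apply: leq_trans hp; apply: (@leq_trans _ _ _ (esize_seq_le (e := (size F).+1 * e.+1 + 1) _)).
    move=> w /mem_word_step [b [w' [-> /words_sound[_ sw ew] bS _]]].
    have -> : (size F).+1 = size (b :: w') by rewrite /= ew.
    apply: esize_seq_le => c; rewrite inE => /orP[/eqP->|/sw]; exact: he.
  by rewrite leq_add2r; apply: leq_mul => //; lia.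
split=> // -[|b w] //= /andP[bw uw] sw [ew]; apply/mem_word_step; exists b, w; split=> //.
  by apply: hc => // c cw; apply: sw; rewrite inE cw orbT.
by apply: sw; rewrite mem_head.
Qed.

(** * Correctness of the elimination order *)

Section Order.
Variables (V : seq nat) (Ed : seq (nat * nat)).
Hypothesis uV : uniq V.
Hypothesis EV : forall a, a \in Ed -> (a.1 \in V) && (a.2 \in V).
Hypothesis Esym : forall u v, (u, v) \in Ed -> (v, u) \in Ed.
Implicit Types (o D : seq nat) (u v x y : nat).

Lemma mem_component o u x : (x \in component Ed o u) =
  reached u (bfs [seq a <- Ed | (a.1 \notin o) && (a.2 \notin o)] u) x.
Proof. by rewrite /component inE. Qed.

Lemma component_self o u : u \in component Ed o u.
Proof. by rewrite inE eqxx. Qed.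

Lemma component_min o u (p : pred nat) : p u ->
  (forall x y, (x, y) \in Ed -> x \notin o -> y \notin o -> p x -> p y) ->
  forall x, x \in component Ed o u -> p x.
Proof.
move=> pu ps x; rewrite mem_component; apply: (tree_min (bfs_tree _ _)) => // -[y z].
by rewrite mem_filter => /andP[/andP[h1 h2] h3]; apply: ps.
Qed.

Lemma component_notin o u x : u \notin o -> x \in component Ed o u -> x \notin o.
Proof. by move=> uo; apply: (@component_min o u (fun x => x \notin o)). Qed.

Lemma component_inV o u : u \in V -> {subset component Ed o u <= V}.
Proof. by move=> uV' x; apply: (@component_min o u (mem V)) => // y z /EV /andP[]. Qed.

Lemma component_closed o u x y : u \notin o -> x \in component Ed o u -> (x, y) \in Ed ->
  y \notin o -> y \in component Ed o u.
Proof.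
move=> uo xD xy yo; have xo := component_notin uo xD; move: xD; rewrite !mem_component.
by apply: (@bfs_closed _ u _ (x, y)); rewrite mem_filter xo yo.
Qed.

Lemma component_sub o o' u : {subset o <= o'} -> u \notin o' ->
  {subset component Ed o' u <= component Ed o u}.
Proof.
move=> so uo; apply: (@component_min _ _ (mem (component Ed o u))); first exact: component_self.
have uo1 : u \notin o by apply: contra uo => /so.
move=> x y xy _ yo xD; apply: component_closed xy _ => //.
by apply: contra yo => /so.
Qed.

Lemma component_ind o u (p : pred nat) : u \notin o -> p u ->
  (forall x y, (x, y) \in Ed -> x \in component Ed o u -> y \in component Ed o u -> p x -> p y) ->
  forall x, x \in component Ed o u -> p x.
Proof.
move=> uo pu ps x xD; suff /andP[] : (x \in component Ed o u) && p x by [].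
move: x xD; apply: (@component_min _ _ (fun x => (x \in component Ed o u) && p x)).
  by rewrite component_self pu.
move=> x y xy xo yo /andP[xD px]; have yD := component_closed uo xD xy yo.
by rewrite yD (ps x y).
Qed.

Lemma component_join o u v : u \notin o -> v \in component Ed o u ->
  {subset component Ed o v <= component Ed o u}.
Proof.
move=> uo vD; apply: (@component_min _ _ (mem (component Ed o u))) => // x y xy _ yo xD.
exact: component_closed xy yo.
Qed.

Lemma mem_boundary o D y : y \in boundary Ed o D <->
  y \in o /\ exists2 d, d \in D & (y, d) \in Ed.
Proof.
rewrite mem_filter; split.
  by move=> /andP[/hasP[[a b] abE /andP[/= /eqP<- bD]] yo]; split=> //; exists b.
move=> [yo [d dD yd]]; rewrite yo andbT; apply/hasP; exists (y, d) => //.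
by rewrite /= eqxx dD.
Qed.

Variables (pad xs F : seq unit) (s0 : nat).
Hypothesis sF : size F = ((size xs).*2).+1.

Definition bounded_boundary o := [/\ uniq o, {subset o <= V} &
  forall u, u \in V -> u \notin o -> size (boundary Ed o (component Ed o u)) <= s0].
(** Once [o] lists all vertices, the vertices of [o2] that can be reached from [v] through
    eliminated ones are the neighbours of [v] in the fill graph when its turn comes; this is the
    width of an elimination order. *)
Definition width_le_order w o := forall o1 v o2, o = o1 ++ v :: o2 ->
  size (boundary Ed o2 (component Ed o2 v)) <= w.

Lemma separators_sound S X : {subset S <= V} -> X \in separators pad V Ed xs F S ->
  exists A B Z, [/\ size X <= size xs, [/\ uniq A, {subset A <= S} & size A = size F],
   [/\ uniq B, {subset B <= S} & size B = size F] & separates Ed A B X Z].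
Proof.
move=> SV /flatten_mapP[A /words_sound[uA sA eA]] /flatten_mapP[B /words_sound[uB sB eB]] hX.
have [||h1 [Z hZ]] := separator_sound uV _ _ EV hX; first by move=> a /sA /SV.
  by move=> a /sB /SV.
by exists A, B, Z.
Qed.

(** Where [size A = 2x + 1] is used: a boundary avoiding [A] outside [X] loses at least x + 1
    vertices of [S], as many as [new] can contribute. *)
Lemma size_less_words (S A X N new : seq nat) :
  uniq A -> {subset A <= S} -> size A = size F -> size X <= size xs ->
  uniq N -> {subset N <= S ++ new} -> (forall a, a \in A -> a \notin X -> a \notin N) ->
  size new <= (size xs).+1 -> size N <= size S.
Proof.
move=> uA sA eA sX uN sN dN snew.
pose A' := [seq a <- A | a \notin X].
have h1 : size N + size A' <= size S + size new.
  rewrite -!size_cat; apply: uniq_leq_size.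
    rewrite cat_uniq uN filter_uniq // andbT; apply/hasPn => a; rewrite mem_filter => /andP[aX aA].
    exact: dN.
  move=> a; rewrite mem_cat => /orP[/sN //|]; rewrite mem_filter => /andP[_ /sA aS].
  by rewrite mem_cat aS.
have h2 : size A <= size A' + size X.
  have := count_predC (mem X) A; rewrite -!size_filter => <-.
  rewrite addnC leq_add2l; apply: uniq_leq_size; first exact: filter_uniq.
  by move=> a; rewrite mem_filter => /andP[].
by move: sF; lia.
Qed.

(** Components other than that of [u] stay disjoint from it and are not adjacent to it, so their
    boundaries gain nothing; only the components inside it need the hypothesis. *)
Lemma extend_bounded o u (new X : seq nat) : bounded_boundary o -> u \in V -> u \notin o ->
  new = [seq y <- V | (y \in component Ed o u) && ((y == u) || (y \in X))] ->
  (size new <= (size xs).+1) ->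
  (forall u', u' \in V -> u' \notin new ++ o -> u' \in component Ed o u ->
     size (boundary Ed (new ++ o) (component Ed (new ++ o) u')) <= s0) ->
  bounded_boundary (new ++ o).
Proof.
move=> [uo oV ob] uV' uno enew snew hD.
have newD y : y \in new -> y \in component Ed o u by rewrite enew mem_filter => /andP[/andP[]].
have newV y : y \in new -> y \in V by rewrite enew mem_filter => /andP[].
split.
- rewrite cat_uniq uo andbT enew filter_uniq //= -enew; apply/hasPn => y yo /=.
  by apply: contraL yo => /newD; apply: component_notin.
- by move=> y; rewrite mem_cat => /orP[/newV|/oV].
move=> u' u'V u'n; case: (boolP (u' \in component Ed o u)) => u'D; first exact: hD.
have u'o : u' \notin o by move: u'n; rewrite mem_cat negb_or => /andP[].
apply: leq_trans (ob u' u'V u'o); apply: uniq_leq_size.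
  rewrite filter_uniq // cat_uniq uo andbT enew filter_uniq //= -enew; apply/hasPn => y yo /=.
  by apply: contraL yo => /newD; apply: component_notin.
have dis x : x \in component Ed (new ++ o) u' -> x \notin component Ed o u.
  move: x; apply: (@component_min _ _ (fun x => x \notin component Ed o u)) => // x y xy xo _ xD; apply: contra xD => yD.
  apply: component_closed yD _ _ => //; first exact: Esym.
  by move: xo; rewrite mem_cat negb_or => /andP[].
have subo : {subset o <= new ++ o} by move=> y yo; rewrite mem_cat yo orbT.
move=> y /mem_boundary[yno [d dD yd]]; apply/mem_boundary.
have do_ : d \notin o.
  by have := component_notin u'n dD; rewrite mem_cat negb_or => /andP[].
move: yno; rewrite mem_cat => /orP[/newD yD|yo].
  by have := dis d dD; rewrite (component_closed uno yD yd).
by split=> //; exists d => //; apply: component_sub dD.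
Qed.

(** For a vertex of the new block, the boundary consists of old boundary vertices, at most s0, and
    of other vertices of the block. *)
Lemma extend_width o u (new : seq nat) : width_le_order (s0 + (size xs).+1) o -> uniq o ->
  u \in V -> u \notin o -> bounded_boundary o ->
  {subset new <= component Ed o u} -> uniq (new ++ o) -> size new <= (size xs).+1 ->
  width_le_order (s0 + (size xs).+1) (new ++ o).
Proof.
move=> hw uo uV' uno [_ _ ob] newD un snew o1 v o2 e.
case: (leqP (size new) (size o1)) => h.
  apply: (hw (drop (size new) o1) v).
  have := congr1 (drop (size new)) e; rewrite drop_size_cat // => ->.
  by rewrite drop_cat; case: ltngtP h => // -> _; rewrite subnn drop0 drop_size.
have eo : o2 = drop (size o1).+1 new ++ o.
  have := congr1 (drop (size o1).+1) e; rewrite drop_cat.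
  have -> : drop (size o1).+1 (o1 ++ v :: o2) = o2.
    by rewrite drop_cat ltnNge leqnSn /= subSnn /= drop0.
  case: ltnP => [_ <- //|h2 <-].
  have h3 : (size o1).+1 = size new by apply/eqP; rewrite eqn_leq h h2.
  by rewrite h3 subnn drop0 drop_size.
have vnew : v \in new.
  by have := congr1 (fun s => nth 0 s (size o1)) e; rewrite nth_cat h nth_cat ltnn subnn /= => <-; exact: mem_nth.
have vD := newD _ vnew.
have vno2 : v \notin o2.
  by move: un; rewrite e cat_uniq => /and3P[_ _] /= /andP[].
apply: leq_trans (_ : size (boundary Ed o (component Ed o u)) + size new <= _); last first.
  by apply: leq_add => //; exact: ob.
rewrite -size_cat; apply: uniq_leq_size.
  apply: filter_uniq; move: un; rewrite e cat_uniq => /and3P[_ _] /= /andP[] //.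
have so : {subset o <= o2} by move=> y yo; rewrite eo mem_cat yo orbT.
have vD2 : {subset component Ed o2 v <= component Ed o u}.
  apply: (@component_min _ _ (mem (component Ed o u))) => // x y xy _ yo xD; apply: component_closed xy _ => //.
  by apply: contra yo => /so.
move=> y /mem_boundary[yo2 [d dD yd]]; rewrite mem_cat.
move: yo2; rewrite eo mem_cat => /orP[/mem_drop->|yo]; first by rewrite orbT.
apply/orP; left; apply/mem_boundary; split=> //; exists d => //; exact: vD2.
Qed.

Definition good_order o := bounded_boundary o /\ width_le_order (s0 + (size xs).+1) o.

Lemma order_step_good ok o u z : u \in V -> good_order o -> 
  order_step pad V Ed xs F s0 (ok, o) u = z -> z.1 ->
  [/\ ok, good_order z.2, u \in z.2 & {subset o <= z.2}].
Proof.
move=> uV' [gb gw]; have [uo oV ob] := gb; rewrite /order_step /=.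
case: ifP => [uo' <- okT|/negbT uno]; first by split.
set D := component Ed o u; set S := boundary Ed o D.
have SV : {subset S <= V} by move=> y /mem_boundary[/oV].
have V1 : [seq y <- V | (y \in component Ed o u) && ((y == u) || (y \in [::]))] = [:: u].
  rewrite -[RHS](filter_pred1_uniq uV uV'); apply: eq_in_filter => y yV /=.
  by rewrite in_nil orbF; case: eqP => [->|]; rewrite ?component_self // andbF.
(* Below the threshold there is room for one more boundary vertex, namely [u]. *)
case: ifP => [Ss|_].
  move=> <- /= okT; split=> //; [ | by rewrite mem_head | by move=> y yo; rewrite inE yo orbT].
  have gbu : bounded_boundary ([:: u] ++ o).
    apply: (@extend_bounded o u [:: u] [::]) => // u' u'V u'n u'D.
    apply: leq_trans Ss; rewrite -[(size S).+1]/(size (u :: S)); apply: uniq_leq_size.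
      by apply: filter_uniq; rewrite /= uno.
    move=> y /mem_boundary[yno [d dD yd]]; rewrite inE; move: yno; rewrite inE => /orP[->//|yo].
    apply/orP; right; apply/mem_boundary; split=> //; exists d => //.
    have subo : {subset o <= [:: u] ++ o} by move=> t to; rewrite mem_cat to orbT.
    exact: component_join (component_sub subo u'n dD).
  split=> //; apply: (@extend_width o u [:: u]) => //; last by case: gbu.
  by move=> y; rewrite inE => /eqP->; exact: component_self.
rewrite /extend; case es: (separators pad V Ed xs F S) => [|X cs] /=; first by move=> <-.
move=> <- /= okT.
have [A [B [Z [sX [uA sA eA] [uB sB eB] [ZA ZB ZE]]]]] : exists A B Z, [/\ size X <= size xs, [/\ uniq A, {subset A <= S} & size A = size F],
   [/\ uniq B, {subset B <= S} & size B = size F] & separates Ed A B X Z].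
  by apply: separators_sound => //; rewrite es mem_head.
set new := filter _ V.
have snew : size new <= (size xs).+1.
  apply: leq_trans (_ : size (u :: X) <= _); last by rewrite /= ltnS.
  apply: uniq_leq_size; first exact: filter_uniq.
  by move=> y; rewrite mem_filter => /andP[/andP[_ h] _]; rewrite inE.
have subo : {subset o <= new ++ o} by move=> t to; rewrite mem_cat to orbT.
have newD : {subset new <= component Ed o u} by move=> y; rewrite mem_filter => /andP[/andP[]].
have gbu : bounded_boundary (new ++ o).
  apply: (@extend_bounded o u new X) => // u' u'V u'n u'D.
  set D' := component Ed (new ++ o) u'.
  have uno' : uniq (new ++ o).
    rewrite cat_uniq uo andbT filter_uniq //=; apply/hasPn => y yo /=.
    by apply: contraL yo => /newD; apply: component_notin.
  have D'D : {subset D' <= D}.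
    move=> d dD'; exact: component_join (component_sub subo u'n dD').
  have D'X d : d \in D' -> d \notin X.
    move=> dD'; have dD := D'D _ dD'; apply: contra (component_notin u'n dD') => dX.
    by rewrite mem_cat mem_filter -/D dD dX orbT /= (component_inV (o := o) uV' dD).
  have NS : {subset boundary Ed (new ++ o) D' <= S ++ new}.
    move=> y /mem_boundary[yno [d dD yd]]; rewrite mem_cat.
    move: yno; rewrite mem_cat => /orP[->|yo]; rewrite ?orbT //.
    by apply/orP; left; apply/mem_boundary; split=> //; exists d => //; apply: D'D.
  apply: leq_trans (ob u uV' uno).
  (* [D'] is connected and avoids [X], so it lies on one side of the separation: inside [Z] it
     touches no vertex of [B] outside [X], and outside [Z] no vertex of [A] outside [X]. *)
  case: (boolP (Z u')) => Zu'.
    apply: (@size_less_words S B X _ new) => //; first exact: filter_uniq.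
    move=> b bB bX; apply/negP => /mem_boundary[_ [d dD' bd]].
    have Zd : Z d.
      move: d dD' {bd}; apply: component_ind => // x y xy xD yD Zx.
      by have := ZE _ xy Zx; rewrite /= (negbTE (D'X _ yD)) orbF.
    by have := ZE _ (Esym bd) Zd; rewrite /= (negbTE bX) orbF (negbTE (ZB _ bB)).
  apply: (@size_less_words S A X _ new) => //; first exact: filter_uniq.
  move=> b bA bX; apply/negP => /mem_boundary[_ [d dD' bd]].
  have Zd : ~~ Z d.
    move: d dD' {bd}; apply: (@component_ind _ _ (fun d => ~~ Z d)) => // x y xy xD yD.
    by apply: contra => Zy; have := ZE _ (Esym xy) Zy; rewrite /= (negbTE (D'X _ xD)) orbF.
  have Zb : Z b by have := ZA _ bA; rewrite (negbTE bX) orbF.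
  by have := ZE _ bd Zb; rewrite /= (negbTE Zd) (negbTE (D'X _ dD')).
split=> //.
- split=> //; apply: (@extend_width o u) => //; by case: gbu.
- by rewrite mem_cat mem_filter component_self eqxx uV'.
Qed.

Lemma order_step_ok z u : (order_step pad V Ed xs F s0 z u).1 -> z.1.
Proof.
by rewrite /order_step; case: ifP => // _; case: ifP => // _; rewrite /extend; case: ifP.
Qed.

Lemma elim_order_good : (elim_order pad V Ed xs F s0).1 ->
  good_order (elim_order pad V Ed xs F s0).2 /\ {subset V <= (elim_order pad V Ed xs F s0).2}.
Proof.
have key (L : seq nat) (z : bool * seq nat) : {subset L <= V} -> (z.1 -> good_order z.2) ->
    let r := foldl (order_step pad V Ed xs F s0) z L in
    r.1 -> [/\ z.1, good_order r.2, {subset L <= r.2} & {subset z.2 <= r.2}].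
  elim: L z => [|u L IH] z sL gz /=; first by move=> ok; split=> //; apply: gz.
  have uV' : u \in V by apply: sL; rewrite mem_head.
  set z' := order_step _ _ _ _ _ _ z u => okr.
  have step : z'.1 -> [/\ z.1, good_order z'.2, u \in z'.2 & {subset z.2 <= z'.2}].
    move=> ok'; have ok := order_step_ok ok'.
    by case: z @z' ok gz {okr} ok' => ok o z' /= okT /(_ okT) go ok'; exact: order_step_good uV' go erefl ok'.
  have [||ok' gr sr zr] := IH z' _ _ okr.
  - by move=> y yL; apply: sL; rewrite inE yL orbT.
  - by move=> /step[].
  have [ok _ uz' sz] := step ok'; split=> //; last by move=> y /sz /zr.
  by move=> y; rewrite inE => /orP[/eqP->|/sr //]; apply: zr.
move=> ok; have [||_ g sV _] := key V (true, [::]) _ _ ok => //.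
by move=> _; split; [split | case].
Qed.

(** The invariant keeps the boundaries below or at s0, so the padding suffices to enumerate all
    candidate pairs, and the separation provided by the last hypothesis is met among them. *)
Lemma elim_order_ok e : (forall b, b \in V -> esize b <= e) ->
  s0.+1 ^ size F * (size F * e.+1 + 2) + 1 <= size pad ->
  (forall S : seq nat, uniq S -> {subset S <= V} -> s0 <= size S -> exists (A B X : seq nat) (Z : pred nat),
     [/\ [/\ uniq A, {subset A <= S} & size A = size F],
         [/\ uniq B, {subset B <= S} & size B = size F],
         size X <= size xs & separates Ed A B X Z]) ->
  (elim_order pad V Ed xs F s0).1.
Proof.
move=> he hpad hsep.
have step (ok : bool) o u : u \in V -> ok -> good_order o ->
    (order_step pad V Ed xs F s0 (ok, o) u).1.
  move=> uV' okT [[uo oV ob] _]; rewrite /order_step /=.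
  case: ifP => // /negbT uno; case: ltnP => // hS.
  set S := boundary Ed o _ in hS *.
  have uS : uniq S by exact: filter_uniq.
  have SV : {subset S <= V} by move=> y /mem_boundary[/oV].
  have [A [B [X [Z [[uA sA eA] [uB sB eB] sX sep]]]]] := hsep S uS SV hS.
  have [||_ hw] := @words_complete pad S F e.
  - by move=> b /SV; exact: he.
  - apply: leq_trans hpad; rewrite leq_add2r leq_mul2r; apply/orP; right.
    by apply: leq_exp2r'; rewrite ltnS; exact: ob.
  have := separator_complete V sep sX.
  rewrite /extend; case es: (separators _ _ _ _ _ S) => [|c cs] //=.
  case es1: (separator _ _ _) => [|X' Xs] // _.
  have : X' \in separators pad V Ed xs F S.
    apply/flatten_mapP; exists A; first exact: hw.
    apply/flatten_mapP; exists B; first exact: hw.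
    by rewrite es1 mem_head.
  by rewrite es.
rewrite /elim_order.
have key (L : seq nat) (z : bool * seq nat) : {subset L <= V} -> z.1 -> good_order z.2 ->
    (foldl (order_step pad V Ed xs F s0) z L).1.
  elim: L z => //= u L IH [ok o] sL /= okT go.
  have uV' : u \in V by apply: sL; rewrite mem_head.
  have ok' := step _ _ _ uV' okT go.
  apply: IH => //; first by move=> y yL; apply: sL; rewrite inE yL orbT.
  by have [] := order_step_good uV' go erefl ok'.
by apply: key => //; split; [split | case].
Qed.

End Order.

(** * Separators from tree decompositions *)

Section Trees.
Variables (T : finType) (e : rel T).
Hypothesis tree_e : is_tree e.

Let e_sym : symmetric e. Proof. by case: tree_e. Qed.
Let e_irr : irreflexive e. Proof. by case: tree_e. Qed.

Definition avoiding (p : T) : rel T := [rel x y | [&& e x y, x != p & y != p]].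
Definition branch (t p : T) : {set T} := [set c | connect (avoiding p) t c].

Lemma branch_neq t p c : t != p -> c \in branch t p -> c != p.
Proof.
move=> tp; rewrite inE => /connectP[s]; case/lastP: s => [_ -> //|s x].
by rewrite rcons_path last_rcons => /andP[_ /and3P[_ _ h]] ->.
Qed.

Lemma first_step (r : rel T) t c : subrel r e -> connect r t c -> c != t ->
  exists2 t1, r t t1 & c \in branch t1 t.
Proof.
move=> sr /connectP[s ps ->]; case: (shortenP ps) => -[|t1 s'] /=; first by rewrite eqxx.
move=> /andP[r1 ps'] /andP[nt us'] _ _; exists t1 => //.
rewrite inE; apply/connectP; exists s' => //.
elim: s' t1 nt {us' r1} ps' => //= y s' IH x; rewrite !inE !negb_or => /and3P[h1 h2 h3] /andP[rxy ps'].
rewrite {1}/avoiding /= (sr _ _ rxy) ![_ == t]eq_sym h1 h2 /=; apply: IH => //.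
by rewrite inE negb_or h2.
Qed.

(** A path from [t'] to [p] that avoids [t] would close with [t] to a cycle of length at least 3. *)
Lemma branch_separate t p t' : e t p -> e t t' -> t' != p -> p \notin branch t' t.
Proof.
move=> tp tt' t'p; apply/negP; rewrite inE => /connectP[s ps].
case: (shortenP ps) => s' ps' us' _ ep.
have nt : t \notin t' :: s'.
  rewrite inE negb_or; apply/andP; split.
    by apply: contraTneq tt' => <-; rewrite e_irr.
  elim: s' {us' ep} t' ps' {tt' t'p ps} => //= y s' IH x /andP[/and3P[_ _ h] h2].
  by rewrite inE negb_or eq_sym h; apply: IH h2.
have pe : path e t' s'.
  by apply: sub_path ps' => x y /and3P[].
have [_ _ _ _ cyc] := tree_e.
have /cyc : ucycle e (t :: t' :: s').
  rewrite /ucycle /= tt' rcons_path pe /= -ep e_sym tp /=.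
  by move: nt us'; rewrite /= => -> ->.
case: s' ep {ps' us' nt pe} => //= e1; by rewrite e1 eqxx in t'p.
Qed.

Lemma branch_proper t p t' : e t p -> e t t' -> t' != p -> branch t' t \proper branch t p.
Proof.
move=> tp tt' t'p; have np := branch_separate tp tt' t'p.
have tp' : t != p by apply: contraTneq tp => ->; rewrite e_irr.
have t't : t' != t by apply: contraTneq tt' => ->; rewrite e_irr.
apply/properP; split; last first.
  exists t; first by rewrite inE connect0.
  by apply/negP => /(branch_neq t't); rewrite eqxx.
apply/subsetP => c; rewrite !inE => /connectP[s ps ->].
elim/last_ind: s ps => [_|s y IH] /=.
  by apply: connect1; rewrite /avoiding /= tt' tp' t'p.
rewrite rcons_path last_rcons => /andP[ps /= st].
apply: connect_trans (IH ps) _; apply: connect1; rewrite {1}/avoiding /=.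
have /and3P[-> h1 h2] := st.
have hx : last t' s \in branch t' t by rewrite inE; apply/connectP; exists s.
have hy : y \in branch t' t.
  by move: hx; rewrite !inE => /connect_trans; apply; apply: connect1.
by rewrite /=; apply/andP; split; [move: hx | move: hy] => h; apply: contraNneq np => <-.
Qed.

Variables (V : finType) (G : rel V) (bag : T -> {set V}).
Hypothesis td : tree_decomposition G e bag.

Definition side (t p : T) : {set V} := (\bigcup_(c in branch t p) bag c) :\: bag p.

(** Some bag holds both [u] and [v]. The bags of [u] are connected and miss [p], so that bag belongs
    to the same branch. *)
Lemma side_closed t p u v : t != p -> u \in side t p -> G u v ->
  v \in side t p :|: bag p.
Proof.
have [_ _ edge conn] := td.
move=> tp; rewrite !inE => /andP[up /bigcupP[c cb uc]] /edge[r ur vr].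
case: (boolP (v \in bag p)) => vp; rewrite ?orbT //= orbF.
apply/bigcupP; exists r => //; move: cb; rewrite !inE => /connect_trans; apply.
apply: (connect_sub _ (conn u c r uc ur)) => x y /and3P[exy ux uy]; apply: connect1.
by rewrite /avoiding /= exy /=; apply/andP; split; apply: contraNneq up => <-.
Qed.

Lemma side_cover (r : rel T) t c v : subrel r e -> connect r t c -> v \in bag c -> v \notin bag t ->
  exists2 t1, r t t1 & v \in side t1 t.
Proof.
move=> sr rc vc vt.
have [|t1 h1 h2] := first_step sr rc; first by apply: contraNneq vt => <-.
by exists t1 => //; rewrite inE vt; apply/bigcupP; exists c.
Qed.

Variables (k a : nat) (S : {set V}).
Hypothesis width : forall t, #|bag t| <= k.+1.
Hypothesis large : 3 * a + 2 * k.+1 <= #|S|.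

Definition sides (r : T) (s : seq T) : {set V} := \bigcup_(t <- s) side t r.

(** Sides are collected until they hold [a] vertices of [S]: before the last one there were fewer
    than [a], and the last one adds fewer than [a + k + 1]. *)
Lemma greedy_sides r s : (forall t, t \in s -> #|S :&: side t r| < a + k.+1) ->
  a <= #|S :&: sides r s| ->
  exists2 s', {subset s' <= s} & a <= #|S :&: sides r s'| < a + (a + k.+1).
Proof.
elim: s => [|t s IH] h ha.
  by exists [::] => //; move: ha; rewrite /sides big_nil setI0 cards0; lia.
case: (leqP a #|S :&: sides r s|) => hs.
  have [|s' ss hs'] := IH _ hs; first by move=> t' t's; apply: h; rewrite inE t's orbT.
  by exists s' => // t' /ss h'; rewrite inE h' orbT.
exists (t :: s) => //; rewrite ha /= /sides big_cons setIUr.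
apply: leq_ltn_trans (leq_card_setU _ _) _; rewrite [a + (a + _)]addnC.
apply: leq_ltn_trans (_ : a + k.+1 + #|S :&: sides r s| < _); last by rewrite ltn_add2l.
by rewrite leq_add2r; apply: ltnW; apply: h; rewrite mem_head.
Qed.

(** Among the directed tree edges with a heavy side, take one whose branch is smallest. Seen from
    its first end all further sides are light, and with the bag they cover the heavy side. If no
    side is heavy, any node will do. *)
Lemma balanced_node : exists (r : T) (s : seq T),
  [/\ forall t, t \in s -> e r t, forall t, t \in s -> #|S :&: side t r| < a + k.+1
    & a <= #|S :&: sides r s|].
Proof.
have cover (q : T) (s : seq T) (Y : {set V}) : (forall v, v \in Y -> v \notin bag q -> exists2 t, t \in s & v \in side t q) ->
    #|S :&: Y| <= #|S :&: sides q s| + k.+1.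
  move=> h; apply: leq_trans (_ : #|(S :&: sides q s) :|: bag q| <= _); last first.
    by apply: leq_trans (leq_card_setU _ _) _; rewrite leq_add2l.
  apply: subset_leq_card; apply/subsetP => v; rewrite !inE => /andP[vS vY].
  case: (boolP (v \in bag q)) => vq; rewrite ?orbT // orbF vS /=.
  have [t ts vt] := h v vY vq; rewrite /sides; elim: (s) ts => //= t' s' IH.
  by rewrite inE big_cons inE => /orP[/eqP<-|/IH->]; rewrite ?vt ?orbT.
pose P (z : T * T) := e z.1 z.2 && (a + k.+1 <= #|S :&: side z.1 z.2|).
case: (pickP P) => [z0 Pz0|nP].
  case: (arg_minnP (fun z => #|branch z.1 z.2|) Pz0) => -[t p] /andP[/= etp big] zmin.
  exists t, (enum [set t' | e t t' && (t' != p)]); split.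
  - by move=> t'; rewrite mem_enum inE => /andP[].
  - move=> t'; rewrite mem_enum inE => /andP[ett' t'p]; rewrite ltnNge; apply/negP => h.
    have /zmin /= : P (t', t) by rewrite /P /= e_sym ett' h.
    by rewrite leqNgt (proper_card (branch_proper etp ett' t'p)).
  - rewrite -(leq_add2r k.+1); apply: leq_trans big _; apply: cover => v vW vt.
    move: vW; rewrite inE => /andP[_ /bigcupP[c]]; rewrite inE => cb vc.
    have [|t1 /and3P[h1 h2 h3] h4] := side_cover _ cb vc vt; first by move=> x y /and3P[].
    by exists t1 => //; rewrite mem_enum inE h1 h3.
have [[T0 _ _ conn _] cov _ _] := td.
have [r _] : exists r : T, true by move/card_gt0P: T0 => [r _]; exists r.
exists r, (enum [set t | e r t]); split.
- by move=> t; rewrite mem_enum inE.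
- move=> t; rewrite mem_enum inE => ert; rewrite ltnNge; apply/negP => h.
  by have := nP (t, r); rewrite /P /= e_sym ert h.
have : #|S :&: setT| <= #|S :&: sides r (enum [set t | e r t])| + k.+1.
  apply: cover => v _ vr; have [c vc] := cov v.
  have [t1 h1 h2] := side_cover (fun x y (h : e x y) => h) (conn r c) vc vr.
  by exists t1 => //; rewrite mem_enum inE.
rewrite setIT; lia.
Qed.

(** The chosen sides hold fewer than 2a + k + 1 vertices of [S] and the bag at most k + 1, which
    leaves at least [a] of the 3a + 2(k + 1). *)
Lemma tree_separator : exists Z X : {set V},
  [/\ #|X| <= k.+1, [disjoint Z & X], forall u v, u \in Z -> G u v -> v \in Z :|: X,
      a <= #|S :&: Z| & a <= #|S :\: (Z :|: X)|].
Proof.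
have [r [s [es hs ha]]] := balanced_node.
have [s' ss /andP[h1 h2]] := greedy_sides hs ha.
have mem_sides v : v \in sides r s' -> exists2 t, t \in s' & v \in side t r.
  rewrite /sides; elim: (s') => [|t s1 IH]; first by rewrite big_nil inE.
  rewrite big_cons in_setU => /orP[h|/IH[t' t's h]]; [exists t; rewrite ?mem_head // | exists t' => //].
  by rewrite inE t's orbT.
have sides_mem t v : t \in s' -> v \in side t r -> v \in sides r s'.
  rewrite /sides; elim: (s') => //= t1 s1 IH; rewrite in_cons big_cons in_setU => /orP[/eqP<- ->//|h1' h2'].
  by rewrite IH ?orbT.
exists (sides r s'), (bag r); split=> //.
- rewrite -setI_eq0; apply/eqP/setP => v; rewrite !inE; apply/negP => /andP[/mem_sides[t _]].
  by rewrite inE => /andP[/negP h _] /h.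
- move=> u v /mem_sides[t ts ut] uv.
  have tr : t != r by apply: contraTneq (es _ (ss _ ts)) => ->; rewrite e_irr.
  have := side_closed tr ut uv; rewrite !inE => /orP[h|->]; last by rewrite orbT.
  by rewrite (sides_mem t) // inE.
rewrite -(leq_add2l #|S :&: (sides r s' :|: bag r)|) cardsID setIUr.
have hb : #|S :&: bag r| <= k.+1.
  by apply: leq_trans (width r); apply: subset_leq_card; apply: subsetIr.
apply: leq_trans (leq_add (leq_card_setU _ _) (leqnn a)) _.
apply: leq_trans (leq_add (leq_add (ltnW h2) hb) (leqnn a)) _.
by apply: leq_trans large; lia.
Qed.
End Trees.

(** * Correctness of bucket elimination *)

(* [conf pi Phi c s]: one entry can be chosen from every factor of [Phi], in
   agreement with the order [pi], with parent counts [c] and total value [s]. *)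
Fixpoint conf (pi : seq nat) (Phi : seq factor) (c : nat -> nat) (s : nat) : Prop :=
  if Phi is phi :: Phi' then
    exists m c' s', [/\ m \in phi.2, unzip1 m.1 = [seq u <- pi | u \in phi.1],
      conf pi Phi' c' s', forall u, c u = parent_count m.1 u + c' u & s = m.2 + s']
  else (forall u, c u = 0) /\ s = 0.

Lemma parent_count_notin M u : u \notin unzip1 M -> parent_count M u = 0.
Proof.
elim: M => //= p M IH; rewrite inE negb_or eq_sym => /andP[/negbTE-> /IH]; exact.
Qed.

Lemma parent_count_graph (w : seq nat) (c : nat -> nat) u : uniq w ->
  parent_count [seq (x, c x) | x <- w] u = if u \in w then c u else 0.
Proof.
elim: w => //= x w IH /andP[xw uw]; rewrite inE [u == x]eq_sym; case: eqP xw => [-> xw|_ _] /=.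
  by rewrite IH // (negbTE xw) addn0.
exact: IH.
Qed.

Lemma conf_split (p : pred factor) pi Phi c s :
  conf pi Phi c s <-> exists c1 s1 c2 s2,
   [/\ conf pi [seq phi <- Phi | p phi] c1 s1, conf pi [seq phi <- Phi | ~~ p phi] c2 s2,
       forall u, c u = c1 u + c2 u & s = s1 + s2].
Proof.
elim: Phi c s => [|phi Phi IH] c s /=.
  split=> [[h ->]|[c1 [s1 [c2 [s2 [[h1 ->] [h2 ->] h ->]]]]]].
    by exists (fun=> 0), 0, (fun=> 0), 0; split.
  by split=> // u; rewrite h h1 h2.
split.
  move=> [m [c' [s' [h1 h2 /IH[c1 [s1 [c2 [s2 [k1 k2 k3 ->]]]]] h3 ->]]]].
  case: (p phi) => /=.
    exists (fun u => parent_count m.1 u + c1 u), (m.2 + s1), c2, s2; split=> //.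
    - by exists m, c1, s1.
    - by move=> u; rewrite h3 k3 addnA.
    - by rewrite addnA.
  exists c1, s1, (fun u => parent_count m.1 u + c2 u), (m.2 + s2); split=> //.
  - by exists m, c2, s2.
  - by move=> u; rewrite h3 k3 addnCA.
  - by rewrite addnCA.
move=> [c1 [s1 [c2 [s2 []]]]]; case: (p phi) => /=.
  move=> [m [c' [s' [h1 h2 h3 h4 ->]]]] h5 h6 ->.
  exists m, (fun u => c' u + c2 u), (s' + s2); split=> //.
  - by apply/IH; exists c', s', c2, s2.
  - by move=> u; rewrite h6 h4 addnA.
  - by rewrite addnA.
move=> h5 [m [c' [s' [h1 h2 h3 h4 ->]]]] h6 ->.
exists m, (fun u => c1 u + c' u), (s1 + s'); split=> //.
- by apply/IH; exists c1, s1, c', s'.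
- by move=> u; rewrite h6 h4 addnCA.
- by rewrite addnCA.
Qed.

(** An order matters only through its traces on the scopes; this allows passing between an order of
    all vertices and an order of a bag. *)
Lemma conf_restrict pi pi' Phi c s :
  (forall phi : factor, phi \in Phi -> [seq u <- pi | u \in phi.1] = [seq u <- pi' | u \in phi.1]) ->
  conf pi Phi c s -> conf pi' Phi c s.
Proof.
elim: Phi c s => //= phi Phi IH c s h [m [c' [s' [h1 h2 h3 h4 h5]]]].
exists m, c', s'; split=> //; first by rewrite h2 h // mem_head.
by apply: IH h3 => psi hp; apply: h; rewrite inE hp orbT.
Qed.

Lemma conf_outside pi Phi c s u : conf pi Phi c s ->
  (forall phi : factor, phi \in Phi -> u \notin phi.1) -> c u = 0.
Proof.
elim: Phi c s => [|phi Phi IH] c s /=; first by move=> [h _].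
move=> [m [c' [s' [h1 h2 h3 h4 h5]]]] h; rewrite h4 (IH _ _ h3); last first.
  by move=> psi hp; apply: h; rewrite inE hp orbT.
rewrite parent_count_notin // h2 mem_filter negb_and h ?mem_head //.
Qed.

Lemma mem_join q acc phi x : x \in join q acc phi <-> exists e m,
  [/\ e \in acc, m \in phi.2, compatible phi.1 e.1 m.1, fits q (add_counts e.1 m.1) &
      x = (add_counts e.1 m.1, e.2 + m.2)].
Proof.
split.
  move=> /flatten_mapP[e ea /flatten_mapP[m mp]]; rewrite /join_entry.
  by case: ifP => // /andP[h1 h2]; rewrite inE => /eqP->; exists e, m.
move=> [e [m [h1 h2 h3 h4 ->]]]; apply/flatten_mapP; exists e => //.
by apply/flatten_mapP; exists m => //; rewrite /join_entry h3 h4 inE.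
Qed.

Lemma prune_sub s e : e \in prune s -> e \in s.
Proof.
rewrite /prune; elim/last_ind: s => // s x IH; rewrite foldl_rcons mem_rcons inE {1}/put.
case: ifP => _; first by move=> /IH->; rewrite orbT.
rewrite inE => /orP[->//|]; rewrite mem_filter => /andP[_ /IH->]; by rewrite orbT.
Qed.

Lemma prune_keys s : uniq (unzip1 (prune s)).
Proof.
rewrite /prune; elim/last_ind: s => // s x IH; rewrite foldl_rcons {1}/put.
case: ifP => // _ /=; apply/andP; split.
  by apply/mapP => -[y]; rewrite mem_filter => /andP[h _] e; rewrite e eqxx in h.
by apply: subseq_uniq IH; apply: map_subseq; apply: filter_subseq.
Qed.

Lemma prune_dom s e : e \in s -> exists2 e', e' \in prune s & e'.1 = e.1 /\ e.2 <= e'.2.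
Proof.
rewrite /prune; elim/last_ind: s => // s x IH; rewrite foldl_rcons mem_rcons inE.
set t := foldl _ _ _ in IH *; rewrite /put; case: ifP => [/hasP[y yt /andP[/eqP h1 h2]]|hn].
  by move=> /orP[/eqP->|/IH//]; exists y.
move=> /orP[/eqP->|/IH[e' e't [h1 h2]]]; first by exists x; rewrite ?mem_head.
case: (eqVneq e'.1 x.1) => hx; last by exists e' => //; rewrite inE mem_filter hx e't orbT.
exists x; first by rewrite mem_head.
split; first by rewrite -hx.
apply: leq_trans h2 _; rewrite leqNgt; apply/negP => h; move/negP: hn; apply.
by apply/hasP; exists e' => //; rewrite hx eqxx ltnW.
Qed.

Definition joins q (acc : seq entry) (Phi : seq factor) :=
  foldl (fun acc phi => prune (join q acc phi)) acc Phi.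

Lemma unzip1_add_counts L M : unzip1 (add_counts L M) = unzip1 L.
Proof. by rewrite /unzip1 -map_comp. Qed.

Lemma joins_sound q acc Phi L v : (L, v) \in joins q acc Phi ->
  exists e c s, [/\ e \in acc, conf (unzip1 e.1) Phi c s,
    L = [seq (p.1, p.2 + c p.1) | p <- e.1], v = e.2 + s & fits q e.1 -> fits q L].
Proof.
elim: Phi acc => [|phi Phi IH] acc /=.
  move=> h; exists (L, v), (fun=> 0), 0; split=> //; last by rewrite addn0.
  by rewrite -{1}[L]map_id; apply: eq_map => -[p1 p2] /=; rewrite addn0.
move=> /IH[e1 [c' [s' [/prune_sub/mem_join[e [m [h1 h2 /eqP h3 h4 ->]]] hc -> -> hf]]]].
rewrite /= unzip1_add_counts in hc hf *.
exists e, (fun u => parent_count m.1 u + c' u), (m.2 + s'); split=> //.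
- by exists m, c', s'.
- by rewrite /add_counts -map_comp; apply: eq_map => -[p1 p2] /=; rewrite addnA.
- by rewrite addnA.
- by move=> _; apply: hf.
Qed.

(** Counts only grow along the fold, so a bound on the final counts makes every earlier [fits] test
    succeed. Pruning may replace an entry by a better one with the same state, hence the
    inequality. *)
Lemma joins_complete q acc Phi e c s : e \in acc -> conf (unzip1 e.1) Phi c s ->
  (forall p, p \in e.1 -> p.2 + c p.1 <= q) ->
  exists2 v, e.2 + s <= v & ([seq (p.1, p.2 + c p.1) | p <- e.1], v) \in joins q acc Phi.
Proof.
elim: Phi acc e c s => [|phi Phi IH] acc e c s ea /=.
  move=> [c0 ->] _; exists e.2; first by rewrite addn0.
  suff -> : [seq (p.1, p.2 + c p.1) | p <- e.1] = e.1 by case: e ea.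
  by rewrite -[RHS]map_id; apply: eq_map => -[p1 p2] /=; rewrite c0 addn0.
move=> [m [c' [s' [h1 h2 h3 h4 ->]]]] hq.
have jm : (add_counts e.1 m.1, e.2 + m.2) \in join q acc phi.
  apply/mem_join; exists e, m; split=> //; first by apply/eqP.
  apply/allP => x /mapP[p pe ->] /=; have := hq p pe; rewrite h4; lia.
have [[L' v'] /= hin [eL hv]] := prune_dom jm; rewrite /= in eL hv; subst L'.
have [|||w hw hm] := IH (prune (join q acc phi)) (add_counts e.1 m.1, v') c' s' => //=.
- by rewrite unzip1_add_counts.
- by move=> p /mapP[x xe ->] /=; have := hq x xe; rewrite h4; lia.
exists w; first by move: hw => /=; lia.
suff -> : [seq (p.1, p.2 + c p.1) | p <- e.1] =
    [seq (p.1, p.2 + c' p.1) | p <- add_counts e.1 m.1] by [].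
by rewrite /add_counts -map_comp; apply: eq_map => -[p1 p2] /=; rewrite h4 addnA.
Qed.

Lemma split_filter (p : pred nat) s w1 w2 : filter p s = w1 ++ w2 ->
  exists s1 s2, [/\ s = s1 ++ s2, filter p s1 = w1 & filter p s2 = w2].
Proof.
elim: s w1 => [|x s IH] w1 /=; first by case: w1 => //= <-; exists [::], [::].
case: ifP => px; last first.
  by move=> /IH[s1 [s2 [-> <- <-]]]; exists (x :: s1), s2; rewrite /= px.
case: w1 => [|y w1] /=.
  by move=> <-; exists [::], (x :: s); rewrite /= px.
by move=> [<- /IH[s1 [s2 [-> <- <-]]]]; exists (x :: s1), s2; rewrite /= px.
Qed.

Definition bag_of V (Phi : seq factor) v := v :: scope_of V Phi v.
Definition at_v (Phi : seq factor) v := [seq phi : factor <- Phi | v \in phi.1].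

Section Eliminate.
Variables (q : nat) (pad : seq unit) (V : seq nat).
Hypothesis uV : uniq V.

(* No padding bound is hit when [v] is eliminated. *)
Definition exact_step (Phi : seq factor) (v : nat) :=
  let B := bag_of V Phi v in
  let acc := bag_start pad B in
  [/\ forall w, uniq w -> {subset w <= B} -> size w = size B -> w \in words pad B [seq tt | _ <- B],
      join_all q pad acc (at_v Phi v) = joins q acc (at_v Phi v) &
      trunc pad (prune (forget v (joins q acc (at_v Phi v)))) =
      prune (forget v (joins q acc (at_v Phi v)))].

Definition scopes_in (Phi : seq factor) (r : seq nat) :=
  forall phi : factor, phi \in Phi -> {subset phi.1 <= r}.

Lemma eliminateE Phi v : exact_step Phi v -> eliminate q pad V Phi v =
  (scope_of V Phi v, prune (forget v (joins q (bag_start pad (bag_of V Phi v)) (at_v Phi v))))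
   :: [seq phi : factor <- Phi | v \notin phi.1].
Proof. by move=> [_ h1 h2]; rewrite /eliminate -/(at_v Phi v) -/(bag_of V Phi v) h1 h2. Qed.

Lemma mem_scope Phi v u : u \in scope_of V Phi v <->
  [/\ u \in V, u != v & exists2 phi : factor, phi \in at_v Phi v & u \in phi.1].
Proof.
rewrite mem_filter; split.
  move=> /andP[/andP[h1 /hasP[phi hp /andP[h2 h3]]] h4]; split=> //; exists phi => //.
  by rewrite mem_filter h2.
move=> [h1 h2 [phi]]; rewrite mem_filter => /andP[h3 h4] h5; rewrite h1 h2 /= andbT.
by apply/hasP; exists phi => //; rewrite h3 h5.
Qed.

Lemma bag_uniq Phi v : uniq (bag_of V Phi v).
Proof.
rewrite /bag_of /= filter_uniq // andbT; apply/negP => /mem_scope[_]; by rewrite eqxx.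
Qed.

Lemma eliminate_scopes Phi v r : scopes_in Phi (v :: r) ->
  scopes_in (eliminate q pad V Phi v) r.
Proof.
move=> h phi; rewrite inE => /orP[/eqP->|] u /=.
  move=> /mem_scope[_ uv [psi]]; rewrite mem_filter => /andP[_ /h hp] /hp.
  by rewrite inE (negbTE uv).
move: u; rewrite mem_filter => /andP[vp /h hp] u up; have := hp u up.
by rewrite inE => /orP[/eqP e|//]; rewrite -e up in vp.
Qed.

Lemma scope_in_bag Phi v (phi : factor) u : phi \in at_v Phi v -> u \in phi.1 -> u \in V ->
  u \in bag_of V Phi v.
Proof.
move=> hp up uV'; rewrite inE; case: eqP => //= /eqP uv; apply/mem_scope; split=> //.
by exists phi.
Qed.

(** The trace of [pi] on the bag is among the starting words; the factors containing [v] are joined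
    along it, and the others do not notice the removal of [v]. *)
Lemma eliminate_complete Phi v pi c s : exact_step Phi v -> uniq pi -> {subset pi <= V} ->
  v \in pi -> scopes_in Phi pi -> conf pi Phi c s -> (forall u, u \in pi -> c u <= q) ->
  exists c' s', [/\ conf [seq u <- pi | u != v] (eliminate q pad V Phi v) c' s', s <= s' &
    forall u, u \in pi -> u != v -> c' u = c u].
Proof.
move=> ex upi piV vpi sc /(conf_split (fun phi : factor => v \in phi.1)).
move=> [c1 [s1 [c2 [s2 [h1 h2 hc ->]]]]] hq; rewrite -/(at_v Phi v) in h1.
rewrite (eliminateE ex); have [hw _ _] := ex.
set B := bag_of V Phi v in hw *; set Q := scope_of V Phi v.
have Bpi : {subset B <= pi}.
  move=> u; rewrite inE => /orP[/eqP-> //|/mem_scope[_ _ [phi]]].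
  by rewrite mem_filter => /andP[_ /sc h] /h.
pose w := [seq u <- pi | u \in B].
have uw : uniq w by exact: filter_uniq.
have wB : w =i B by move=> u; rewrite mem_filter; case: (boolP (u \in B)) => // /Bpi ->.
have wW : w \in words pad B [seq tt | _ <- B].
  apply: hw => //; first by move=> u; rewrite wB.
  by apply: perm_size; apply: uniq_perm => //; exact: bag_uniq.
have h1w : conf w (at_v Phi v) c1 s1.
  apply: conf_restrict h1 => phi hp; rewrite /w -filter_predI; apply: eq_in_filter => u upi'.
  rewrite /=; case: (boolP (u \in phi.1)) => //= up; symmetry; apply: scope_in_bag hp up _.
  exact: piV.
pose e : entry := ([seq (u, 0) | u <- w], 0).
have ew : unzip1 e.1 = w by rewrite /unzip1 -map_comp map_id.
have ea : e \in bag_start pad B by apply: (map_f (fun w => ([seq (u, 0) | u <- w], 0))).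
rewrite -ew in h1w.
have [|x hx hin] := joins_complete ea h1w (q := q).
  move=> p /mapP[u uw' ->] /=; rewrite add0n.
  by have := hq u; rewrite hc => /(_ (Bpi _ _)); rewrite -wB => /(_ uw'); lia.
have eL : [seq (p.1, p.2 + c1 p.1) | p <- e.1] = [seq (u, c1 u) | u <- w].
  by rewrite -map_comp; apply: eq_map => u.
rewrite {}eL in hin.
have fin : ([seq (u, c1 u) | u <- w & u != v], x) \in
   forget v (joins q (bag_start pad B) (at_v Phi v)).
  apply/mapP; exists ([seq (u, c1 u) | u <- w], x) => //=.
  by rewrite filter_map.
have [[M y] hM [/= eM hy]] := prune_dom fin.
have uM : unzip1 M = [seq u <- w | u != v] by rewrite eM /unzip1 -map_comp map_id.
exists (fun u => parent_count M u + c2 u), (y + s2); split.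
- exists (M, y), c2, s2; split=> //=.
    rewrite uM -!filter_predI; apply: eq_in_filter => u upi' /=.
    by rewrite /B /bag_of in_cons -/Q; case: (u == v) => /=; rewrite ?andbF ?andbT.
  apply: conf_restrict h2 => phi; rewrite mem_filter => /andP[vp _].
  rewrite -filter_predI; apply: eq_in_filter => u _ /=.
  by case: (boolP (u \in phi.1)) => //= up; symmetry; apply: contraNneq vp => <-.
- by move: hx => /=; lia.
- move=> u upi' uv; rewrite hc; congr (_ + _); rewrite eM parent_count_graph ?filter_uniq //.
  rewrite mem_filter uv wB /=; case: ifP => // /negbT uB; symmetry; apply: conf_outside h1 _.
  by move=> phi hp; apply: contra uB => up; apply: scope_in_bag hp up _; exact: piV.
Qed.

(** Amalgamation: the table entry comes from a word [w1 ++ v :: w2] on the bag, and [w1 ++ w2] is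
    the trace of [pi] on the scope. Cutting [pi] at a matching place and inserting [v] there leaves
    both traces intact. *)
Lemma eliminate_sound Phi v pi c s : exact_step Phi v -> uniq pi -> {subset pi <= V} ->
  v \notin pi -> v \in V -> scopes_in Phi (v :: pi) ->
  conf pi (eliminate q pad V Phi v) c s -> (forall u, u \in pi -> c u <= q) ->
  exists pi' c', [/\ perm_eq pi' (v :: pi), conf pi' Phi c' s &
    forall u, u \in pi' -> c' u <= q].
Proof.
move=> ex upi piV vpi vV sc; rewrite (eliminateE ex).
set B := bag_of V Phi v; set Q := scope_of V Phi v.
move=> /= [[M y] [c2 [s2 [/= hM uM h2 hc ->]]]] hq.
have /mapP[[L y'] hL [eM ey]] := prune_sub hM; rewrite /= in eM ey; subst y'.
have [e [c1 [s1 [/mapP[w ww ->] /= h1 eL ey fL]]]] := joins_sound hL.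
have [uw wB sw] := words_sound ww; rewrite size_map in sw.
have ew : unzip1 [seq (u, 0) | u <- w] = w by rewrite /unzip1 -map_comp map_id.
rewrite ew in h1.
have {}eL : L = [seq (u, c1 u) | u <- w] by rewrite eL -map_comp; apply: eq_map => u /=.
have {}eM : M = [seq (u, c1 u) | u <- w & u != v] by rewrite eM eL filter_map.
have c1q u : u \in w -> c1 u <= q.
  move=> uw'; have : fits q L by apply: fL; apply/allP => p /mapP[x _ ->].
  by rewrite eL => /allP /(_ (u, c1 u)); apply; apply: map_f.
have wB' : w =i B.
  have [|_ h] := uniq_min_size uw wB; first by rewrite sw.
  exact: h.
have {}uM : [seq u <- w | u != v] = [seq u <- pi | u \in Q].
  by rewrite -uM eM /unzip1 -map_comp map_id.
have vw : v \in w by rewrite wB' mem_head.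
case/splitPr: vw uw wB' uM eM eL c1q h1 {wB ww sw ew hL} => w1 w2 uw wB' uM eM eL c1q h1.
have [vw1 vw2] : v \notin w1 /\ v \notin w2.
  by move: uw; rewrite cat_uniq /= negb_or => /and3P[_ /andP[-> _] /andP[->]].
have ew : [seq u <- w1 ++ v :: w2 | u != v] = w1 ++ w2.
  rewrite filter_cat /= eqxx /=; congr (_ ++ _); apply/all_filterP/allP => u uin;
  by [apply: contraNneq vw1 => <- | apply: contraNneq vw2 => <-].
rewrite ew in uM; have [p1 [p2 [epi e1 e2]]] := split_filter (esym uM).
have notv u : u \in pi -> (u \in B) = (u \in Q).
  by move=> upi'; rewrite inE; case: eqP => // e'; rewrite -e' upi' in vpi.
have fB : [seq u <- p1 ++ v :: p2 | u \in B] = w1 ++ v :: w2.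
  rewrite filter_cat /= mem_head -e1 -e2; congr (_ ++ _ :: _); apply: eq_in_filter => u up;
  by apply: notv; rewrite epi mem_cat up ?orbT.
have pe : perm_eq (p1 ++ v :: p2) (v :: pi).
  by rewrite epi -cat1s perm_catCA.
have mempi u : u \in p1 ++ v :: p2 -> u = v \/ u \in pi.
  by rewrite (perm_mem pe) inE => /orP[/eqP->|]; [left | right].
exists (p1 ++ v :: p2), (fun u => c1 u + c2 u); split=> //.
- apply/(conf_split (fun phi : factor => v \in phi.1)); exists c1, s1, c2, s2; split=> //; last by rewrite ey.
    apply: conf_restrict h1 => phi hp; rewrite -fB -filter_predI; apply: eq_in_filter => u uin /=.
    case: (boolP (u \in phi.1)) => //= up; apply: scope_in_bag hp up _.
    by case: (mempi u uin) => [->|/piV].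
  apply: conf_restrict h2 => phi; rewrite mem_filter => /andP[vp _].
  by rewrite epi !filter_cat /= (negbTE vp).
- move=> u uin; case: (mempi u uin) => [->|upi'].
    rewrite (conf_outside h2) ?addn0; first by apply: c1q; rewrite mem_cat mem_head orbT.
    by move=> phi; rewrite mem_filter => /andP[].
  have := hq u upi'; rewrite hc; apply: leq_trans; rewrite leq_add2r.
  have uv : u != v by apply: contraNneq vpi => <-.
  rewrite eM parent_count_graph ?filter_uniq // mem_filter uv wB' /=.
  case: ifP => // /negbT uB; rewrite (conf_outside h1) // => phi hp.
  by apply: contra uB => up; apply: scope_in_bag hp up _; exact: piV.
Qed.

Fixpoint exact_run (Phi : seq factor) (o : seq nat) : Prop :=
  if o is v :: o' then exact_step Phi v /\ exact_run (eliminate q pad V Phi v) o' else True.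

Lemma eliminate_all_complete Phi o pi c s : exact_run Phi o -> uniq o -> {subset o <= V} ->
  scopes_in Phi o -> perm_eq pi o -> conf pi Phi c s -> (forall u, u \in pi -> c u <= q) ->
  exists c' s', conf [::] (eliminate_all q pad V Phi o) c' s' /\ s <= s'.
Proof.
elim: o Phi pi c s => [|v o IH] Phi pi c s /=.
  by move=> _ _ _ _ /perm_nilP-> h _; exists c, s.
move=> [ex er] /andP[vo uo] oV sc pe h hq.
have upi : uniq pi by rewrite (perm_uniq pe) /= vo.
have vpi : v \in pi by rewrite (perm_mem pe) mem_head.
have piV : {subset pi <= V} by move=> u; rewrite (perm_mem pe) => /oV.
have [|c' [s' [h' ss' cc']]] := eliminate_complete ex upi piV vpi _ h hq.
  by move=> phi hp u /(sc _ hp); rewrite (perm_mem pe).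
have pe' : perm_eq [seq u <- pi | u != v] o.
  have /(perm_filter (fun u => u != v)) := pe; rewrite /= eqxx /=.
  congr (perm_eq _ _); apply/all_filterP/allP => u uo'; by apply: contraNneq vo => <-.
have [|||c2 [s2 [h2 s2']]] := IH _ _ _ _ er uo _ _ pe' h'.
- by move=> u uo'; apply: oV; rewrite inE uo' orbT.
- exact: eliminate_scopes.
- by move=> u; rewrite mem_filter => /andP[uv upi']; rewrite cc' //; apply: hq.
by exists c2, s2; split=> //; apply: leq_trans s2'.
Qed.

Lemma eliminate_all_sound Phi o c s : exact_run Phi o -> uniq o -> {subset o <= V} ->
  scopes_in Phi o -> conf [::] (eliminate_all q pad V Phi o) c s ->
  exists pi c', [/\ perm_eq pi o, conf pi Phi c' s & forall u, u \in pi -> c' u <= q].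
Proof.
elim: o Phi c s => [|v o IH] Phi c s /=.
  by move=> _ _ _ _ h; exists [::], c; split.
move=> [ex er] /andP[vo uo] oV sc h.
have [||pi [c' [pe h' hq]]] := IH _ _ _ er uo _ _ h.
- by move=> u uo'; apply: oV; rewrite inE uo' orbT.
- exact: eliminate_scopes.
have [|||||pi' [c2 [pe' h2 hq2]]] := eliminate_sound ex _ _ _ _ _ h' hq.
- by rewrite (perm_uniq pe).
- by move=> u; rewrite (perm_mem pe) => uo'; apply: oV; rewrite inE uo' orbT.
- by rewrite (perm_mem pe).
- by apply: oV; rewrite mem_head.
- by move=> phi hp u /(sc _ hp); rewrite !inE (perm_mem pe).
by exists pi', c2; split=> //; apply: perm_trans pe' _; rewrite perm_cons.
Qed.
End Eliminate.

Lemma best_ge t (m : entry) : m \in t -> m.1 = [::] -> m.2 <= best t.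
Proof.
elim: t => //= x t IH; rewrite inE => /orP[/eqP<-|/IH{}IH] em; first by rewrite em leq_maxl.
by case: ifP => _; [apply: leq_trans (IH em) (leq_maxr _ _) | apply: IH].
Qed.

Lemma best_mem t (m : entry) : m \in t -> m.1 = [::] -> ([::], best t) \in t.
Proof.
elim: t m => //= -[x1 x2] t IH m /=; rewrite !inE.
case: (boolP (has (fun m : entry => nilp m.1) t)) => [/hasP[m' m't /nilP em'] _ _|/hasPn hn].
  case: ifP => [/nilP->|_]; last by rewrite (IH m') ?orbT.
  by case: leqP => _; rewrite ?eqxx // (IH m') ?orbT.
have b0 : best t = 0.
  elim: t hn {IH} => //= y t IH hn; rewrite (negbTE (hn y (mem_head _ _))).
  by apply: IH => z zt; apply: hn; rewrite inE zt orbT.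
case: ifP => [/nilP-> _ _|nx]; first by rewrite b0 maxn0 eqxx.
move=> /orP[/eqP->|mt] /= em; first by rewrite em in nx.
by have := hn m mt; rewrite em.
Qed.

Lemma conf_nil_total_value Phi c s : conf [::] Phi c s ->
  s <= total_value Phi /\ exists c', conf [::] Phi c' (total_value Phi).
Proof.
elim: Phi c s => [|phi Phi IH] c s /=; first by move=> [h ->]; split=> //; exists c.
move=> [m [c' [s' [h1 h2 /IH[h3 [c2 h4]] _ ->]]]].
have em : m.1 = [::] by case: (m.1) h2.
split; first by apply: leq_add => //; exact: best_ge h1 em.
exists (fun u => 0 + c2 u), ([::], best phi.2), c2, (total_value Phi); split=> //.
exact: best_mem h1 em.
Qed.

(** * Sizes of tables *)

Lemma size_bits_mono m n : m <= n -> size (nat_bits m) <= size (nat_bits n).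
Proof.
have step k : 0 < k -> size (nat_bits k) = (size (nat_bits k./2)).+1.
  move=> k0; rewrite -{1}(odd_double_half k) nat_bitsD; case: ifP => //.
  rewrite nilp_nat_bits => /andP[no /eqP h]; move: (odd_double_half k).
  by rewrite h (negbTE no); lia.
elim/ltn_ind: n m => n IH [|m] le_mn //.
have n0 : 0 < n by lia.
rewrite (step m.+1) // (step n) // ltnS; apply: IH; first by rewrite -divn2 ltn_Pdiv.
exact: half_leq.
Qed.

Lemma esize_bits (n : nat) : (size (nat_bits n)).*2 < esize n <= (size (nat_bits n)).*2.*2.+1.
Proof.
rewrite esize_natE; elim: (nat_bits n) => //= b s IH.
by rewrite esize_cons esize_bool; case: b => /=; lia.
Qed.

(** A digit costs 2 or 4 depending on its value, so sizes are monotone only up to a factor 2. *)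
Lemma esize_mono (m n : nat) : m <= n -> esize m <= (esize n).*2.
Proof.
by move=> /size_bits_mono h; have := esize_bits m; have := esize_bits n; lia.
Qed.

Fixpoint all_words (T : Type) (A : seq T) n : seq (seq T) :=
  if n is n'.+1 then [seq a :: w | a <- A, w <- all_words A n'] else [:: [::]].

Lemma count_words (T : eqType) (A : seq T) n (s : seq (seq T)) : uniq s ->
  (forall w, w \in s -> size w = n /\ {subset w <= A}) -> size s <= size A ^ n.
Proof.
move=> us h.
have -> : size A ^ n = size (all_words A n).
  by elim: n {h} => //= n IH; rewrite size_allpairs -IH expnS.
apply: uniq_leq_size => // w /h[e sw]; elim: n w e sw {h} => [|n IH] [|a w] //= [e] sw.
apply/allpairsP; exists (a, w); split=> //=; first by apply: sw; rewrite mem_head.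
by apply: IH => // x xw; apply: sw; rewrite inE xw orbT.
Qed.

Definition max_value (t : seq entry) := \max_(m <- t) m.2.
(** A bound for all values that elimination does not raise; it ties the sizes of numbers in later
    tables to the input. *)
Definition sum_max (Phi : seq factor) := \sum_(phi <- Phi) max_value phi.2.

Lemma max_value_ge t (m : entry) : m \in t -> m.2 <= max_value t.
Proof. by move=> h; rewrite /max_value (big_rem m) //= leq_maxl. Qed.

Lemma max_value_le t k : (forall m : entry, m \in t -> m.2 <= k) -> max_value t <= k.
Proof.
rewrite /max_value; elim: t => [|x t IH] h; first by rewrite big_nil.
rewrite big_cons geq_max h ?mem_head //=; apply: IH => m hm; apply: h.
by rewrite inE hm orbT.
Qed.

Lemma conf_sum_max pi Phi c s : conf pi Phi c s -> s <= sum_max Phi.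
Proof.
rewrite /sum_max; elim: Phi c s => [|phi Phi IH] c s /=; first by move=> [_ ->].
move=> [m [c' [s' [h1 h2 h3 _ ->]]]]; rewrite big_cons; apply: leq_add (IH _ _ h3).
exact: max_value_ge.
Qed.

Section Tables.
Variables (q : nat) (pad : seq unit) (B : seq nat) (e eq ev : nat).
Hypothesis he : forall b, b \in B -> esize b <= e.
Hypothesis hq : forall c, c <= q -> esize c <= eq.
Let n := size B.
Let N := (n.+1 * q.+1) ^ n.
Let ent := n * (e + eq + 2) + ev + 3.
Hypothesis hpad : N * ent + 1 <= size pad.
Hypothesis ev0 : 0 < ev.

Lemma words_pad : n.+1 ^ n * (n * e.+1 + 2) + 1 <= size pad.
Proof.
apply: leq_trans hpad; rewrite leq_add2r; apply: leq_mul.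
  by apply: leq_exp2r'; rewrite leq_pmulr.
by rewrite /ent; apply: leq_add; [apply: leq_trans (leq_addr _ _); apply: leq_mul; lia | lia].
Qed.

Let acc := bag_start pad B.
Let fB := [seq tt | _ <- B].

Lemma words_bag : size (words pad B fB) <= n.+1 ^ n /\
  forall w, uniq w -> {subset w <= B} -> size w = n -> w \in words pad B fB.
Proof.
have sz : size fB = n by rewrite size_map.
have [|h1 h2] := @words_complete pad B fB e he.
  by rewrite sz; exact: words_pad.
rewrite sz in h1 h2; by split.
Qed.

Lemma joins_entry Phi (m : entry) : m \in joins q acc Phi ->
  [/\ size m.1 = n, forall p, p \in m.1 -> (p.1 \in B) && (p.2 <= q) & m.2 <= sum_max Phi].
Proof.
case: m => L v /joins_sound[x [c [s [/mapP[w ww ->] /= hc eL -> fL]]]].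
have [uw wB sw] := words_sound ww; rewrite size_map in sw.
have fits0 : fits q L by apply: fL; apply/allP => p /mapP[u _ ->].
split; last by rewrite add0n; exact: conf_sum_max hc.
  by rewrite eL !size_map sw.
move=> p pL; rewrite (allP fits0 _ pL) andbT; move: pL; rewrite eL => /mapP[p' /mapP[u uw' ->] ->] /=.
exact: wB.
Qed.

(** Pruning leaves one entry per state, and a state is a word of length n over pairs of a bag vertex
    and a count up to [q]. *)
Lemma joins_size Phi : size (joins q acc Phi) <= N.
Proof.
case/lastP: Phi => [|Phi phi].
  rewrite /joins /= /acc /bag_start size_map; apply: leq_trans (proj1 words_bag) _.
  by apply: leq_exp2r'; rewrite leq_pmulr.
have ent_ := @joins_entry (rcons Phi phi); rewrite /joins foldl_rcons in ent_ *.
rewrite -(size_map fst).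
apply: leq_trans (@count_words _ [seq (b, c) | b <- B, c <- iota 0 q.+1] n _ _ _) _.
- exact: prune_keys.
- move=> L /mapP[m /ent_ [h1 h2 _] ->]; split=> // p /h2 /andP[h3 h4].
  by apply/allpairsP; exists p; rewrite h3 mem_iota /= add0n ltnS h4; split=> //; case: (p).
by rewrite size_allpairs size_iota; apply: leq_exp2r'; rewrite leq_mul2r leqnSn orbT.
Qed.

Lemma esize_entry (L : state) (v : nat) : size L <= n ->
  (forall p, p \in L -> (p.1 \in B) && (p.2 <= q)) -> esize v <= ev -> esize (L, v) < ent.
Proof.
move=> sL hL hv; rewrite esize_pair.
have : esize L <= size L * (e + eq + 1).+1 + 1.
  apply: esize_seq_le => -[u c] /hL /andP[/= /he h1 /hq h2]; rewrite esize_pair; lia.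
have : size L * (e + eq + 1).+1 <= n * (e + eq + 2) by apply: leq_mul; lia.
rewrite /ent; lia.
Qed.

Lemma esize_table (t : seq entry) : size t <= N ->
  (forall m, m \in t -> esize m < ent) -> esize t <= size pad.
Proof.
move=> st ht; apply: leq_trans hpad.
have := @esize_seq_le _ t ent.-1.
have -> : ent.-1.+1 = ent by rewrite prednK // /ent; lia.
move=> h; apply: leq_trans (h _) _; first by move=> m /ht; lia.
by rewrite leq_add2r leq_mul2r st orbT.
Qed.

Variable Phi : seq factor.
Hypothesis hev : forall v, v <= sum_max Phi -> esize v <= ev.

(** Prefixes are needed because [join_all] cuts after every factor. *)
Lemma joins_fit Phi1 Phi2 : Phi = Phi1 ++ Phi2 -> esize (joins q acc Phi1) <= size pad.
Proof.
move=> ePhi; apply: esize_table; first exact: joins_size.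
move=> [L v] /joins_entry[h1 h2 h3]; apply: esize_entry; rewrite ?h1 //.
by apply: hev; apply: leq_trans h3 _; rewrite ePhi /sum_max big_cat leq_addr.
Qed.

Lemma join_all_exact : join_all q pad acc Phi = joins q acc Phi.
Proof.
have: exists Phi2, Phi = Phi ++ Phi2 by exists [::]; rewrite cats0.
move: {2 3 4}Phi => Phi1; elim/last_ind: Phi1 => // Phi1 phi IH [Phi2 e2].
have fit := joins_fit e2; move: fit.
rewrite /join_all /joins !foldl_rcons -/(join_all q pad acc Phi1) -/(joins q acc Phi1) IH.
  exact: size_le_trunc.
by exists (phi :: Phi2); rewrite -cat_rcons.
Qed.

Lemma size_prune s : size (prune s) <= size s.
Proof.
rewrite /prune; elim/last_ind: s => // s x IH; rewrite foldl_rcons size_rcons {1}/put.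
case: ifP => _; first by lia.
by rewrite /= ltnS size_filter; apply: leq_trans (count_size _ _) IH.
Qed.

Lemma forget_exact v : trunc pad (prune (forget v (joins q acc Phi))) =
  prune (forget v (joins q acc Phi)).
Proof.
apply: size_le_trunc; apply: esize_table.
  by apply: leq_trans (size_prune _) _; rewrite size_map; exact: joins_size.
move=> m /prune_sub/mapP[[L x] /joins_entry[h1 h2 h3] ->]; apply: esize_entry => /=.
- by rewrite -h1 size_filter count_size.
- by move=> p; rewrite mem_filter => /andP[_ /h2].
- exact: hev.
Qed.
End Tables.

(** * Scopes and the width of the elimination order *)

Section Exact.
Variables (V : seq nat) (Ed : seq (nat * nat)).
Hypothesis uV : uniq V.
Hypothesis EV : forall a, a \in Ed -> (a.1 \in V) && (a.2 \in V).
Hypothesis Esym : forall u v, (u, v) \in Ed -> (v, u) \in Ed.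
Variables (q : nat) (pad : seq unit) (e eq ev w Tot : nat).
Hypothesis he : forall b, b \in V -> esize b <= e.
Hypothesis hq : forall c, c <= q -> esize c <= eq.
Hypothesis hev : forall v, v <= Tot -> esize v <= ev.
Hypothesis ev0 : 0 < ev.
Hypothesis hpad : (w.+2 * q.+1) ^ w.+1 * (w.+1 * (e + eq + 2) + ev + 3) + 1 <= size pad.

Definition without (a : nat) (r : seq nat) := [seq u <- r | u != a].
(** A walk from [a] to [b] whose inner vertices avoid [r]: adjacency in the fill graph after
    everything outside [r] has been eliminated. *)
Definition linked (r : seq nat) (a b : nat) :=
  exists2 c, c \in component Ed (without a r) a & (c, b) \in Ed.
Definition linked_scopes (Phi : seq factor) r :=
  forall phi : factor, phi \in Phi -> forall a b, a \in phi.1 -> b \in phi.1 -> a != b -> linked r a b.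

Lemma notin_without a r : a \notin without a r.
Proof. by rewrite mem_filter eqxx. Qed.

Lemma linked_tail v r a b : linked (v :: r) a b -> linked r a b.
Proof.
move=> [c hc cb]; exists c => //; apply: component_sub hc; last exact: notin_without.
by move=> u; rewrite /without /=; case: ifP => //; rewrite inE => _ ->; rewrite orbT.
Qed.

Lemma linked_trans v r a b : v \notin r -> a != v ->
  linked (v :: r) a v -> linked (v :: r) v b -> linked r a b.
Proof.
move=> vr av [c1 h1 e1] [c2 h2 e2].
have wv : without v (v :: r) = r.
  rewrite /without /= eqxx /=; apply/all_filterP/allP => u ur; by apply: contraNneq vr => <-.
rewrite wv in h2; exists c2 => //.
have vw : v \notin without a r by rewrite mem_filter (negbTE vr) andbF.
have vc : v \in component Ed (without a r) a.
  apply: component_closed e1 vw; first exact: notin_without.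
  apply: component_sub h1; last exact: notin_without.
  by move=> u; rewrite /without /=; case: ifP => //; rewrite inE => _ ->; rewrite orbT.
apply: component_join vc _ _; first exact: notin_without.
apply: component_sub h2 => //; by move=> u; rewrite mem_filter => /andP[].
Qed.

Lemma scope_linked Phi v r u : linked_scopes Phi r -> u \in scope_of V Phi v ->
  u != v /\ (linked r v u /\ linked r u v).
Proof.
move=> h /mem_scope[_ uv [phi]]; rewrite mem_filter => /andP[vp hp] up; split=> //.
by split; apply: (h phi) => //; rewrite eq_sym.
Qed.

Lemma eliminate_linked Phi v r : v \notin r -> linked_scopes Phi (v :: r) ->
  linked_scopes (eliminate q pad V Phi v) r.
Proof.
move=> vr h phi; rewrite inE => /orP[/eqP->|].
  move=> a b /= /(scope_linked h)[av [_ h1]] /(scope_linked h)[bv [h2 _]] _.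
  exact: linked_trans h1 h2.
rewrite mem_filter => /andP[_ hp] a b ha hb ab; apply: (@linked_tail v); exact: h hp _ _ ha hb ab.
Qed.

Lemma sum_max_split (p : pred factor) Phi :
  sum_max Phi = sum_max [seq phi <- Phi | p phi] + sum_max [seq phi <- Phi | ~~ p phi].
Proof. by rewrite /sum_max !big_filter (bigID p). Qed.

(** The scopes remain cliques of the fill graph, so the scope created for [v] lies in the boundary
    that the width bounds by [w]; bag and table sizes follow. *)
Lemma exact_run_width Phi o : uniq o -> {subset o <= V} -> scopes_in Phi o ->
  linked_scopes Phi o -> sum_max Phi <= Tot -> width_le_order Ed w o ->
  exact_run q pad V Phi o.
Proof.
elim: o Phi => //= v o IH Phi /andP[vo uo] oV sc lk tot wd.
have wv : without v (v :: o) = o.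
  rewrite /without /= eqxx /=; apply/all_filterP/allP => u ur; by apply: contraNneq vo => <-.
have sQ : size (scope_of V Phi v) <= w.
  apply: leq_trans (wd [::] v o erefl); apply: uniq_leq_size; first exact: filter_uniq.
  move=> u uQ; have [uv [[c hc cu] _]] := scope_linked lk uQ; rewrite wv in hc.
  apply/mem_boundary; split; last by exists c => //; exact: Esym.
  move: uQ => /mem_scope[_ _ [phi]]; rewrite mem_filter => /andP[_ /sc h] /h.
  by rewrite inE (negbTE uv).
have sB : size (bag_of V Phi v) <= w.+1 by rewrite /= ltnS.
have tot1 : sum_max (at_v Phi v) <= Tot.
  apply: leq_trans tot; rewrite (sum_max_split (fun phi : factor => v \in phi.1) Phi); exact: leq_addr.
have he' b : b \in bag_of V Phi v -> esize b <= e.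
  rewrite inE => /orP[/eqP->|/mem_scope[bV _ _]]; apply: he => //; apply: oV; exact: mem_head.
have hpad' : ((size (bag_of V Phi v)).+1 * q.+1) ^ size (bag_of V Phi v) *
    (size (bag_of V Phi v) * (e + eq + 2) + ev + 3) + 1 <= size pad.
  apply: leq_trans hpad; rewrite leq_add2r; apply: leq_mul.
    apply: (@leq_trans ((w.+2 * q.+1) ^ size (bag_of V Phi v))).
      by apply: leq_exp2r'; rewrite leq_mul2r ltnS sB orbT.
    by apply: leq_pexp2l.
  by rewrite !leq_add2r leq_mul2r sB orbT.
have hev' x : x <= sum_max (at_v Phi v) -> esize x <= ev by move=> h; apply: hev; apply: leq_trans tot1.
have ex : exact_step q pad V Phi v.
  split.
  - exact: (proj2 (words_bag he' hpad' ev0)).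
  - exact: (join_all_exact he' hq hpad' ev0 hev').
  - exact: (forget_exact he' hq hpad' ev0 hev').
split=> //; apply: IH => //.
- by move=> u uo'; apply: oV; rewrite inE uo' orbT.
- exact: eliminate_scopes.
- exact: eliminate_linked.
- rewrite (eliminateE ex) /sum_max big_cons /=; apply: leq_trans tot.
  rewrite (sum_max_split (fun phi : factor => v \in phi.1) Phi) leq_add2r.
  apply: max_value_le => m /prune_sub/mapP[m' hm' ->] /=.
  by have [_ _] := joins_entry hm'.
- by move=> o1 x o2 eo; apply: (wd (v :: o1)); rewrite /= eo.
Qed.
End Exact.

(** * Acyclic digraphs and orders *)

Lemma acyclic_measure (T : finType) (D : rel T) (m : T -> nat) :
  (forall x y, D x y -> m x < m y) -> acyclic D.
Proof.
move=> h [|x p] //; rewrite /ucycle /= => /andP[cyc _].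
have lt_path q y : path D y q -> q != [::] -> m y < m (last y q).
  elim: q y => //= z q IH y /andP[/h yz pq] _; case: (eqVneq q [::]) => [->|nq] //=.
  exact: ltn_trans yz (IH z pq nq).
have := lt_path _ _ cyc; rewrite last_rcons ltnn -size_eq0 size_rcons => /(_ isT).
by [].
Qed.

Lemma acyclic_order (T : finType) (D : rel T) : acyclic D ->
  exists2 s : seq T, perm_eq s (enum T) & forall x y, D x y -> index x s < index y s.
Proof.
(* The number of vertices from which [y] can be reached increases strictly along arcs of an acyclic
   digraph; sorting by it gives a topological order. *)
move=> acy; pose m y := #|[set x | connect D x y]|.
have mlt x y : D x y -> m x < m y.
  move=> xy; apply: proper_card; apply/properP; split.
    by apply/subsetP => z; rewrite !inE => zx; apply: connect_trans zx (connect1 xy).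
  exists y; first by rewrite inE connect0.
  rewrite inE; apply/negP => /connectP[p pp]; case: (shortenP pp) => p' pp' up' _ ex.
  suff : y :: p' = [::] by [].
  by apply: acy; rewrite /ucycle up' andbT /= rcons_path pp' -ex.
pose le := fun x y => m x <= m y.
have so : sorted le (sort le (enum T)) by apply: sort_sorted => x y; apply: leq_total.
exists (sort le (enum T)); first by rewrite perm_sort.
move=> x y xy; rewrite ltnNge; apply/negP => h.
have : le y x.
  apply: (sorted_leq_index _ _ so) => //; rewrite ?mem_sort ?mem_enum //.
  - by move=> a b c; apply: leq_trans.
  - by move=> a; apply: leqnn.
by rewrite /le leqNgt mlt.
Qed.

Lemma filter_pair (pi : seq nat) x v : uniq pi -> x \in pi -> v \in pi -> x != v ->
  [seq u <- pi | u \in [:: x; v]] = if index x pi < index v pi then [:: x; v] else [:: v; x].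
Proof.
have one y s : uniq s -> y \in s -> x != v -> (y == x) || (y == v) ->
    (forall z, z \in s -> z \in [:: x; v] -> z = y) -> [seq u <- s | u \in [:: x; v]] = [:: y].
  move=> us ys xv hy h; rewrite -[RHS](filter_pred1_uniq us ys); apply: eq_in_filter => z zs /=.
  by apply/idP/eqP => [/(h z zs)//|->]; rewrite !inE.
elim: pi => //= y s IH /andP[ys us]; rewrite !inE.
case: (eqVneq y x) => [exy|nyx] /=.
  subst y => _ /orP[/eqP->|vs xv]; first by rewrite eqxx.
  rewrite (negbTE xv) /=; congr (_ :: _); apply: one => //; first by rewrite eqxx orbT.
  by move=> z zs; rewrite !inE => /orP[] /eqP // e; rewrite -e zs in ys.
move=> xs; case: (eqVneq y v) => [eyv|nyv] /=.
  subst y => _ xv; congr (_ :: _); apply: one => //; first by rewrite eqxx.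
  by move=> z zs; rewrite !inE => /orP[] /eqP // e; rewrite -e zs in ys.
by rewrite ltnS; apply: IH.
Qed.

Section Arcs.
Variables (delta : nat) (pi : seq nat).
Hypothesis upi : uniq pi.

(** Configurations of the arc factors along [pi] are the same as sets of chosen arcs that go forward
    in [pi]. *)
Lemma conf_arcsP As c s : uniq As ->
  (forall a : arc, a \in As -> [/\ a.2.1 \in pi, a.1 \in pi & a.2.1 != a.1]) ->
  conf pi (map (arc_factor delta) As) c s <-> exists ch : pred arc,
   [/\ forall a : arc, a \in As -> ch a -> index a.2.1 pi < index a.1 pi,
       forall u, c u = \sum_(a <- As | ch a && (a.1 == u)) delta &
       s = \sum_(a <- As | ch a) a.2.2].
Proof.
elim: As c s => [|[v [x w]] As IH] c s.
  move=> _ _; split=> /= [[c0 ->]|[ch [_ h ->]]].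
    by exists xpred0; split=> // [u|]; rewrite big_nil.
  by rewrite big_nil; split=> // u; rewrite h big_nil.
move=> /= /andP[nin uAs] hAs.
have hAs' : forall a : arc, a \in As -> [/\ a.2.1 \in pi, a.1 \in pi & a.2.1 != a.1].
  by move=> a aAs; apply: hAs; rewrite inE aAs orbT.
have [xpi vpi xv] := hAs _ (mem_head _ _); rewrite /= in xpi vpi xv.
have fp := filter_pair upi xpi vpi xv.
have {}IH c' s' := IH c' s' uAs hAs'.
split.
  move=> [m [c' [s' [mt um /IH[ch [h1 h2 h3]] h4 ->]]]].
  (* When [delta] and [w] are both 0 the entry that uses the arc equals one that does not; either
     reading then gives the same counts and value. *)
  pose t := (m == ([:: (x, 0); (v, delta)], w)) && (index x pi < index v pi).
  rewrite /= fp in um.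
  have [m1 m2] : (forall u, parent_count m.1 u = if t && (v == u) then delta else 0) /\ m.2 = if t then w else 0.
    rewrite /t; move: mt um; rewrite !inE => /or3P[] /eqP -> /=; case: ltnP => //= hxv um.
    - case: eqP => [[<- <-]|ne] /=; last by split=> // u; case: (x == u); case: (v == u).
      by split=> // u; case: (x == u); case: (v == u).
    - by move: um => [e _]; rewrite e eqxx in xv.
    - by move: um => [e _]; rewrite e eqxx in xv.
    - by rewrite andbF; split=> // u; case: (x == u); case: (v == u).
    - rewrite eqxx; split=> // u /=; case: (eqVneq x u) => [<-|_]; last by case: (v == u); rewrite ?addn0.
      by rewrite eq_sym (negbTE xv).
    - by move: um => [e _]; rewrite e eqxx in xv.
  exists (fun a => if a == (v, (x, w)) then t else ch a); split.
  - by move=> a; rewrite inE; case: eqP => [-> _ /andP[]//|_ /= /h1].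
  - move=> u; rewrite big_cons eqxx /= h4 m1 h2.
    have -> : \sum_(a <- As | (if a == (v, (x, w)) then t else ch a) && (a.1 == u)) delta =
              \sum_(a <- As | ch a && (a.1 == u)) delta.
      rewrite big_seq_cond [RHS]big_seq_cond; apply: eq_bigl => a.
      by case: eqP => [->|//]; rewrite (negbTE nin).
    by case: ifP => // _; rewrite add0n.
  - rewrite big_cons eqxx m2 h3.
    have -> : \sum_(a <- As | if a == (v, (x, w)) then t else ch a) a.2.2 = \sum_(a <- As | ch a) a.2.2.
      rewrite big_seq_cond [RHS]big_seq_cond; apply: eq_bigl => a.
      by case: eqP => [->|//]; rewrite (negbTE nin).
    by case: ifP => // _; rewrite add0n.
move=> [ch [h1 h2 h3]].
pose m : entry := if ch (v, (x, w)) then ([:: (x, 0); (v, delta)], w)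
   else if index x pi < index v pi then ([:: (x, 0); (v, 0)], 0) else ([:: (v, 0); (x, 0)], 0).
exists m, (fun u => \sum_(a <- As | ch a && (a.1 == u)) delta), (\sum_(a <- As | ch a) a.2.2).
split.
- by rewrite /m !inE; case: ifP => _; [|case: ifP => _]; rewrite eqxx ?orbT.
- rewrite /= fp /m; case: ifP => [/(h1 _ (mem_head _ _)) /= -> //|_].
  by case: ifP.
- by apply/IH; exists ch; split=> // a aAs; apply: h1; rewrite inE aAs orbT.
- move=> u; rewrite h2 big_cons /= /m; case: (ch (v, (x, w))) => /=.
    case: (eqVneq v u) => [<-|vu]; first by rewrite (negbTE xv) addn0.
    by case: (x == u).
  by case: ifP => _ /=; case: (x == u); case: (v == u).
- by rewrite h3 big_cons /m; case: ifP => _ //; case: ifP.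
Qed.
End Arcs.

(** * Constants *)

(** From y <= 2^y the left side is at most 2^(c^2 (k+1)^2), and (k+1)^2 <= 4 * 2^k. The successor in
    the exponent gives 1 < C. *)
Lemma padding_constant c : exists2 C, 1 < C &
  forall k, (c * k.+1) ^ (c * k.+1) <= C ^ (2 ^ k).
Proof.
exists (2 ^ (c * c * 4).+1); first by rewrite -{1}(expn0 2) ltn_exp2l.
move=> k; apply: (@leq_trans (2 ^ (c * k.+1 * (c * k.+1)))).
  by rewrite (expnM 2 (c * k.+1) (c * k.+1)); apply: leq_exp2r'; apply: ltnW; apply: ltn_expl.
rewrite -expnM leq_exp2l //.
have sq : k.+1 * k.+1 <= 4 * 2 ^ k.
  have h1 : forall k, k.+3 * 2 + 1 <= 4 * 2 ^ k.+1 by elim=> // j IH; rewrite expnS; lia.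
  by elim: k => // -[|j] IH //; have := h1 j; rewrite [2 ^ j.+2]expnS; lia.
rewrite mulnACA; apply: (@leq_trans (c * c * (4 * 2 ^ k))); first by rewrite leq_mul2l sq orbT.
by rewrite mulnA leq_mul2r leqnSn orbT.
Qed.

Lemma order_padding k C s : 0 < s -> (100 * k.+1) ^ (100 * k.+1) <= C ->
  (8 * k.+1 + 3).+1 ^ ((k.+1).*2.+1) * ((k.+1).*2.+1 * s.+1 + 2) + 1 <= C * s.
Proof.
move=> s0 hC; set x := k.+1; pose b := 100 * x.
have x0 : 0 < x by [].
apply: leq_trans (_ : b ^ (x.*2 + 3) * s <= _); last first.
  rewrite leq_mul2r; apply/orP; right; apply: leq_trans hC; rewrite -/x -/b.
  by apply: leq_pexp2l; rewrite /b; lia.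
have e1 : (8 * x + 3).+1 ^ (x.*2.+1) <= b ^ (x.*2.+1) by apply: leq_exp2r'; rewrite /b; lia.
have e2 : x.*2.+1 * s.+1 + 2 <= b * s by rewrite /b; nia.
have p0 : 0 < b ^ x.*2.+1 by rewrite expn_gt0 /b; lia.
have -> : b ^ (x.*2 + 3) = b ^ (x.*2.+1) * b * b by rewrite -!expnSr; congr (_ ^ _); lia.
apply: leq_trans (leq_add (leq_mul e1 e2) (leqnn 1)) _.
have b1 : 1 < b by rewrite /b; lia.
by move: (b ^ x.*2.+1) p0 b1 s0 => y; clear; move: b => b; nia.
Qed.

(** With x = k + 1 and w = 9x + 4, the table needs the exponent 2(w + 1) + 2 = 18x + 12 of the base
    100x, below the available 100x. The doubled sizes come from [esize_mono]. *)
Lemma table_padding k q C s w : w = 8 * k.+1 + 3 + k.+2 -> 0 < s -> q <= k -> (100 * k.+1) ^ (100 * k.+1) <= C ->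
  (w.+2 * q.+1) ^ w.+1 * (w.+1 * (s + s.*2 + 2) + s.*2 + 3) + 1 <= C * s.
Proof.
move=> hw s0 qk hC; pose x := k.+1; pose b := 100 * x.
have x0 : 0 < x by [].
have wE : w = 9 * x + 4 by rewrite hw /x; lia.
apply: leq_trans (_ : b ^ (w.+1.*2 + 2) * s <= _); last first.
  rewrite leq_mul2r; apply/orP; right; apply: leq_trans hC; rewrite -/x -/b.
  by apply: leq_pexp2l; rewrite /b; lia.
have e1 : (w.+2 * q.+1) ^ w.+1 <= b ^ (w.+1.*2).
  rewrite -muln2 [_ * 2]mulnC expnM; apply: leq_exp2r'; rewrite -mulnn.
  by apply: leq_mul; rewrite /b; lia.
have e2 : w.+1 * (s + s.*2 + 2) + s.*2 + 3 <= b * s.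
  apply: (@leq_trans (w.+1 * (5 * s) + 5 * s)).
    by rewrite -addnA; apply: leq_add; [rewrite leq_mul2l; apply/orP; right; lia | lia].
  by rewrite mulnA -mulnDl leq_mul2r; apply/orP; right; rewrite wE /b; lia.
have p0 : 0 < b ^ (w.+1.*2) by rewrite expn_gt0 /b; lia.
have -> : b ^ (w.+1.*2 + 2) = b ^ (w.+1.*2) * b * b by rewrite -!expnSr; congr (_ ^ _); lia.
apply: leq_trans (leq_add (leq_mul e1 e2) (leqnn 1)) _.
have b1 : 1 < b by rewrite /b; lia.
by move: (b ^ w.+1.*2) p0 b1 s0 => y; clear; move: b => b; nia.
Qed.

(** * Instances *)

Section Instance.
Variable I : bnsl.
Let n := nvert I.
Let F := @local_scores I.

Definition arc_cond (vx : 'I_n * 'I_n) := (vx.2 != vx.1) && (F vx.1 [set vx.2] != 0).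
Definition arc_of (vx : 'I_n * 'I_n) : arc := (val vx.1, (val vx.2, F vx.1 [set vx.2])).
Definition arc_list : seq arc := [seq arc_of vx | vx <- enum {: 'I_n * 'I_n} & arc_cond vx].
Definition target_pair : bool * nat :=
  match target I with Posz m => (false, m) | Negz m => (true, m.+1) end.
Definition inst_data := (iota 0 n, (arc_list, target_pair)).

(** The prescribed encoding is literally the encoding of a typed tuple, so the input needs no
    parsing. *)
Lemma enc_bnslE : enc_bnsl I = enc inst_data.
Proof.
rewrite /enc_bnsl /inst_data encE /= encE /=; congr (Node _ (Node _ _)).
  by rewrite /enc_family [RHS]/enc /= /enc_list /arc_list -map_comp.
by rewrite /enc_int /target_pair; case: (target I).
Qed.

Lemma arc_of_inj : injective arc_of.
Proof. by move=> [a b] [c d] [] /val_inj -> /val_inj ->. Qed.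

Lemma arc_list_uniq : uniq arc_list.
Proof. by rewrite (map_inj_uniq arc_of_inj) filter_uniq // enum_uniq. Qed.

Lemma mem_arc_list a : reflect (exists2 vx, arc_cond vx & a = arc_of vx) (a \in arc_list).
Proof.
apply: (iffP mapP) => [[vx]|[vx h ->]].
  by rewrite mem_filter => /andP[h _] ->; exists vx.
by exists vx => //; rewrite mem_filter h mem_enum.
Qed.

Lemma big_arc_list (p : pred arc) (h : arc -> nat) :
  \sum_(a <- arc_list | p a) h a = \sum_(vx | arc_cond vx && p (arc_of vx)) h (arc_of vx).
Proof. by rewrite big_map big_filter_cond big_enum_cond. Qed.

Let V := iota 0 n.
Let Ed := edges arc_list.

Lemma mem_V u : (u \in V) = (u < n).
Proof. by rewrite mem_iota add0n. Qed.

Lemma edgeP u v : (u, v) \in Ed ->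
  exists i j : 'I_n, [/\ u = val i, v = val j & superstructure F i j].
Proof.
rewrite mem_cat => /orP[] /mapP[a /mem_arc_list[[x y] /andP[/= xy f0] ->]] [-> ->] /=.
  by exists x, y; split=> //; rewrite /superstructure /= eq_sym xy f0 orbT.
by exists y, x; split=> //; rewrite /superstructure /= xy f0.
Qed.

Lemma edge_sym u v : (u, v) \in Ed -> (v, u) \in Ed.
Proof.
rewrite !mem_cat => /orP[] /mapP[a h [-> ->]]; apply/orP; [right | left];
by apply/mapP; exists a.
Qed.

Lemma edge_V a : a \in Ed -> (a.1 \in V) && (a.2 \in V).
Proof. by case: a => u v /edgeP[i [j [-> -> _]]]; rewrite !mem_V !ltn_ord. Qed.

Section Stage.
Variables (delta q k C : nat).
Hypothesis hC : (100 * k.+1) ^ (100 * k.+1) <= C.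
Let i : instance := (delta, (q, inst_data)).
Let K := nseq k tt.
Let padk := nseq C tt.
Let pad := padding padk i.
Let s := esize i.

Lemma size_pad : size pad = C * s.
Proof. by rewrite /pad /padding size_fuel_mul !size_nseq. Qed.
Lemma size_fx : size (fuel_x K) = k.+1. Proof. by rewrite /= size_nseq. Qed.
Lemma size_fa : size (fuel_a K) = (size (fuel_x K)).*2.+1.
Proof. by rewrite /fuel_a /= size_cat /=; lia. Qed.
Lemma size_fs : size (fuel_s K) = 8 * k.+1 + 3.
Proof. by rewrite /fuel_s !size_cat size_fa size_fx; lia. Qed.

Lemma V_esize b : b \in V -> esize b <= s.
Proof.
move=> /(@esize_mem nat b V) h; apply: leq_trans h _.
by rewrite /s /i /inst_data !esize_pair -/V; move: (esize V) => x; lia.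
Qed.

Lemma order_ok : width_le (superstructure F) k -> (stage_order K padk i).1.
Proof.
move=> [T [e [bag [td wd]]]].
apply: (@elim_order_ok V Ed (iota_uniq _ _) edge_V edge_sym _ _ _ _ size_fa s V_esize).
  rewrite size_fa size_fx size_fs -/pad size_pad; apply: order_padding => //; exact: esize_gt0.
move=> S uS SV sS; rewrite size_fs in sS.
pose S' : {set 'I_n} := [set x | val x \in S].
have cS : #|S'| = size S.
  rewrite cardE -(size_map val); apply: perm_size; apply: uniq_perm => //.
    by rewrite map_inj_uniq ?enum_uniq //; exact: val_inj.
  move=> u; apply/mapP/idP => [[x]|uS']; first by rewrite mem_enum inE => h ->.
  have un : u < n by rewrite -mem_V; apply: SV.
  by exists (Ordinal un) => //; rewrite mem_enum inE.
have [|Z [X [cX dX cl hA hB]]] := @tree_separator _ e (let: And4 t _ _ _ := td in t) _ _ bag td k (size (fuel_a K)) S' wd.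
  by rewrite cS size_fa size_fx; lia.
pose vals (A : {set 'I_n}) : seq nat := map val (enum A).
have memv (A : {set 'I_n}) x : (val x \in vals A) = (x \in A).
  by rewrite mem_map ?mem_enum //; exact: val_inj.
have valsE (A : {set 'I_n}) u : u \in vals A -> exists2 x, x \in A & u = val x.
  by move=> /mapP[x]; rewrite mem_enum => h ->; exists x.
have uvals A : uniq (vals A) by rewrite map_inj_uniq ?enum_uniq //; exact: val_inj.
have svals A : size (vals A) = #|A| by rewrite size_map -cardE.
exists (take (size (fuel_a K)) (vals (S' :&: Z))), (take (size (fuel_a K)) (vals (S' :\: (Z :|: X)))),
  (vals X), (mem (vals Z)); split.
- split; [exact: take_uniq | | by rewrite size_takel // svals].
  by move=> u /mem_take /valsE[x]; rewrite inE => /andP[]; rewrite inE => ? _ ->.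
- split; [exact: take_uniq | | by rewrite size_takel // svals].
  by move=> u /mem_take /valsE[x]; rewrite inE => /andP[_]; rewrite inE => ? ->.
- by rewrite svals size_fx.
- split.
  + by move=> u /mem_take /valsE[x]; rewrite inE => /andP[_ xZ] ->; rewrite /= memv xZ.
  + move=> u /mem_take /valsE[x]; rewrite inE => /andP[]; rewrite inE negb_or => /andP[nZ _] _ ->.
    by rewrite /= memv.
  + move=> [u v] /edgeP[x [y [-> -> xy]]] /=; rewrite !memv => xZ.
    by have := cl x y xZ xy; rewrite inE.
Qed.

(** Nothing is assumed about the treewidth: the success flag alone guarantees the width. *)
Lemma order_good : (stage_order K padk i).1 ->
  let o := (stage_order K padk i).2 in
  [/\ uniq o, o =i V & width_le_order Ed (8 * k.+1 + 3 + k.+2) o].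
Proof.
move=> ok /=; have [[[uo oV _] wd] Vo] :=
  elim_order_good (iota_uniq 0 n) edge_V edge_sym size_fa ok.
have -> : 8 * k.+1 + 3 + k.+2 = size (fuel_s K) + (size (fuel_x K)).+1 by rewrite size_fs size_fx.
split; [exact: uo | | exact: wd].
by move=> u; apply/idP/idP => [/oV|/Vo].
Qed.

Hypothesis qk : q <= k.
Hypothesis ok : (stage_order K padk i).1.
Let o := (stage_order K padk i).2.
Let Phi := map (arc_factor delta) arc_list.

Lemma sum_max_arcs : sum_max Phi <= \sum_(a <- arc_list) a.2.2.
Proof.
rewrite /sum_max /Phi big_map; apply: leq_sum => a _; apply: max_value_le => m.
by rewrite !inE => /or3P[] /eqP -> /=.
Qed.

Lemma esize_sum_arcs (As : seq arc) : esize (\sum_(a <- As) a.2.2) <= esize As.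
Proof.
elim: As => [|[v [x w]] As IH]; first by rewrite big_nil.
rewrite big_cons esize_cons !esize_pair; apply: leq_trans (esize_add _ _) _ => /=.
by move: IH; lia.
Qed.

Lemma run_exact : exact_run q pad V Phi o.
Proof.
have [uo oV wd] := order_good ok.
pose Tot := \sum_(a <- arc_list) a.2.2.
have eT : esize Tot <= s.
  by apply: leq_trans (esize_sum_arcs _) _; rewrite /s /i /inst_data !esize_pair; lia.
have eq_ : esize q <= s by rewrite /s /i !esize_pair; lia.
apply: (@exact_run_width V Ed (iota_uniq _ _) edge_sym q pad s s.*2 s.*2
   (8 * k.+1 + 3 + k.+2) Tot V_esize _ _ _ _ _ _ uo).
- by move=> c /esize_mono; lia.
- by move=> c /esize_mono; lia.
- by have := esize_gt0 i; rewrite -/s; lia.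
- by rewrite size_pad; apply: table_padding => //; exact: esize_gt0.
- by move=> u; rewrite oV.
- move=> phi /mapP[a /mem_arc_list[vx _ ->] ->] u /=; rewrite oV mem_V !inE.
  by move=> /orP[] /eqP->; rewrite ltn_ord.
- move=> phi /mapP[a aL ->] u v /=; rewrite !inE => hu hv uv.
  exists u; first exact: component_self.
  rewrite mem_cat; case/orP: hu uv => /eqP->; case/orP: hv => /eqP->; rewrite ?eqxx // => _.
    by apply/orP; right; apply/mapP; exists a.
  by apply/orP; left; apply/mapP; exists a.
- exact: sum_max_arcs.
- exact: wd.
Qed.

(** For [delta = 0] the degree condition is void, for [delta = 1] it is the bound [q]. *)
Definition solution (D : rel 'I_n) :=
  acyclic D /\ forall v, delta * #|parents D v| <= q.

Lemma sum_at (p : pred ('I_n * 'I_n)) v :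
  \sum_(vx | p vx && (val vx.1 == val v)) delta = delta * #|[set x | p (v, x)]|.
Proof.
have -> : \sum_(vx | p vx && (val vx.1 == val v)) delta =
   \sum_(vx : 'I_n * 'I_n | p (vx.1, vx.2) && (val vx.1 == val v)) delta.
  by apply: eq_bigl => -[].
rewrite -(pair_big_dep xpredT (fun v' x => p (v', x) && (val v' == val v)) (fun _ _ => delta)) /=.
rewrite (bigD1 v) //= [X in _ + X]big1 => [|v' nv].
  rewrite addn0 mulnC -sum_nat_const; apply: eq_bigl => x; by rewrite inE eqxx andbT.
by apply: big_pred0 => x; rewrite (inj_eq val_inj) (negbTE nv) andbF.
Qed.

Lemma score_additive (D : rel 'I_n) : (forall v, ~~ D v v) ->
  score F D = \sum_(vx : 'I_n * 'I_n | D vx.2 vx.1) F vx.1 [set vx.2].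
Proof.
move=> nl; rewrite /score -(pair_big_dep xpredT (fun v x => D x v) (fun v x => F v [set x])) /=.
apply: eq_bigr => v _; rewrite [LHS](@scores_additive I v (parents D v)) ?inE //.
by apply: eq_bigl => x; rewrite inE.
Qed.

Lemma arcs_in (pi : seq nat) : pi =i V -> forall a : arc, a \in arc_list ->
  [/\ a.2.1 \in pi, a.1 \in pi & a.2.1 != a.1].
Proof.
move=> piV a /mem_arc_list[vx /andP[h _] ->]; rewrite !piV !mem_V !ltn_ord; split=> //=.
Qed.

Lemma conf_solution pi c t : perm_eq pi o -> conf pi Phi c t ->
  (forall u, u \in pi -> c u <= q) -> exists2 D, solution D & score F D = t.
Proof.
have [uo oV _] := order_good ok; move=> pe.
have upi : uniq pi by rewrite (perm_uniq pe).
have piV : pi =i V by move=> u; rewrite (perm_mem pe) oV.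
move=> /(conf_arcsP delta upi c t arc_list_uniq (arcs_in piV))[ch [h1 h2 ->]] hq.
pose D := [rel x v : 'I_n | arc_cond (v, x) && ch (arc_of (v, x))].
have Dlt x v : D x v -> index (val x) pi < index (val v) pi.
  by move=> /andP[h3 h4]; apply: (h1 (arc_of (v, x))) => //; apply/mem_arc_list; exists (v, x).
have acy : acyclic D by apply: (acyclic_measure (m := fun x => index (val x) pi)).
exists D.
  split=> // v; have := hq (val v); rewrite piV mem_V ltn_ord => /(_ isT).
  rewrite h2 big_arc_list; apply: leq_trans; rewrite leq_eqVlt; apply/orP; left; apply/eqP.
  rewrite -(sum_at (fun vx => arc_cond vx && ch (arc_of vx))).
  by apply: eq_bigl => vx; rewrite andbA.
rewrite score_additive; last by move=> v; rewrite /D /= /arc_cond /= eqxx.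
by rewrite big_arc_list; apply: eq_bigl => -[v x].
Qed.

(** Arcs of score 0 are absent from [arc_list]; dropping them from [D] only lowers in-degrees and
    keeps the score. *)
Lemma solution_conf D : solution D -> exists pi c t,
  [/\ perm_eq pi o, conf pi Phi c t, forall u, u \in pi -> c u <= q & score F D <= t].
Proof.
have [uo oV _] := order_good ok; move=> [acy hq].
have [sq psq lt_sq] := acyclic_order acy.
have nl v : ~~ D v v.
  by apply/negP => vv; have := acy [:: v]; rewrite /ucycle /= vv => /(_ isT).
pose pi := map val sq.
have upi : uniq pi by rewrite (map_inj_uniq val_inj) (perm_uniq psq) enum_uniq.
have mpi (x : 'I_n) : val x \in pi by rewrite (mem_map val_inj) (perm_mem psq) mem_enum.
have piV : pi =i V.
  move=> u; rewrite mem_V; apply/mapP/idP => [[x _ ->]|un]; first exact: ltn_ord.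
  by exists (Ordinal un) => //; rewrite (perm_mem psq) mem_enum.
pose ch (a : arc) := [exists vx : 'I_n * 'I_n, (arc_of vx == a) && D vx.2 vx.1].
have chE vx : ch (arc_of vx) = D vx.2 vx.1.
  apply/existsP/idP => [[y /andP[/eqP/arc_of_inj-> //]]|h].
  by exists vx; rewrite eqxx.
exists pi, (fun u => \sum_(a <- arc_list | ch a && (a.1 == u)) delta),
  (\sum_(a <- arc_list | ch a) a.2.2); split.
- by apply: uniq_perm => // u; rewrite piV oV.
- apply/(conf_arcsP delta upi _ _ arc_list_uniq (arcs_in piV)); exists ch; split=> //.
  move=> a /mem_arc_list[vx _ ->]; rewrite chE => /lt_sq.
  by rewrite /= !(index_map val_inj).
- move=> u; rewrite piV mem_V => un; pose v := Ordinal un.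
  apply: leq_trans (hq v).
  rewrite big_arc_list (eq_bigl (fun vx => (arc_cond vx && D vx.2 vx.1) && (val vx.1 == val v))); last first.
    by move=> vx; rewrite chE andbA.
  rewrite sum_at leq_mul2l; apply/orP; right; apply: subset_leq_card.
  by apply/subsetP => x; rewrite !inE => /andP[].
rewrite big_arc_list (score_additive nl).
rewrite [X in X <= _](bigID (fun vx => arc_cond vx)) /= [X in _ + X]big1 => [|[v x] /andP[/= d]].
  by rewrite addn0 leq_eqVlt; apply/orP; left; apply/eqP; apply: eq_bigl => vx; rewrite chE andbC.
rewrite /arc_cond /= negb_and !negbK => /orP[/eqP e|/eqP //].
by rewrite e (negbTE (nl v)) in d.
Qed.

Lemma stage_value_correct : (exists2 D, solution D & score F D = stage_value padk i o) /\
  forall D, solution D -> score F D <= stage_value padk i o.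
Proof.
have [uo oV _] := order_good ok; have ex := run_exact.
have oV' : {subset o <= V} by move=> u; rewrite oV.
have sc : scopes_in Phi o.
  move=> phi /mapP[a /mem_arc_list[vx _ ->] ->] u /=; rewrite oV mem_V !inE.
  by move=> /orP[] /eqP->; rewrite ltn_ord.
have upper D : solution D -> exists c' s', conf [::] (eliminate_all q pad V Phi o) c' s' /\ score F D <= s'.
  move=> /solution_conf[pi [c [t [pe h hq st]]]].
  have [c' [s' [h' tt']]] := eliminate_all_complete (iota_uniq _ _) ex uo oV' sc pe h hq.
  by exists c', s'; split=> //; apply: leq_trans tt'.
split; last first.
  move=> D /upper[c' [s' [h st]]]; apply: leq_trans st _.
  exact: (proj1 (conf_nil_total_value h)).
(* The empty digraph guarantees that a configuration exists, so the final maxima are attained and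
   not the default 0 of [best]. *)
have sol0 : solution [rel _ _ | false].
  split; first by apply: (acyclic_measure (m := fun=> 0)).
  by move=> v; rewrite (_ : parents _ _ = set0) ?cards0 ?muln0 //; apply/setP => x; rewrite !inE.
have [c' [s' [h _]]] := upper _ sol0.
have [_ [c2 h2]] := conf_nil_total_value h.
have [pi [c3 [pe h3 hq]]] := eliminate_all_sound ex uo oV' sc h2.
exact: conf_solution pe h3 hq.
Qed.
End Stage.

Lemma stage_stop delta q k C : (100 * k.+1) ^ (100 * k.+1) <= C -> q <= k ->
  width_le (superstructure F) k ->
  stage (nseq k tt, (nseq C tt, (delta, (q, inst_data)))) <> [::].
Proof.
move=> hC qk wd; rewrite /stage /= /q_of /= size_nseq qk.
by rewrite (order_ok delta q hC wd).
Qed.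

(** Correct for every [k], even below the treewidth, so the first stage that answers can be
    trusted. *)
Lemma stage_sound delta q k C b : (100 * k.+1) ^ (100 * k.+1) <= C ->
  stage (nseq k tt, (nseq C tt, (delta, (q, inst_data)))) = [:: b] ->
  b <-> exists2 D, solution delta q D & (target I <= (score F D)%:Z)%R.
Proof.
move=> hC; rewrite /stage /= /q_of /= size_nseq; case: ifP => // /andP[qk ok] [<-].
have [[D0 sol0 sc0] upper] := stage_value_correct hC qk ok.
rewrite /target_of /=.
rewrite /target_pair; case: (target I) => m /=.
  split=> [h|[D sol le_m]]; first by exists D0 => //; rewrite sc0 lez_nat.
  by apply: leq_trans (upper D sol); rewrite -lez_nat.
by split=> // _; exists D0.
Qed.
End Instance.

Lemma width_le_treewidth (V : finType) (G : rel V) k : treewidth G <= k -> width_le G k.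
Proof.
rewrite /treewidth; case: ex_minnP => m /asboolP[T [e [bag [td wd]]]] _ mk.
by exists T, e, bag; split=> // t; apply: leq_trans (wd t) _; rewrite ltnS.
Qed.

Theorem theorem7 :
  fpt enc_bnsl bnsl_yes bnsl_treewidth
  /\ fpt enc_bnsl_bounded bnsl_bounded_yes
       (fun I : bnsl_bounded => indeg_bound I + bnsl_treewidth I).
Proof.
have [C C1 hC] := padding_constant 100.
split.
(* With [delta = 0] all counts stay 0, so the bound [q = 0] is always kept and [q <= k] holds at
   every stage. *)
- apply: (@driver bnsl _ enc_bnsl inst_data enc_bnslE (fun j => (0, (0, j))) _ _ C) => //.
  + by pt.
  + move=> I; exists (bnsl_treewidth I) => //; apply: stage_stop => //.
    exact: width_le_treewidth.
  + move=> I k b /(stage_sound (hC k)) ->; split=> [[D [acy _] h]|[D [acy h]]].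
      by exists D.
    by exists D => //; split=> // v; rewrite mul0n.
- apply: (@driver bnsl_bounded _ enc_bnsl_bounded (fun I => (indeg_bound I, inst_data I))
    _ (fun z => (1, (z.1, z.2))) _ _ C) => //.
  + by move=> I; rewrite /enc_bnsl_bounded enc_bnslE.
  + by pt.
  (* The sum of both parameters is at least [q] and at least the treewidth, so this stage passes
     both tests. *)
  + move=> I; exists (indeg_bound I + bnsl_treewidth I) => //; apply: stage_stop => //=.
      exact: leq_addr.
    by apply: width_le_treewidth; exact: leq_addl.
  + move=> I k b /(stage_sound (hC k)) ->; split=> [[D [acy hq] h]|[D [acy hq h]]].
      by exists D; split=> // v; have := hq v; rewrite mul1n.
    by exists D => //; split=> // v; rewrite mul1n.
Qed.
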